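(* Let $(\Omega,\Sigma,\mu)$ be a positive measure space, write $L^p = L^p(\Omega,\Sigma,\mu)$, and let $\sigma \subseteq \mathbb{R}$ be a nonempty compact set. If, for some real number $s>1$, a linear map $T$ defines real $\mathrm{AC}(\sigma)$ operators $T_1$ and $T_s$ on $L^1$ and $L^s$ respectively, then the operator $T_1$ on $L^1$ has a $\mathrm{BV}(\sigma)$ functional calculus.
   Context: For a nonempty compact set $\sigma \subseteq \mathbb{R}$, $\mathrm{BV}(\sigma)$ is the Banach algebra (pointwise operations) of all functions $f:\sigma \to \mathbb{C}$ of bounded variation, i.e. with $\mathrm{var}_\sigma f = \sup \sum_{i=1}^n |f(t_i)-f(t_{i-1})| < \infty$ (supremum over all finite increasing sequences $t_0<\dots<t_n$ in $\sigma$), with norm $\|f\|_{\mathrm{BV}(\sigma)} = \sup_{\sigma}|f| + \mathrm{var}_\sigma f$. $\mathrm{AC}(\sigma)$ is the closure in $\mathrm{BV}(\sigma)$ of the (restrictions to $\sigma$ of) polynomials, with the same norm. An operator $T \in B(X)$ on a Banach space $X$ is a real $\mathrm{AC}(\sigma)$ operator if there is a bounded algebra homomorphism $\mathrm{AC}(\sigma) \to B(X)$, $f \mapsto f(T)$ (necessarily unique), sending $1$ to $I$ and $t\mapsto t$ to $T$. It has a $\mathrm{BV}(\sigma)$ functional calculus if there is a norm continuous algebra homomorphism $\Psi: \mathrm{BV}(\sigma) \to B(X)$ with $\Psi(f) = f(T)$ for all $f \in \mathrm{AC}(\sigma)$. A linear transformation $T$, whose domain $\mathrm{Dom}(T)$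 consists of equivalence classes of measurable functions $\Omega \to \mathbb{C}$, defines a bounded operator on $L^p$ if $L^p \subseteq \mathrm{Dom}(T)$ and there is $K_p<\infty$ with $\|Tx\|_p \le K_p\|x\|_p$ for all $x \in L^p$; $T_p \in B(L^p)$ denotes the restriction of $T$ to $L^p$. *)

(* Defs.v *)
From HB Require Import structures.
From mathcomp Require Import all_boot all_order all_algebra.
From mathcomp Require Import all_classical all_reals all_analysis.
From mathcomp Require Import measurable_realfun complex.

Set Implicit Arguments.
Unset Strict Implicit.
Unset Printing Implicit Defensive.

Import Order.TTheory GRing.Theory Num.Theory.
Import numFieldNormedType.Exports.
Import ComplexField.Normc.

Local Open Scope classical_set_scope.
Local Open Scope ring_scope.
Local Open Scope complex_scope.

(* The norms of R[i] and of a normed module over R[i] take their values in R[i];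
   [normc] and [rnorm] are the corresponding real numbers. *)
Definition rnorm (R : realType) (X : normedModType R[i]) (x : X) : R :=
  complex.Re `|x|.

Section functions_of_bounded_variation.
Context (R : realType) (sigma : set R).
Implicit Types f g : sigma -> R[i].

(* Only the first n + 1 terms of t matter. *)
Definition var f : \bar R :=
  ereal_sup [set v | exists (n : nat) (t : nat -> sigma),
    (forall i : nat, (i < n)%N -> \val (t i) < \val (t i.+1)) /\
    v = (\sum_(i < n) normc (f (t i.+1) - f (t i)))%:E].

Definition BV_fun : set (sigma -> R[i]) := [set f | (var f < +oo)%E].

(* Meaningful on BV_fun sigma, where both terms are finite. *)
Definition BVnorm f : R :=
  fine (ereal_sup (range (fun t => (normc (f t))%:E)) + var f)%E.

Definition poly_fun (p : {poly R[i]}) : sigma -> R[i] :=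
  fun t => p.[(\val t)%:C].

Definition AC_fun : set (sigma -> R[i]) :=
  [set f | BV_fun f /\
    forall e : R, 0 < e -> exists p : {poly R[i]}, BVnorm (f - poly_fun p) < e].

End functions_of_bounded_variation.
Arguments var {R sigma} f.
Arguments BV_fun {R} sigma.
Arguments BVnorm {R sigma} f.
Arguments poly_fun {R} sigma p.
Arguments AC_fun {R} sigma.

Section functional_calculus.
Context (R : realType) (X : normedModType R[i]).

Definition bounded_operator (A : X -> X) : Prop :=
  (forall (a : R[i]) (x y : X), A (a *: x + y) = a *: A x + A y) /\
  exists K : R, forall x, rnorm (A x) <= K * rnorm x.

Definition opnorm (A : X -> X) : R :=
  sup [set rnorm (A x) | x in [set x | rnorm x <= 1]].

Variable sigma : set R.
Implicit Types (F : set (sigma -> R[i])) (Phi : (sigma -> R[i]) -> X -> X).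

(* Phi restricts to an algebra homomorphism F -> B(X); its values outside of
   the function algebra F are irrelevant. *)
Record algebra_hom F Phi : Prop := {
  algebra_hom_bounded : forall f, F f -> bounded_operator (Phi f) ;
  algebra_homD : forall f g, F f -> F g ->
    forall x, Phi (f + g) x = Phi f x + Phi g x ;
  algebra_homZ : forall (a : R[i]) f, F f ->
    forall x, Phi (a *: f) x = a *: Phi f x ;
  algebra_homM : forall f g, F f -> F g ->
    forall x, Phi (f * g) x = Phi f (Phi g x)
}.

Definition bounded_hom F Phi : Prop :=
  exists K : R, forall f, F f -> opnorm (Phi f) <= K * BVnorm f.

Definition norm_continuous F Phi : Prop :=
  forall f, F f -> forall e : R, 0 < e -> exists2 d : R, 0 < d &
    forall g, F g -> BVnorm (g - f) < d -> opnorm (Phi g \- Phi f) < e.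

Record AC_functional_calculus (T : X -> X) Phi : Prop := {
  AC_calculus_hom : algebra_hom (AC_fun sigma) Phi ;
  AC_calculus_bounded : bounded_hom (AC_fun sigma) Phi ;
  AC_calculus1 : forall x, Phi (poly_fun sigma 1) x = x ;
  AC_calculusX : forall x, Phi (poly_fun sigma 'X) x = T x
}.

Definition real_AC_operator (T : X -> X) : Prop :=
  bounded_operator T /\ exists Phi, AC_functional_calculus T Phi.

(* Phi is unique on AC_fun sigma, so that f(T) is Phi f. *)
Definition has_BV_functional_calculus (T : X -> X) : Prop :=
  exists2 Phi, AC_functional_calculus T Phi &
  exists Psi, [/\ algebra_hom (BV_fun sigma) Psi,
    norm_continuous (BV_fun sigma) Psi &
    forall f, AC_fun sigma f -> forall x, Psi f x = Phi f x].

End functional_calculus.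
Arguments real_AC_operator {R X} sigma T.
Arguments has_BV_functional_calculus {R X} sigma T.

Section complex_measurable_functions.
Context d (Omega : measurableType d) (R : realType).

(* Borel measurability of a function into R[i], componentwise. *)
Definition cmeasurable : {pred (Omega -> R[i])} := fun f =>
  `[< measurable_fun setT (fun w => complex.Re (f w)) /\
      measurable_fun setT (fun w => complex.Im (f w)) >].

Lemma cmeasurableP f : reflect
  (measurable_fun setT (fun w => complex.Re (f w)) /\
   measurable_fun setT (fun w => complex.Im (f w))) (f \in cmeasurable).
Proof. exact: asboolP. Qed.

Fact cmeasurable_submod_closed : submod_closed cmeasurable.
Proof.
split.
  by apply/cmeasurableP; split; exact: measurable_cst.
move=> a f g /cmeasurableP[rf imf] /cmeasurableP[rg img]; apply/cmeasurableP.
split.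
- rewrite (_ : (fun w => _) = (fun w => (complex.Re a * complex.Re (f w) -
    complex.Im a * complex.Im (f w)) + complex.Re (g w))); last first.
    apply/funext => w; rewrite /GRing.add /GRing.scale /= /GRing.scale /=.
    by case: a (f w) (g w) => [a1 a2] [f1 f2] [g1 g2].
  apply: measurable_funD => //; apply: measurable_funB;
    apply: measurable_funM => //; exact: measurable_cst.
- rewrite (_ : (fun w => _) = (fun w => (complex.Re a * complex.Im (f w) +
    complex.Im a * complex.Re (f w)) + complex.Im (g w))); last first.
    apply/funext => w; rewrite /GRing.add /GRing.scale /= /GRing.scale /=.
    by case: a (f w) (g w) => [a1 a2] [f1 f2] [g1 g2].
  apply: measurable_funD => //; apply: measurable_funD;
    apply: measurable_funM => //; exact: measurable_cst.
Qed.

HB.instance Definition _ := GRing.isSubmodClosed.Build R[i] (Omega -> R[i])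
  cmeasurable cmeasurable_submod_closed.

Record cmfun := CMfun { cmfun_val :> Omega -> R[i] ;
                        cmfunP : cmfun_val \in cmeasurable }.

HB.instance Definition _ := [isSub for cmfun_val].
HB.instance Definition _ := [Choice of cmfun by <:].
HB.instance Definition _ := [SubChoice_isSubLmodule of cmfun by <:].

End complex_measurable_functions.

Section Lebesgue_spaces.
Context d (Omega : measurableType d) (R : realType).
Variable mu : {measure set Omega -> \bar R}.
Local Notation cmfun := (cmfun Omega R).
Local Open Scope quotient_scope.

Definition cae_eq : rel cmfun := fun f g =>
  `[< (f : Omega -> R[i]) = g %[ae mu] >].

Lemma cae_eqP (f g : cmfun) :
  reflect ({ae mu, forall w, f w = g w}) (cae_eq f g).
Proof.
apply: (iffP (asboolP _)); apply: filterS => w; [exact|by move=> + _].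
Qed.

Fact cae_eq_refl : reflexive cae_eq.
Proof. by move=> f; apply/cae_eqP; exact: nearW. Qed.

Fact cae_eq_sym : symmetric cae_eq.
Proof.
by move=> f g; apply/cae_eqP/cae_eqP; apply: filterS => w ->.
Qed.

Fact cae_eq_trans : transitive cae_eq.
Proof.
move=> g f h /cae_eqP fg /cae_eqP gh; apply/cae_eqP.
by apply: filterS2 fg gh => w -> ->.
Qed.

Canonical cae_eq_canonical :=
  EquivRel cae_eq cae_eq_refl cae_eq_sym cae_eq_trans.

Definition L0 : Type := {eq_quot cae_eq}.
HB.instance Definition _ := Choice.on L0.
HB.instance Definition _ := EqQuotient.on L0.

Lemma L0_eqP (f g : cmfun) :
  \pi_L0 f = \pi_L0 g <-> {ae mu, forall w, f w = g w}.
Proof.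
split; first by move=> /eqmodP/cae_eqP.
by move=> fg; apply/eqmodP/cae_eqP.
Qed.

Lemma L0_reprP (f : cmfun) : {ae mu, forall w, repr (\pi_L0 f) w = f w}.
Proof. by apply/L0_eqP; rewrite reprK. Qed.

Lemma L0W (P : L0 -> Prop) : (forall f, P (\pi_L0 f)) -> forall u, P u.
Proof. by move=> Pf u; rewrite -[u]reprK; exact: Pf. Qed.

Definition L0_add (u v : L0) : L0 := \pi_L0 (repr u + repr v).
Definition L0_opp (u : L0) : L0 := \pi_L0 (- repr u).
Definition L0_scale (a : R[i]) (u : L0) : L0 := \pi_L0 (a *: repr u).

Fact L0_add_pi (f g : cmfun) : L0_add (\pi_L0 f) (\pi_L0 g) = \pi_L0 (f + g).
Proof.
apply/L0_eqP; apply: filterS2 (L0_reprP f) (L0_reprP g) => w fE gE.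
by rewrite /= -[LHS]/(repr (\pi_L0 f) w + repr (\pi_L0 g) w) fE gE.
Qed.

Fact L0_opp_pi (f : cmfun) : L0_opp (\pi_L0 f) = \pi_L0 (- f).
Proof.
apply/L0_eqP; apply: filterS (L0_reprP f) => w fE.
by rewrite /= -[LHS]/(- repr (\pi_L0 f) w) fE.
Qed.

Fact L0_scale_pi a (f : cmfun) : L0_scale a (\pi_L0 f) = \pi_L0 (a *: f).
Proof.
apply/L0_eqP; apply: filterS (L0_reprP f) => w fE.
by rewrite /= -[LHS]/(a *: repr (\pi_L0 f) w) fE.
Qed.

Fact L0_addA : associative L0_add.
Proof.
by elim/L0W => f; elim/L0W => g; elim/L0W => h; rewrite !L0_add_pi addrA.
Qed.

Fact L0_addC : commutative L0_add.
Proof. by elim/L0W => f; elim/L0W => g; rewrite !L0_add_pi addrC. Qed.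

Fact L0_add0 : left_id (\pi_L0 0) L0_add.
Proof. by elim/L0W => f; rewrite L0_add_pi add0r. Qed.

Fact L0_addN : left_inverse (\pi_L0 0) L0_opp L0_add.
Proof. by elim/L0W => f; rewrite L0_opp_pi L0_add_pi addNr. Qed.

HB.instance Definition _ :=
  GRing.isZmodule.Build L0 L0_addA L0_addC L0_add0 L0_addN.

Fact L0_scaleA a b u : L0_scale a (L0_scale b u) = L0_scale (a * b) u.
Proof. by elim/L0W: u => f; rewrite !L0_scale_pi scalerA. Qed.

Fact L0_scale1 : left_id 1 L0_scale.
Proof. by elim/L0W => f; rewrite L0_scale_pi scale1r. Qed.

Fact L0_scaleDr : right_distributive L0_scale +%R.
Proof.
move=> a; elim/L0W => f; elim/L0W => g.
by rewrite -[LHS]/(L0_scale _ (L0_add _ _)) -[RHS]/(L0_add _ _)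
  !(L0_add_pi, L0_scale_pi) scalerDr.
Qed.

Fact L0_scaleDl u : {morph L0_scale^~ u : a b / a + b}.
Proof.
elim/L0W: u => f a b.
by rewrite -[RHS]/(L0_add _ _) !(L0_add_pi, L0_scale_pi) scalerDl.
Qed.

HB.instance Definition _ := GRing.Zmodule_isLmodule.Build R[i] L0
  L0_scaleA L0_scale1 L0_scaleDr L0_scaleDl.

Lemma L0_piD (f g : cmfun) : \pi_L0 (f + g) = \pi_L0 f + \pi_L0 g.
Proof. by rewrite -[RHS]/(L0_add _ _) L0_add_pi. Qed.

Lemma L0_piZ a (f : cmfun) : \pi_L0 (a *: f) = a *: \pi_L0 f.
Proof. by rewrite -[RHS]/(L0_scale _ _) L0_scale_pi. Qed.

Definition cLnorm (p : R) (f : Omega -> R[i]) : \bar R :=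
  'N[mu]_p%:E[(fun w => (normc (f w))%:E)].

Definition L0norm (p : R) (u : L0) : \bar R := cLnorm p (repr u).

Lemma measurable_normc (f : cmfun) : measurable_fun setT (fun w => normc (f w)).
Proof.
have /cmeasurableP[mr mi] := cmfunP f.
have -> : (fun w => normc (f w)) = (fun w => Num.sqrt
    (complex.Re (f w) ^+ 2 + complex.Im (f w) ^+ 2)).
  by apply/funext => w; case: (f w).
apply: (measurableT_comp (f := @Num.sqrt R)).
  exact: (continuous_measurable_fun (@sqrt_continuous R)).
by apply: measurable_funD; exact: measurable_funX.
Qed.

Lemma normc_ge0 (z : R[i]) : 0 <= normc z.
Proof. by case: z => a b; exact: sqrtr_ge0. Qed.

Lemma measurable_normc_powR p (f : cmfun) :
  measurable_fun setT (fun w => (normc (f w) `^ p)%:E).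
Proof.
apply/measurable_EFinP.
exact: (measurableT_comp (measurable_powR p) (measurable_normc f)).
Qed.

Lemma cLnormE p (f : Omega -> R[i]) :
  cLnorm p f = ((\int[mu]_w (normc (f w) `^ p)%:E) `^ p^-1)%E.
Proof.
rewrite /cLnorm unlock; congr (_ `^ _)%E; apply: eq_integral => w _ /=.
by rewrite ger0_norm ?normc_ge0.
Qed.

Lemma eq_cLnorm p (f g : cmfun) : {ae mu, forall w, f w = g w} ->
  cLnorm p f = cLnorm p g.
Proof.
move=> fg; rewrite !cLnormE; congr (_ `^ _)%E.
apply: ae_eq_integral; [by []|exact: measurable_normc_powR..|].
by apply: filterS fg => w fgw _ /=; rewrite fgw.
Qed.

Lemma L0norm_pi p (f : cmfun) : L0norm p (\pi_L0 f) = cLnorm p f.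
Proof. exact/eq_cLnorm/L0_reprP. Qed.

Lemma L0norm_ge0 p u : (0 <= L0norm p u)%E.
Proof. exact: Lnorm_ge0. Qed.

Lemma L0normD p (u v : L0) : 1 <= p ->
  (L0norm p (u + v)%R <= L0norm p u + L0norm p v)%E.
Proof.
move=> p1; elim/L0W: u => f; elim/L0W: v => g; rewrite -L0_piD !L0norm_pi.
have := minkowski_EFin mu (measurable_normc f) (measurable_normc g) p1.
apply: le_trans.
rewrite cLnormE unlock; apply: gt0_ler_poweR.
- by rewrite invr_ge0 (le_trans _ p1).
- by rewrite in_itv /= leey andbT; apply: integral_ge0 => w _;
    rewrite lee_fin powR_ge0.
- by rewrite in_itv /= leey andbT; apply: integral_ge0 => w _;
    rewrite lee_fin powR_ge0.
apply: ge0_le_integral => //.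
- by move=> w _; rewrite lee_fin powR_ge0.
- exact: measurable_normc_powR.
- apply/measurable_EFinP.
  apply: (measurableT_comp (measurable_powR p)).
  apply: measurableT_comp => //.
  by apply: measurable_funD; exact: measurable_normc.
move=> w _ /=; rewrite lee_fin ger0_norm ?addr_ge0 ?normc_ge0//.
apply: ge0_ler_powR; rewrite ?nnegrE ?addr_ge0 ?normc_ge0 ?(le_trans _ p1)//.
exact: le_normcD.
Qed.

Lemma L0normZ p a u : 1 <= p ->
  L0norm p (a *: u)%R = ((normc a)%:E * L0norm p u)%E.
Proof.
move=> p1; elim/L0W: u => f; rewrite -L0_piZ !L0norm_pi.
have p0 : 0 < p by exact: lt_le_trans p1.
rewrite !cLnormE.
under eq_integral do
  rewrite /= /GRing.scale /= normcM powRM ?normc_ge0// EFinM.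
rewrite ge0_integralZl//.
- rewrite poweRM ?integral_ge0 ?lee_fin ?powR_ge0//.
    by rewrite poweR_EFin -powRrM mulfV ?gt_eqF// powRr1 ?normc_ge0.
  by move=> w _; rewrite lee_fin powR_ge0.
- exact: measurable_normc_powR.
- by move=> w _; rewrite lee_fin powR_ge0.
- by rewrite lee_fin powR_ge0.
Qed.

Lemma L0norm_eq0 p u : 0 < p -> L0norm p u = 0%E -> u = 0.
Proof.
move=> p0; elim/L0W: u => f; rewrite L0norm_pi /cLnorm => /Lnorm_eq0_eq0 f0.
apply/L0_eqP; have := f0 _ _; rewrite lte_fin p0 => /(_ _ isT) {}f0.
have : measurable_fun setT (fun w => (normc (f w))%:E).
  exact/measurable_EFinP/measurable_normc.
by move=> /f0; apply: filterS => w /(_ I) [] /eq0_normc.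
Qed.

Lemma L0norm0 p : 0 < p -> L0norm p 0 = 0%E.
Proof.
move=> p0; rewrite L0norm_pi /cLnorm.
rewrite (_ : (fun w => _) = cst 0%E); first by rewrite Lnorm0// gt_eqF.
by apply/funext => w /=; rewrite expr0n /= addr0 sqrtr0.
Qed.

Definition in_Lp (p : R) : set L0 := [set u | (L0norm p u < +oo)%E].

Section Lp.
Variables (p : R) (p1 : 1 <= p).

(* The closure properties below are proved by Minkowski's inequality; the phantom
   argument 1 <= p lets the module structure be inferred. *)
Definition Lp_pred of 1 <= p : {pred L0} := fun u => `[< in_Lp p u >].

Lemma Lp_predP u : reflect (in_Lp p u) (u \in Lp_pred p1).
Proof. exact: asboolP. Qed.

Fact Lp_submod_closed : submod_closed (Lp_pred p1).
Proof.
split; first by apply/Lp_predP; rewrite /in_Lp /= L0norm0// (lt_le_trans _ p1).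
move=> a u v /Lp_predP /= up /Lp_predP /= vp; apply/Lp_predP.
apply: (le_lt_trans (L0normD _ _ p1)).
by rewrite L0normZ// lte_add_pinfty// lte_mul_pinfty// lee_fin normc_ge0.
Qed.

HB.instance Definition _ := GRing.isSubmodClosed.Build R[i] L0
  (Lp_pred p1) Lp_submod_closed.

Record Lp := MkLp { Lp_val :> L0 ; Lp_valP : Lp_val \in Lp_pred p1 }.

HB.instance Definition _ := [isSub for Lp_val].
HB.instance Definition _ := [Choice of Lp by <:].
HB.instance Definition _ := [SubChoice_isSubLmodule of Lp by <:].

Definition Lp_norm (u : Lp) : R[i] := (fine (L0norm p u))%:C.

Lemma Lp_lty (u : Lp) : (L0norm p u < +oo)%E.
Proof. exact/Lp_predP/Lp_valP. Qed.

Lemma Lp_fin (u : Lp) : L0norm p u \is a fin_num.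
Proof. by rewrite ge0_fin_numE ?L0norm_ge0 ?Lp_lty. Qed.

Fact Lp_normD (u v : Lp) : Lp_norm (u + v) <= Lp_norm u + Lp_norm v.
Proof.
rewrite -rmorphD lecR -lee_fin EFinD !fineK ?Lp_fin//; exact: L0normD.
Qed.

Fact Lp_normZ (a : R[i]) (u : Lp) : Lp_norm (a *: u) = `|a| * Lp_norm u.
Proof.
rewrite /Lp_norm (L0normZ _ _ p1) fineM ?Lp_fin//.
by rewrite rmorphM; congr (_ * _); case: a.
Qed.

Fact Lp_norm_eq0 (u : Lp) : Lp_norm u = 0 -> u = 0.
Proof.
move=> [u0]; apply/val_inj/(@L0norm_eq0 p); first exact: lt_le_trans p1.
by rewrite -[LHS]fineK ?Lp_fin// u0.
Qed.

HB.instance Definition _ := Lmodule_isNormed.Build R[i] Lp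
  Lp_normD Lp_normZ Lp_norm_eq0.

End Lp.

(* A linear map from a subspace of L0 to L0; the values of [lt_map] outside
   of [lt_dom] are irrelevant. *)
Record linear_transformation := LinearTransformation {
  lt_dom : set L0 ;
  lt_map :> L0 -> L0 ;
  lt_dom0 : lt_dom 0 ;
  lt_dom_linear : forall (a : R[i]) u v,
    lt_dom u -> lt_dom v -> lt_dom (a *: u + v) ;
  lt_linear : forall (a : R[i]) u v, lt_dom u -> lt_dom v ->
    lt_map (a *: u + v) = a *: lt_map u + lt_map v
}.

Definition defines_bounded_operator (p : R) (T : linear_transformation) : Prop :=
  in_Lp p `<=` lt_dom T /\
  exists K : R, forall u, in_Lp p u -> (L0norm p (T u) <= K%:E * L0norm p u)%E.

Fact restriction_subproof p (p1 : 1 <= p) T :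
  defines_bounded_operator p T -> forall u : Lp p1, T u \in Lp_pred p1.
Proof.
move=> [_ [K TK]] u; apply/Lp_predP; apply: (le_lt_trans (TK _ (Lp_lty u))).
by rewrite -(fineK (Lp_fin u)) -EFinM ltry.
Qed.

Definition Lp_restriction p (p1 : 1 <= p) T (Tp : defines_bounded_operator p T)
  (u : Lp p1) : Lp p1 := MkLp (restriction_subproof Tp u).

End Lebesgue_spaces.
Arguments Lp {d Omega R} mu {p} p1.
Arguments Lp_restriction {d Omega R mu p} p1 {T} Tp u.

(* Main.v *)
Require Import Defs.
From mathcomp Require Import all_boot all_order all_algebra.
From mathcomp Require Import all_classical all_reals all_analysis.
From mathcomp Require Import measurable_realfun complex ring lra.
Import Order.TTheory GRing.Theory Num.Theory.
Import numFieldNormedType.Exports.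
Local Open Scope classical_set_scope.
Local Open Scope ring_scope.

Set Implicit Arguments.
Unset Strict Implicit.
Unset Printing Implicit Defensive.
Import ComplexField.Normc.
Local Open Scope complex_scope.

(** The reason why the theorem holds: for 1 < s the space L^s is uniformly convex
    and complete, and this alone turns the AC functional calculus of T_s into a
    BV calculus f |-> f(T_s) such that each f(T_s) x is a norm limit of vectors
    h(T_s) x with h in AC and ||h|| <= 2 ||f||.  If x is also in L^1, the vectors
    h(T_1) x = h(T_s) x stay bounded in L^1 by a multiple of ||f|| ||x||_1, hence
    so does their limit, by Fatou's lemma; and such x are dense in L^1.  So f(T_s) extends by continuity to L^1, and the algebraic identities
    pass from L^s to L^1.

    The BV calculus on a uniformly convex complete space X comes from one
    estimate, [small_off_finite]: for x in X and e > 0 there is a finite subset F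
    of sigma with ||h(T) x|| <= e ||h|| for all h in AC vanishing on F.  It says
    that, on bounded subsets of AC, the map h |-> h(T) x is uniformly continuous
    for pointwise convergence.  Piecewise linear interpolation
    ([BV_interpolant]) puts every f in BV in the pointwise closure of the functions
    of AC of norm at most 2 ||f||, so f(T) x can be defined by continuity
    ([BV_extension]); products are preserved because the approximation is in norm
    and the approximating operators are bounded.

    The estimate is local.  Let g_n be cutoffs that shrink to a point c of sigma
    from one side, with g_n g_m = g_m for n < m.  Then g_n(T) x is a Cauchy
    sequence ([nested_cauchy]); this is the only use of uniform convexity, and it
    replaces the weak compactness argument available in reflexive spaces.  If h in
    AC is supported on that side of c and vanishes at c, then h g_n tends to 0
    in BV, so that h(T) x is the limit of h(T) (g_N(T) x - g_n(T) x) when g_N is 1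
    on the support of h: it is small once N is large ([local_smallness]).
    Thus sigma is cut into finitely many pieces where the estimate holds, and the
    variations of h over these pieces add up to at most the variation of h.

    For L^s, uniform convexity ([Lp_uniformly_convex]) is the integrated form of a
    pointwise inequality between |a - b|^s and the convexity defect
    (|a|^s + |b|^s) / 2 - |(a + b) / 2|^s ([pointwise_convexity]). *)

(** * Variation along chains *)

Section real_and_complex.
Context (R : realType).

Lemma normc_real (x : R) : normc x%:C = `|x|.
Proof. by rewrite /= expr0n addr0 sqrtr_sqr. Qed.

Lemma normc_half : normc (2^-1)%:C = 2^-1 :> R.
Proof. by rewrite normc_real ger0_norm. Qed.

Lemma invS_small (e : R) : 0 < e ->
  exists N, forall n, (N <= n)%N -> n.+1%:R^-1 <= e.
Proof.
move=> e0; exists (Num.bound e^-1) => n Nn.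
rewrite -[e]invrK lef_pV2 ?posrE ?invr_gt0//.
apply: ltW; apply: (lt_le_trans (archi_boundP _)); first by rewrite invr_ge0 ltW.
by rewrite ler_nat leqW.
Qed.

End real_and_complex.

Section bounded_variation.
Context (R : realType) (sigma : set R).
Implicit Types (f g : sigma -> R[i]) (a b : R) (n : nat).

(** Chains are not required to increase strictly: images of chains under
    monotone maps are then chains again, even where the map is constant. *)
Definition chain n (t : nat -> sigma) := forall i, (i < n)%N -> \val (t i) <= \val (t i.+1).

Definition chain_sum f n (t : nat -> sigma) : R := \sum_(i < n) normc (f (t i.+1) - f (t i)).

(** Repeated points contribute zero terms and can be deleted. *)
Lemma chain_strict f n t : chain n t -> exists m (u : nat -> sigma),
  [/\ forall i, (i < m)%N -> \val (u i) < \val (u i.+1), u m = t n &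
      chain_sum f n t = chain_sum f m u].
Proof.
elim: n => [|n IHn] tn; first by exists 0%N, t; split=> //; rewrite /chain_sum !big_ord0.
have [|m [u [um umn uE]]] := IHn.
  by move=> i ilt; apply: tn; exact: ltnW.
have := tn n (ltnSn n); rewrite le_eqVlt => /orP[/eqP/val_inj tE|tlt].
  exists m, u; split=> //; first by rewrite umn tE.
  by rewrite {1}/chain_sum big_ord_recr /= tE subrr normc0 addr0.
exists m.+1, (fun i => if (i <= m)%N then u i else t n.+1); split.
- move=> i; rewrite ltnS /= => im; rewrite im; case: ltnP => [|mi]; first exact: um.
  by rewrite (_ : i = m) ?umn//; apply/eqP; rewrite eqn_leq im mi.
- by rewrite ltnn.
- rewrite /chain_sum !big_ord_recr /= -/(chain_sum f n t) uE ltnn leqnn umn.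
  congr (_ + _); apply: eq_bigr => i _ /=.
  by rewrite (ltnW (ltn_ord i)) ltn_ord.
Qed.

(** Keeping the bounds of the modulus and of the variation apart, as two real
    numbers, makes the estimates for products and compositions elementary; the
    least value of a + b is the BV norm, by [BVnorm_le] and [BV_bounded_by]. *)
Record bounded_by f a b : Prop := BoundedBy {
  bnd_sup : forall t, normc (f t) <= a ;
  bnd_chain : forall n t, chain n t -> chain_sum f n t <= b }.

Lemma var_le f b : (var f <= b%:E)%E <->
  forall n t, chain n t -> chain_sum f n t <= b.
Proof.
split=> [fb n t /(chain_strict f)[m [u [um _ ->]]]|fb].
  rewrite -lee_fin; apply: le_trans fb; apply: ereal_sup_ubound.
  by exists m, u.
apply: ub_ereal_sup => _ [n [t [tn ->]]]; rewrite lee_fin; apply: fb.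
by move=> i /tn/ltW.
Qed.

Lemma chain_osc f b (s t : sigma) :
  (forall n u, chain n u -> chain_sum f n u <= b) -> normc (f s - f t) <= b.
Proof.
move=> fb; have [st|/ltW st] := leP (\val s) (\val t).
  have := fb 1%N (fun i => if i == 0%N then s else t).
  by rewrite /chain_sum big_ord1 /= -normcN opprB; apply; case.
have := fb 1%N (fun i => if i == 0%N then t else s).
by rewrite /chain_sum big_ord1 /=; apply; case.
Qed.

Lemma var_ge0 f : sigma !=set0 -> (0 <= var f)%E.
Proof.
move=> [c sc]; apply: ereal_sup_ubound; exists 0%N, (fun=> exist _ c (mem_set sc)).
by split=> //; rewrite big_ord0.
Qed.

Hypothesis sigma0 : sigma !=set0.

Let t0 : sigma := exist _ (projT1 (cid sigma0)) (mem_set (projT2 (cid sigma0))).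

Lemma bounded_by_BV f a b : bounded_by f a b -> BV_fun sigma f.
Proof. by case=> _ /var_le fb; apply: (le_lt_trans fb); rewrite ltry. Qed.

Lemma BVnorm_le f a b : bounded_by f a b -> BVnorm f <= a + b.
Proof.
case=> fa /var_le fb; rewrite /BVnorm.
have ha : (ereal_sup (range (fun t => (normc (f t))%:E)) <= a%:E)%E.
  by apply: ub_ereal_sup => _ [t _ <-]; rewrite lee_fin.
have h0 : (0 <= ereal_sup (range (fun t => (normc (f t))%:E)))%E.
  apply: (@le_trans _ _ (normc (f t0))%:E); first by rewrite lee_fin normc_ge0.
  by apply: ereal_sup_ubound; exists t0.
rewrite -lee_fin fineK ?EFinD ?leeD//.
rewrite ge0_fin_numE ?adde_ge0 ?var_ge0//.
by apply: (le_lt_trans (leeD ha fb)); rewrite -EFinD ltry.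
Qed.

Lemma BV_bounded_by f : BV_fun sigma f -> exists a b,
  bounded_by f a b /\ a + b = BVnorm f.
Proof.
move=> fBV; have vfin : var f \is a fin_num by rewrite ge0_fin_numE ?var_ge0.
set S := ereal_sup (range (fun t => (normc (f t))%:E)).
have h0 : (0 <= S)%E.
  apply: (@le_trans _ _ (normc (f t0))%:E); first by rewrite lee_fin normc_ge0.
  by apply: ereal_sup_ubound; exists t0.
have fv : forall n t, chain n t -> chain_sum f n t <= fine (var f).
  by apply/var_le; rewrite fineK.
have Sfin : S \is a fin_num.
  rewrite ge0_fin_numE//; apply: (@le_lt_trans _ _ (normc (f t0) + fine (var f))%:E).
    apply: ub_ereal_sup => _ [t _ <-]; rewrite lee_fin.
    rewrite -[f t](subrK (f t0)) addrC (le_trans (le_normcD _ _))// lerD2l.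
    exact: chain_osc.
  exact: ltry.
exists (fine S), (fine (var f)); split; last by rewrite /BVnorm fineD.
split=> // t; rewrite -lee_fin fineK//; apply: ereal_sup_ubound; by exists t.
Qed.

Lemma bounded_by_ge0 f a b : bounded_by f a b -> 0 <= a /\ 0 <= b.
Proof.
case=> fa fb; split; first exact: le_trans (normc_ge0 _) (fa t0).
by have := fb 0%N (fun=> t0); rewrite /chain_sum big_ord0; apply.
Qed.

Lemma bounded_byD f g a b a' b' : bounded_by f a b -> bounded_by g a' b' ->
  bounded_by (f + g) (a + a') (b + b').
Proof.
case=> fa fb [ga gb]; split=> [t|n t tn].
  by apply: (le_trans (le_normcD _ _)); exact: lerD.
apply: le_trans (lerD (fb _ _ tn) (gb _ _ tn)); rewrite /chain_sum -big_split /=.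
apply: ler_sum => i _; apply: le_trans (le_normcD _ _).
by rewrite -[in leLHS]/(f _ + g _ - (f _ + g _)) opprD addrACA.
Qed.

Lemma bounded_byM f g a b a' b' : bounded_by f a b -> bounded_by g a' b' ->
  bounded_by (f * g) (a * a') (a * b' + b * a').
Proof.
move=> fab gab; have [a0 b0] := bounded_by_ge0 fab.
have [a0' b0'] := bounded_by_ge0 gab.
case: fab gab => fa fb [ga gb]; split=> [t|n t tn].
  by rewrite /= normcM ler_pM ?normc_ge0.
apply: le_trans (lerD (ler_wpM2l a0 (gb _ _ tn)) (ler_wpM2r a0' (fb _ _ tn))).
rewrite /chain_sum mulr_sumr mulr_suml -big_split /=.
apply: ler_sum => i _.
have -> : (f * g) (t i.+1) - (f * g) (t i) =
    f (t i.+1) * (g (t i.+1) - g (t i)) + (f (t i.+1) - f (t i)) * g (t i).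
  by rewrite mulrBr mulrBl addrA subrK.
apply: (le_trans (le_normcD _ _)); rewrite !normcM; apply: lerD.
  by rewrite ler_wpM2r ?normc_ge0.
by rewrite ler_wpM2l ?normc_ge0.
Qed.

Lemma bounded_by_cst (c : R[i]) : bounded_by (fun=> c) (normc c) 0.
Proof.
by split=> // n t _; rewrite /chain_sum big1// => i _; rewrite subrr normc0.
Qed.

Lemma bounded_byZ (c : R[i]) f a b : bounded_by f a b ->
  bounded_by (c *: f) (normc c * a) (normc c * b).
Proof.
move=> fab; have := bounded_byM (bounded_by_cst c) fab.
by rewrite mul0r addr0; congr bounded_by.
Qed.

Lemma bounded_byN f a b : bounded_by f a b -> bounded_by (- f) a b.
Proof.
case=> fa fb; split=> [t|n t tn]; first by rewrite /= normcN.
apply: le_trans (fb _ _ tn); apply: ler_sum => i _.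
by rewrite -[in leLHS]/(- f _ - - f _) -opprD normcN.
Qed.

Lemma bounded_byB f g a b a' b' : bounded_by f a b -> bounded_by g a' b' ->
  bounded_by (f - g) (a + a') (b + b').
Proof. by move=> fab /bounded_byN; exact: bounded_byD. Qed.

Lemma bounded_by_comp (r : sigma -> sigma) f a b :
  (forall s t, \val s <= \val t -> \val (r s) <= \val (r t)) ->
  bounded_by f a b -> bounded_by (f \o r) a b.
Proof.
move=> rm [fa fb]; split=> [t|n t tn]; first exact: fa.
by apply: (fb n (r \o t)) => i /tn/rm.
Qed.

(** The increments along a chain have one sign, so their sum telescopes. *)
Lemma bounded_by_monotone (u : sigma -> R) (l h : R) :
  (forall s t, \val s <= \val t -> u s <= u t) ->
  (forall t, l <= u t <= h) ->
  forall c, `|l| <= c -> `|h| <= c -> bounded_by (fun t => (u t)%:C) c (h - l).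
Proof.
move=> um ulh c lc hc; split=> [t|n t tn].
  rewrite normc_real; have /andP[lu uh] := ulh t.
  rewrite ler_norml (le_trans _ lu) ?(le_trans uh)//.
    by rewrite (le_trans _ hc)// ler_norm.
  by rewrite lerNl (le_trans _ lc)// -normrN ler_norm.
have -> : chain_sum (fun t => (u t)%:C) n t = u (t n) - u (t 0%N).
  rewrite -(telescope_sumr (fun i => u (t i)) (leq0n n)) big_mkord.
  apply: eq_bigr => i _.
  rewrite -rmorphB normc_real ger0_norm//.
  by rewrite subr_ge0 um// tn.
have /andP[_ h1] := ulh (t n); have /andP[h2 _] := ulh (t 0%N); lra.
Qed.

Lemma bounded_by_antitone (u : sigma -> R) (l h : R) :
  (forall s t, \val s <= \val t -> u t <= u s) ->
  (forall t, l <= u t <= h) ->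
  forall c, `|l| <= c -> `|h| <= c -> bounded_by (fun t => (u t)%:C) c (h - l).
Proof.
move=> um ulh c lc hc.
have umN s t : \val s <= \val t -> - u s <= - u t by move=> /um; rewrite lerN2.
have ulhN t : - h <= - u t <= - l by rewrite !lerN2 andbC.
have hcN : `|- h| <= c by rewrite normrN.
have lcN : `|- l| <= c by rewrite normrN.
have := bounded_byN (bounded_by_monotone umN ulhN hcN lcN).
rewrite opprK addrC; congr bounded_by; apply/funext => t.
by rewrite -[LHS]/(- (- u t)%:C) rmorphN opprK.
Qed.

(** The retractions of sigma onto its parts below and above c.  Composing with
    them cuts a function at c without leaving AC, unlike multiplying by the
    indicator of a half-line. *)
Definition smin (c t : sigma) : sigma := if \val t <= \val c then t else c.
Definition smax (c t : sigma) : sigma := if \val t <= \val c then c else t.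

Lemma val_smin c t : \val (smin c t) = Num.min (\val t) (\val c).
Proof. by rewrite /smin; case: leP. Qed.

Lemma val_smax c t : \val (smax c t) = Num.max (\val t) (\val c).
Proof. by rewrite /smax; case: leP. Qed.

Lemma smin_homo c s t : \val s <= \val t -> \val (smin c s) <= \val (smin c t).
Proof. by rewrite !val_smin => st; rewrite le_min2//. Qed.

Lemma smax_homo c s t : \val s <= \val t -> \val (smax c s) <= \val (smax c t).
Proof. by rewrite !val_smax => st; rewrite le_max2//. Qed.

(** A chain pushed below c followed by a chain pushed above c is a single chain;
    hence the variations on both sides of c add up to at most the variation. *)
Lemma chain_sum_split f b c n m t u :
  (forall n t, chain n t -> chain_sum f n t <= b) ->
  chain n t -> chain m u ->
  chain_sum (f \o smin c) n t + chain_sum (f \o smax c) m u <= b.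
Proof.
move=> fb tn um.
(* The first n + 1 points come from t, and the next ones from u; the step from
   t n to u 0 only adds a nonnegative term. *)
pose w i := if (i <= n)%N then smin c (t i) else smax c (u (i - n.+1)%N).
have wch : chain (n.+1 + m) w.
  move=> i ilt; rewrite /w; case: (ltnP i n) => [ilt'|].
    by rewrite (ltnW ilt'); apply: smin_homo; exact: tn.
  rewrite leq_eqVlt => /orP[/eqP <-|ni]; first rewrite leqnn.
    by rewrite val_smin val_smax ge_min !le_max lexx !orbT.
  rewrite leqNgt ni /=; apply: smax_homo; rewrite subSn//; apply: um.
  by rewrite ltn_subLR.
apply: le_trans (fb _ _ wch).
rewrite /chain_sum [leRHS]big_split_ord /= big_ord_recr /= -addrA; apply: lerD.
  apply: ler_sum => i _; rewrite /w ltn_ord (ltnW (ltn_ord i)); exact: lexx.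
rewrite -[leLHS]add0r; apply: lerD; first exact: normc_ge0.
have wE k : w (n.+1 + k)%N = smax c (u k).
  by rewrite /w leqNgt leq_addr /= addKn.
by apply: ler_sum => i _; rewrite /= -addnS !wE.
Qed.

End bounded_variation.

(** * The algebras BV and AC *)

Section absolutely_continuous.
Context (R : realType) (sigma : set R).
Hypothesis sigma0 : sigma !=set0.
Implicit Types (f g : sigma -> R[i]) (p q : {poly R[i]}).

Lemma BVnorm_sup f s : BV_fun sigma f -> normc (f s) <= BVnorm f.
Proof.
move=> /(BV_bounded_by sigma0)[a [b [fab <-]]].
have [_ b0] := bounded_by_ge0 sigma0 fab.
by rewrite (le_trans (bnd_sup fab s))// lerDl.
Qed.

Lemma BVnorm_ge0 f : BV_fun sigma f -> 0 <= BVnorm f.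
Proof.
move=> /(BV_bounded_by sigma0)[a [b [fab <-]]].
by have [a0 b0] := bounded_by_ge0 sigma0 fab; rewrite addr_ge0.
Qed.

Lemma BV_funD f g : BV_fun sigma f -> BV_fun sigma g -> BV_fun sigma (f + g).
Proof.
move=> /(BV_bounded_by sigma0)[a [b [fab _]]] /(BV_bounded_by sigma0)[a' [b' [gab _]]].
exact: bounded_by_BV (bounded_byD fab gab).
Qed.

Lemma BVnormD f g : BV_fun sigma f -> BV_fun sigma g ->
  BVnorm (f + g) <= BVnorm f + BVnorm g.
Proof.
move=> /(BV_bounded_by sigma0)[a [b [fab <-]]] /(BV_bounded_by sigma0)[a' [b' [gab <-]]].
by rewrite addrACA; exact: BVnorm_le (bounded_byD fab gab).
Qed.

Lemma BV_funN f : BV_fun sigma f -> BV_fun sigma (- f).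
Proof.
move=> /(BV_bounded_by sigma0)[a [b [fab _]]].
exact: bounded_by_BV (bounded_byN fab).
Qed.

Lemma BVnormN f : BV_fun sigma f -> BVnorm (- f) <= BVnorm f.
Proof.
move=> /(BV_bounded_by sigma0)[a [b [fab <-]]].
exact: BVnorm_le (bounded_byN fab).
Qed.

Lemma BV_funB f g : BV_fun sigma f -> BV_fun sigma g -> BV_fun sigma (f - g).
Proof. by move=> fBV /BV_funN; exact: BV_funD. Qed.

Lemma BVnormB f g : BV_fun sigma f -> BV_fun sigma g ->
  BVnorm (f - g) <= BVnorm f + BVnorm g.
Proof.
move=> fBV gBV; apply: (le_trans (BVnormD fBV (BV_funN gBV))).
by rewrite lerD2l BVnormN.
Qed.

Lemma BVnormBC f g : BV_fun sigma f -> BV_fun sigma g ->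
  BVnorm (f - g) = BVnorm (g - f).
Proof.
move=> fBV gBV; apply/le_anti/andP; split.
  by rewrite -opprB BVnormN//; exact: BV_funB.
by rewrite -(opprB f) BVnormN//; exact: BV_funB.
Qed.

Lemma BV_funM f g : BV_fun sigma f -> BV_fun sigma g -> BV_fun sigma (f * g).
Proof.
move=> /(BV_bounded_by sigma0)[a [b [fab _]]] /(BV_bounded_by sigma0)[a' [b' [gab _]]].
exact: bounded_by_BV (bounded_byM sigma0 fab gab).
Qed.

Lemma BVnormM f g : BV_fun sigma f -> BV_fun sigma g ->
  BVnorm (f * g) <= BVnorm f * BVnorm g.
Proof.
move=> /(BV_bounded_by sigma0)[a [b [fab <-]]] /(BV_bounded_by sigma0)[a' [b' [gab <-]]].
have [a0 b0] := bounded_by_ge0 sigma0 fab.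
have [a0' b0'] := bounded_by_ge0 sigma0 gab.
apply: (le_trans (BVnorm_le sigma0 (bounded_byM sigma0 fab gab))).
have : 0 <= b * b' by rewrite mulr_ge0.
lra.
Qed.

Lemma BV_funZ (c : R[i]) f : BV_fun sigma f -> BV_fun sigma (c *: f).
Proof.
move=> /(BV_bounded_by sigma0)[a [b [fab _]]].
exact: bounded_by_BV (bounded_byZ sigma0 c fab).
Qed.

Lemma BVnormZ (c : R[i]) f : BV_fun sigma f ->
  BVnorm (c *: f) <= normc c * BVnorm f.
Proof.
move=> /(BV_bounded_by sigma0)[a [b [fab <-]]].
by rewrite mulrDr; exact: BVnorm_le (bounded_byZ sigma0 c fab).
Qed.

Lemma BV_fun_comp (r : sigma -> sigma) f :
  (forall s t, \val s <= \val t -> \val (r s) <= \val (r t)) ->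
  BV_fun sigma f -> BV_fun sigma (f \o r).
Proof.
move=> rm /(BV_bounded_by sigma0)[a [b [fab _]]].
exact: bounded_by_BV (bounded_by_comp rm fab).
Qed.

Lemma BVnorm_comp (r : sigma -> sigma) f :
  (forall s t, \val s <= \val t -> \val (r s) <= \val (r t)) ->
  BV_fun sigma f -> BVnorm (f \o r) <= BVnorm f.
Proof.
move=> rm /(BV_bounded_by sigma0)[a [b [fab <-]]].
exact: BVnorm_le (bounded_by_comp rm fab).
Qed.

Lemma BVnorm_cst (c : R[i]) : BVnorm (fun _ : sigma => c) <= normc c.
Proof. by rewrite -[leRHS]addr0; exact: BVnorm_le (bounded_by_cst sigma c). Qed.

Lemma BV_fun_cst (c : R[i]) : BV_fun sigma (fun _ : sigma => c).
Proof. exact: bounded_by_BV (bounded_by_cst sigma c). Qed.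

Hypothesis sigma_bounded : exists B : R, forall s : sigma, `|\val s| <= B.

Lemma poly_fun_cst (c : R[i]) : poly_fun sigma c%:P = fun=> c.
Proof. by apply/funext => s; rewrite /poly_fun hornerC. Qed.

Lemma poly_funX : poly_fun sigma 'X = fun s => (\val s)%:C.
Proof. by apply/funext => s; rewrite /poly_fun hornerX. Qed.

Lemma poly_funD p q : poly_fun sigma (p + q) = poly_fun sigma p + poly_fun sigma q.
Proof. by apply/funext => s; rewrite /poly_fun hornerD. Qed.

Lemma poly_funM p q : poly_fun sigma (p * q) = poly_fun sigma p * poly_fun sigma q.
Proof. by apply/funext => s; rewrite /poly_fun hornerM. Qed.

Lemma poly_funZ c p : poly_fun sigma (c *: p) = c *: poly_fun sigma p.
Proof. by apply/funext => s; rewrite /poly_fun hornerZ. Qed.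

Lemma BV_val : BV_fun sigma (fun s => (\val s)%:C).
Proof.
have [B sB] := sigma_bounded.
apply: bounded_by_BV; apply: (@bounded_by_monotone _ _ (fun s => \val s) (- B) B)=> //.
- by move=> s; rewrite -ler_norml.
- by rewrite normrN.
Qed.

Lemma BV_poly p : BV_fun sigma (poly_fun sigma p).
Proof.
elim/poly_ind: p => [|p c IH]; first by rewrite poly_fun_cst; exact: BV_fun_cst.
rewrite poly_funD poly_funM poly_fun_cst poly_funX.
by apply: BV_funD; [exact: BV_funM IH BV_val|exact: BV_fun_cst].
Qed.

Lemma AC_BV f : AC_fun sigma f -> BV_fun sigma f. Proof. by case. Qed.
Hint Resolve AC_BV BV_poly : core.

Lemma AC_poly p : AC_fun sigma (poly_fun sigma p).
Proof.
split=> // e e0; exists p; rewrite subrr; apply: le_lt_trans e0.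
by have := BVnorm_cst 0; rewrite normc0.
Qed.

Lemma AC_closed f : BV_fun sigma f ->
  (forall e : R, 0 < e -> exists2 g, AC_fun sigma g & BVnorm (f - g) < e) ->
  AC_fun sigma f.
Proof.
move=> fBV fg; split=> // e e0.
have e2 : 0 < e / 2 by rewrite divr_gt0.
have [g gAC fge] := fg _ e2; have [p gpe] := gAC.2 _ e2.
exists p; rewrite (_ : f - _ = (f - g) + (g - poly_fun sigma p)); last first.
  by rewrite addrA subrK.
have := BVnormD (BV_funB fBV (AC_BV gAC)) (BV_funB (AC_BV gAC) (BV_poly p)).
lra.
Qed.

Lemma AC_cst c : AC_fun sigma (fun=> c).
Proof. by rewrite -poly_fun_cst; exact: AC_poly. Qed.

Lemma AC_val : AC_fun sigma (fun s => (\val s)%:C).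
Proof. by rewrite -poly_funX; exact: AC_poly. Qed.

Lemma AC_funD f g : AC_fun sigma f -> AC_fun sigma g -> AC_fun sigma (f + g).
Proof.
move=> fAC gAC; split=> [|e e0]; first exact: BV_funD fAC.1 gAC.1.
have e2 : 0 < e / 2 by rewrite divr_gt0.
have [p fp] := fAC.2 _ e2; have [q gq] := gAC.2 _ e2.
exists (p + q); rewrite poly_funD opprD addrACA.
have := BVnormD (BV_funB fAC.1 (BV_poly p)) (BV_funB gAC.1 (BV_poly q)); lra.
Qed.

Lemma AC_funM f g : AC_fun sigma f -> AC_fun sigma g -> AC_fun sigma (f * g).
Proof.
move=> fAC gAC; split=> [|e e0]; first exact: BV_funM fAC.1 gAC.1.
have f0 := BVnorm_ge0 fAC.1.
have fe : 0 < e / (2 * (BVnorm f + 1)) by rewrite divr_gt0// mulr_gt0//; lra.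
have [q gq] := gAC.2 _ fe.
have q0 := BVnorm_ge0 (BV_poly q).
have qe : 0 < e / (2 * (BVnorm (poly_fun sigma q) + 1)).
  by rewrite divr_gt0// mulr_gt0//; lra.
have [p fp] := fAC.2 _ qe.
exists (p * q); rewrite poly_funM.
rewrite (_ : _ - _ = f * (g - poly_fun sigma q) +
   (f - poly_fun sigma p) * poly_fun sigma q); last first.
  by rewrite mulrBr mulrBl addrA subrK.
have fB := BV_funB fAC.1 (BV_poly p).
have gB := BV_funB gAC.1 (BV_poly q).
apply: (le_lt_trans (BVnormD (BV_funM fAC.1 gB) (BV_funM fB (BV_poly q)))).
apply: (le_lt_trans (lerD (BVnormM fAC.1 gB) (BVnormM fB (BV_poly q)))).
rewrite (splitr e); apply: ltr_leD.
  apply: (@le_lt_trans _ _ ((BVnorm f + 1) * BVnorm (g - poly_fun sigma q))).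
    by rewrite ler_wpM2r ?BVnorm_ge0//; lra.
  move: gq; rewrite invfM mulrA ltr_pdivlMr; last lra.
  by rewrite mulrC.
apply: (@le_trans _ _ (BVnorm (f - poly_fun sigma p) * (BVnorm (poly_fun sigma q) + 1))).
  by rewrite ler_wpM2l ?BVnorm_ge0//; lra.
by move/ltW: fp; rewrite invfM mulrA ler_pdivlMr; last lra.
Qed.

Lemma AC_funZ c f : AC_fun sigma f -> AC_fun sigma (c *: f).
Proof.
move=> fAC; rewrite (_ : c *: f = (fun=> c) * f)//.
by apply: AC_funM fAC; exact: AC_cst.
Qed.

Lemma AC_funN f : AC_fun sigma f -> AC_fun sigma (- f).
Proof. by move=> /(AC_funZ (-1)); rewrite scaleN1r. Qed.

Lemma AC_funB f g : AC_fun sigma f -> AC_fun sigma g -> AC_fun sigma (f - g).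
Proof. by move=> fAC /AC_funN; exact: AC_funD. Qed.

(** Composing with a monotone map does not increase the BV norm, so p \o r
    approximates f \o r when the polynomial p approximates f; and p \o r is a
    polynomial in r. *)
Lemma AC_fun_comp (r : sigma -> sigma) f :
  (forall s t, \val s <= \val t -> \val (r s) <= \val (r t)) ->
  AC_fun sigma (fun s => (\val (r s))%:C) ->
  AC_fun sigma f -> AC_fun sigma (f \o r).
Proof.
move=> rm rAC fAC; apply: AC_closed => [|e e0].
  exact: BV_fun_comp rm fAC.1.
have [p fp] := fAC.2 _ e0; exists (poly_fun sigma p \o r); last first.
  apply: le_lt_trans fp.
  exact: BVnorm_comp rm (BV_funB fAC.1 (BV_poly p)).
elim/poly_ind: p {fp} => [|p c IH].
  by rewrite poly_fun_cst; exact: AC_cst.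
rewrite poly_funD poly_funM poly_fun_cst poly_funX.
by apply: AC_funD; [exact: AC_funM IH rAC|exact: AC_cst].
Qed.

End absolutely_continuous.

Section abs_iteration.
Context (R : realType).
Implicit Types x y : R.

(** Polynomials that decrease to the absolute value on [-1, 1].  They start at 1
    rather than at 0, because of [abs_iter_defect]. *)
Fixpoint abs_iter n x : R :=
  if n is n'.+1 then abs_iter n' x + (x ^+ 2 - abs_iter n' x ^+ 2) / 2 else 1.

Lemma abs_iter_bounds n y : 0 <= y <= 1 -> y <= abs_iter n y <= 1.
Proof.
move=> /andP[y0 y1]; elim: n => [|n /andP[IH1 IH2]] /=; first by rewrite y1 lexx.
apply/andP; split; nra.
Qed.

Lemma abs_iter_homo n x y : 0 <= x -> x <= y -> y <= 1 ->
  abs_iter n x <= abs_iter n y.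
Proof.
move=> x0 xy y1; elim: n => [//|n IH] /=.
have /andP[a1 a2] : x <= abs_iter n x <= 1 by apply: abs_iter_bounds; lra.
have /andP[b1 b2] : y <= abs_iter n y <= 1 by apply: abs_iter_bounds; lra.
have : x ^+ 2 <= y ^+ 2 by rewrite ler_pXn2r// nnegrE; lra.
nra.
Qed.

(** One step multiplies the error by 1 - (x + abs_iter n x) / 2, which is
    nonnegative and nonincreasing in x, so the error remains nonincreasing on
    [0, 1].  Its total variation is thus controlled by its value at 0: uniform
    convergence to the absolute value becomes convergence in BV. *)
Lemma abs_iter_defect n x y : 0 <= x -> x <= y -> y <= 1 ->
  abs_iter n y - y <= abs_iter n x - x.
Proof.
move=> x0 xy y1; elim: n => [|n IH] /=; first lra.
have /andP[a1 a2] : x <= abs_iter n x <= 1 by apply: abs_iter_bounds; lra.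
have /andP[b1 b2] : y <= abs_iter n y <= 1 by apply: abs_iter_bounds; lra.
have h := abs_iter_homo n x0 xy y1.
have E (z w : R) : w + (z ^+ 2 - w ^+ 2) / 2 - z = (w - z) * (1 - (z + w) / 2) by field.
by rewrite !E ler_pM//; lra.
Qed.

(** At 0 the iteration is c - c^2 / 2. *)
Lemma abs_iter0 n : abs_iter n 0 <= 2 / (n%:R + 2).
Proof.
elim: n => [|n IH] /=; first by rewrite add0r divff.
have /andP[c0 c1] : 0 <= abs_iter n 0 <= 1 by apply: abs_iter_bounds; rewrite lexx ler01.
have n0 : (0 : R) <= n%:R by [].
apply: (@le_trans _ _ (2 / (n%:R + 2) - (2 / (n%:R + 2)) ^+ 2 / 2)).
  have : 2 / (n%:R + 2) <= 1 :> R by rewrite ler_pdivrMr; lra.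
  nra.
rewrite -natr1 -subr_ge0.
rewrite (_ : _ - _ = 2 / ((n%:R + 1 + 2) * (n%:R + 2) ^+ 2)); last first.
  by field; apply/andP; split; lra.
by rewrite divr_ge0// mulr_ge0//; nra.
Qed.

Lemma abs_iter_norm n x : abs_iter n `|x| = abs_iter n x.
Proof. by elim: n => [//|n IH] /=; rewrite IH real_normK// num_real. Qed.

End abs_iteration.

(** * Piecewise linear functions are absolutely continuous *)

Section piecewise_linear.
Context (R : realType) (sigma : set R).
Hypothesis sigma0 : sigma !=set0.
Hypothesis sigma_bounded : exists B : R, forall s : sigma, `|\val s| <= B.
Implicit Types (f g : sigma -> R[i]).

(** After scaling, the error of [abs_iter] is monotone on each side of c, so its
    BV norm is at most five times its value at c. *)
Lemma AC_abs (c : R) : AC_fun sigma (fun s => (`|\val s - c|)%:C).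
Proof.
have [B sB] := sigma_bounded.
pose L := `|B| + `|c| + 1.
have L0 : 0 < L by rewrite /L; have := normr_ge0 B; have := normr_ge0 c; lra.
pose u (s : sigma) := (\val s - c) / L.
have uL s : `|u s| <= 1.
  rewrite /u normrM normfV (gtr0_norm L0) ler_pdivrMr// mul1r /L.
  have := ler_normB (\val s) c; have := sB s; have := ler_norm B; lra.
have uAC : AC_fun sigma (fun s => (u s)%:C).
  rewrite (_ : (fun _ => _) = (L^-1)%:C *: ((fun s => (\val s)%:C) - (fun=> c%:C))).
    by apply: AC_funZ => //; apply: AC_funB => //; [exact: AC_val|exact: AC_cst].
  apply/funext => s; rewrite -[RHS]/((L^-1)%:C * ((\val s)%:C - c%:C)).
  by rewrite -rmorphB -rmorphM mulrC.
pose f n (s : sigma) := (abs_iter n (u s))%:C.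
have fAC n : AC_fun sigma (f n).
  elim: n => [|n IH]; first exact: (AC_cst sigma0 sigma_bounded 1%:C).
  rewrite (_ : f n.+1 = f n + (2^-1)%:C *:
    ((fun s => (u s)%:C) * (fun s => (u s)%:C) - f n * f n)).
    apply: AC_funD => //; apply: AC_funZ => //.
    by apply: AC_funB => //; exact: AC_funM.
  apply/funext => s; rewrite -[RHS]/((abs_iter n (u s))%:C + (2^-1)%:C *
    ((u s)%:C * (u s)%:C - (abs_iter n (u s))%:C * (abs_iter n (u s))%:C)).
  by rewrite -!rmorphM -rmorphB -rmorphM -rmorphD /f /= -!expr2 [2^-1 * _]mulrC.
pose g (s : sigma) := (`|u s|)%:C.
have fgE n : bounded_by (f n - g) (abs_iter n (0 : R) *+ 3) (abs_iter n (0 : R) *+ 2).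
  set c0 := abs_iter n 0.
  have /andP[c00 _] : 0 <= c0 <= 1 by apply: abs_iter_bounds; rewrite lexx ler01.
  have D y : 0 <= y <= 1 -> 0 <= abs_iter n y - y <= c0.
    move=> /andP[y0 y1]; have := abs_iter_defect n (lexx 0) y0 y1.
    have /andP[] : y <= abs_iter n y <= 1 by apply: abs_iter_bounds; rewrite y0.
    by rewrite -/c0; move=> *; apply/andP; split; lra.
  (* The error is A + A' - c0: A follows it to the right of c and is constant on
     the left, and A' does the converse. *)
  pose A s := abs_iter n (Num.max (u s) 0) - Num.max (u s) 0.
  pose A' s := abs_iter n (Num.max (- u s) 0) - Num.max (- u s) 0.
  have u01 s : 0 <= Num.max (u s) 0 <= 1.
    by rewrite le_max lexx orbT ge_max ler01 andbT (le_trans (ler_norm _)).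
  have u01' s : 0 <= Num.max (- u s) 0 <= 1.
    rewrite le_max lexx orbT ge_max ler01 andbT (le_trans (ler_norm _))//.
    by rewrite normrN.
  have umono (s t : sigma) : \val s <= \val t -> u s <= u t.
    by move=> st; rewrite ler_wpM2r ?invr_ge0 ?(ltW L0)// lerB.
  have Abnd : bounded_by (fun s => (A s)%:C) c0 (c0 - 0).
    apply: bounded_by_antitone; rewrite ?normr0 ?(ger0_norm c00)//.
      move=> s t st; apply: abs_iter_defect.
      + by have /andP[] := u01 s.
      + by rewrite le_max2// umono.
      + by have /andP[] := u01 t.
    by move=> s; exact: D.
  have A'bnd : bounded_by (fun s => (A' s)%:C) c0 (c0 - 0).
    apply: bounded_by_monotone; rewrite ?normr0 ?(ger0_norm c00)//.
      move=> s t st; apply: abs_iter_defect.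
      + by have /andP[] := u01' t.
      + by rewrite le_max2// lerN2 umono.
      + by have /andP[] := u01' s.
    by move=> s; exact: D.
  have := bounded_byB (bounded_byD Abnd A'bnd) (bounded_by_cst sigma c0%:C).
  have -> : normc c0%:C = c0 by rewrite normc_real ger0_norm.
  rewrite !subr0 addr0 -!mulr2n -mulrSr; congr bounded_by.
  apply/funext => s; rewrite -[LHS]/((A s)%:C + (A' s)%:C - c0%:C).
  rewrite -[RHS]/((abs_iter n (u s))%:C - (`|u s|)%:C) -!(rmorphD, rmorphB).
  congr (_%:C); rewrite /A /A' /c0 -(abs_iter_norm n (u s)).
  have [u0|u0] := leP 0 (u s).
    by rewrite ger0_norm// (max_idPr _) ?oppr_le0//; lra.
  rewrite ltr0_norm// (max_idPl _) ?oppr_ge0 ?(ltW u0)//; lra.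
have gBV : BV_fun sigma g.
  rewrite (_ : g = f 0%N - (f 0%N - g)); last by rewrite opprB addrCA subrr addr0.
  by apply: BV_funB (AC_BV (fAC _)) _ => //; exact: bounded_by_BV (fgE 0%N).
have gAC : AC_fun sigma g.
  apply: AC_closed => // e e0.
  have [n ne] : exists n : nat, 10 / e < n%:R.
    by exists (Num.bound (10 / e)); rewrite archi_boundP// divr_ge0// ltW.
  exists (f n) => //; rewrite BVnormBC//; last exact: AC_BV.
  apply: (le_lt_trans (BVnorm_le sigma0 (fgE n))).
  rewrite -mulrnDr.
  have := abs_iter0 R n; move: (abs_iter n 0) => c0 c0n.
  apply: (@le_lt_trans _ _ ((2 / (n%:R + 2)) *+ 5)); first by rewrite lerMn2r.
  rewrite -mulr_natr mulrAC ltr_pdivrMr; last by rewrite ltr_wpDl.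
  by move: ne; rewrite ltr_pdivrMr//; nra.
rewrite (_ : (fun _ => _) = L%:C *: g); first exact: AC_funZ.
apply/funext => s; rewrite -[RHS]/(L%:C * (`|u s|)%:C) -rmorphM /u.
by rewrite normrM normfV (gtr0_norm L0) mulrC divfK// gt_eqF.
Qed.

Lemma AC_smin (c : sigma) f : AC_fun sigma f -> AC_fun sigma (f \o smin c).
Proof.
apply: AC_fun_comp => //; first exact: smin_homo.
rewrite (_ : (fun _ => _) = (2^-1)%:C *: ((fun s => (\val s)%:C) +
   (fun=> (\val c)%:C) - (fun s => (`|\val s - \val c|)%:C))).
  apply: AC_funZ => //; apply: AC_funB => //; last exact: AC_abs.
  by apply: AC_funD => //; [exact: AC_val|exact: AC_cst].
apply/funext => s; rewrite val_smin.
rewrite -[RHS]/((2^-1)%:C * ((\val s)%:C + (\val c)%:C - (`|\val s - \val c|)%:C)).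
by rewrite -rmorphD -rmorphB -rmorphM Num.Theory.minr_absE mulrC.
Qed.

Lemma AC_smax (c : sigma) f : AC_fun sigma f -> AC_fun sigma (f \o smax c).
Proof.
apply: AC_fun_comp => //; first exact: smax_homo.
rewrite (_ : (fun _ => _) = (2^-1)%:C *: ((fun s => (\val s)%:C) +
   (fun=> (\val c)%:C) + (fun s => (`|\val s - \val c|)%:C))).
  apply: AC_funZ => //; apply: AC_funD => //; last exact: AC_abs.
  by apply: AC_funD => //; [exact: AC_val|exact: AC_cst].
apply/funext => s; rewrite val_smax.
rewrite -[RHS]/((2^-1)%:C * ((\val s)%:C + (\val c)%:C + (`|\val s - \val c|)%:C)).
by rewrite -rmorphD -rmorphD -rmorphM Num.Theory.maxr_absE mulrC.
Qed.

(** The function that is 0 before c, 1 after d, and affine in between, written in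
    terms of absolute values so that [AC_abs] applies. *)
Definition ramp (c d x : R) : R := (`|x - c| - `|x - d| + (d - c)) / (2 * (d - c)).

Lemma ramp0 c d x : c < d -> x <= c -> ramp c d x = 0.
Proof.
move=> cd xc; rewrite /ramp !ler0_norm ?subr_le0//; last lra.
by rewrite (_ : _ + _ = 0) ?mul0r//; lra.
Qed.

Lemma ramp1 c d x : c < d -> d <= x -> ramp c d x = 1.
Proof.
move=> cd xc; rewrite /ramp !ger0_norm ?subr_ge0//; last lra.
by rewrite (_ : _ + _ = 2 * (d - c)) ?divff//; [apply/eqP; lra|lra].
Qed.

Lemma ramp_homo c d x y : c < d -> x <= y -> ramp c d x <= ramp c d y.
Proof.
move=> cd xy; rewrite /ramp ler_pM2r; last by rewrite invr_gt0; lra.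
rewrite lerD2r.
by case: (ger0P (x - c)); case: (ger0P (x - d)); case: (ger0P (y - c));
  case: (ger0P (y - d)) => *; lra.
Qed.

Lemma ramp_itv c d x : c < d -> 0 <= ramp c d x <= 1.
Proof.
move=> cd; apply/andP; split.
  have [xc|cx] := leP x c; first by rewrite ramp0.
  by rewrite -(ramp0 cd (lexx c)) ramp_homo// ltW.
have [xc|cx] := leP d x; first by rewrite ramp1.
by rewrite -(ramp1 cd (lexx d)) ramp_homo// ltW.
Qed.

Definition ramp_fun c d (s : sigma) : R[i] := (ramp c d (\val s))%:C.

Lemma AC_ramp c d : AC_fun sigma (ramp_fun c d).
Proof.
rewrite (_ : ramp_fun c d = ((2 * (d - c))^-1)%:C *:
  ((fun s => (`|\val s - c|)%:C) - (fun s => (`|\val s - d|)%:C) + (fun=> (d - c)%:C))).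
  apply: AC_funZ => //; apply: AC_funD => //; last exact: AC_cst.
  by apply: AC_funB => //; exact: AC_abs.
apply/funext => s; rewrite -[RHS]/(((2 * (d - c))^-1)%:C *
  ((`|\val s - c|)%:C - (`|\val s - d|)%:C + (d - c)%:C)).
by rewrite -rmorphB -rmorphD -rmorphM mulrC.
Qed.

Lemma bounded_by_ramp c d : c < d -> bounded_by (ramp_fun c d) 1 1.
Proof.
move=> cd; rewrite -[X in bounded_by _ _ X](subr0 1).
apply: bounded_by_monotone; rewrite ?normr0 ?normr1//.
  by move=> s t st; exact: ramp_homo.
by move=> s; exact: ramp_itv.
Qed.

End piecewise_linear.

(** * Interpolation of BV functions by AC functions *)

Section interpolation.
Context (R : realType) (sigma : set R).
Hypothesis sigma0 : sigma !=set0.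
Hypothesis sigma_bounded : exists B : R, forall s : sigma, `|\val s| <= B.
Implicit Types (f g : sigma -> R[i]).

(** Each step of the chain adds one ramp; its variation is the increment of f.  The
    interpolant is constant after the last node, which lets the next ramp start
    there. *)
Lemma chain_interpolant f n (t : nat -> sigma) : chain n t -> exists h,
  [/\ AC_fun sigma h,
      bounded_by h (normc (f (t 0%N)) + chain_sum f n t) (chain_sum f n t),
      forall i, (i <= n)%N -> h (t i) = f (t i) &
      forall s, \val (t n) <= \val s -> h s = f (t n)].
Proof.
elim: n => [|n IH] tn.
  exists (fun=> f (t 0%N)); split=> //.
  - exact: AC_cst.
  - by rewrite /chain_sum big_ord0 addr0; exact: bounded_by_cst.
  - by case.
have [|h [hAC hb hf hn]] := IH; first by move=> i /ltnW; exact: tn.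
have mono i : (i <= n)%N -> \val (t i) <= \val (t n).
  elim: n {IH h hAC hb hf hn} tn => [|m IHm] tm; first by rewrite leqn0 => /eqP ->.
  rewrite leq_eqVlt => /orP[/eqP -> //|]; rewrite ltnS => im.
  apply: (le_trans (IHm _ im) (tm _ _)) => // j jm; apply: tm; exact: leqW.
have Sb : chain_sum f n.+1 t = chain_sum f n t + normc (f (t n.+1) - f (t n)).
  by rewrite /chain_sum big_ord_recr.
have := tn n (ltnSn n); rewrite le_eqVlt => /orP[/eqP/val_inj tE|tlt].
  exists h; rewrite Sb -tE subrr normc0 !addr0; split=> // i.
  by rewrite leq_eqVlt => /orP[/eqP ->|]; [rewrite -tE; exact: hf|exact: hf].
exists (h + (f (t n.+1) - f (t n)) *:
  ramp_fun (sigma := sigma) (\val (t n)) (\val (t n.+1))).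
have hS s : \val (t n.+1) <= \val s -> (h + (f (t n.+1) - f (t n)) *:
    ramp_fun (sigma := sigma) (\val (t n)) (\val (t n.+1))) s = f (t n.+1).
  move=> ts; rewrite -[LHS]/(h s + (f (t n.+1) - f (t n)) * (ramp _ _ _)%:C).
  by rewrite ramp1// rmorph1 mulr1 hn ?(le_trans (ltW tlt))// addrC subrK.
split=> //.
- by apply: AC_funD => //; apply: AC_funZ => //; exact: AC_ramp.
- have := bounded_byD hb (bounded_byZ sigma0 (f (t n.+1) - f (t n))
    (@bounded_by_ramp _ sigma _ _ tlt)).
  by rewrite mulr1 Sb addrA.
move=> i; rewrite leq_eqVlt => /orP[/eqP ->|]; first exact: hS.
rewrite ltnS => im.
rewrite -[LHS]/(h (t i) + (f (t n.+1) - f (t n)) * (ramp _ _ _)%:C).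
by rewrite ramp0 ?mono// rmorph0 mulr0 addr0 hf.
Qed.

Lemma BV_interpolant f (F : seq sigma) : BV_fun sigma f -> exists h,
  [/\ AC_fun sigma h, BVnorm h <= 2 * BVnorm f & {in F, h =1 f}].
Proof.
move=> /(BV_bounded_by sigma0)[a [b [fab <-]]].
have [c sc] := sigma0; pose t0 : sigma := exist _ c (mem_set sc).
pose G := sort (fun s t : sigma => \val s <= \val t) F.
have tG : chain (size G).-1 (nth t0 G).
  move=> i; rewrite -ltnS => iG; have : sorted (fun s t : sigma => \val s <= \val t) G.
    by apply: sort_sorted => x y; exact: le_total.
  move/(sortedP t0); apply; apply: (leq_trans iG).
  by case: (G) iG.
have [h [hAC hb hf _]] := chain_interpolant f tG.
exists h; split=> //.
  apply: (le_trans (BVnorm_le sigma0 hb)).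
  have := bnd_sup fab (nth t0 G 0); have := bnd_chain fab tG.
  have [] := bounded_by_ge0 sigma0 fab; lra.
move=> s; rewrite -(mem_sort (fun s t : sigma => \val s <= \val t)) -/G => sG.
by rewrite -(nth_index t0 sG); apply: hf; move: (sG); rewrite -index_mem; case: (size G).
Qed.

End interpolation.

(** * Uniform convexity and nested cutoffs *)

Section real_norm.
Context (R : realType) (X : normedModType R[i]).
Implicit Types x y : X.

Lemma rnormE x : `|x| = (rnorm x)%:C.
Proof. by rewrite /rnorm RRe_real// realE normr_ge0. Qed.

Lemma rnorm_ge0 x : 0 <= rnorm x.
Proof. by rewrite -ler0c -rnormE. Qed.

Lemma rnorm0 : rnorm (0 : X) = 0.
Proof. by rewrite /rnorm normr0. Qed.

Lemma rnormD x y : rnorm (x + y) <= rnorm x + rnorm y.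
Proof. by rewrite -lecR rmorphD /= -!rnormE ler_normD. Qed.

Lemma rnormN x : rnorm (- x) = rnorm x.
Proof. by rewrite /rnorm normrN. Qed.

Lemma rnormB x y : rnorm (x - y) <= rnorm x + rnorm y.
Proof. by rewrite -(rnormN y) rnormD. Qed.

Lemma rnormBC x y : rnorm (x - y) = rnorm (y - x).
Proof. by rewrite -rnormN opprB. Qed.

Lemma rnormZ (a : R[i]) x : rnorm (a *: x) = normc a * rnorm x.
Proof.
rewrite /rnorm normrZ rnormE -/(rnorm x) (_ : `|a| = (normc a)%:C) -?rmorphM//.
Qed.

Lemma rnorm_eq0 x : rnorm x = 0 -> x = 0.
Proof. by move=> x0; apply/eqP; rewrite -normr_eq0 rnormE x0 rmorph0. Qed.

Lemma rnorm_triangle z x y : rnorm (x - y) <= rnorm (x - z) + rnorm (z - y).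
Proof. by apply: le_trans (rnormD _ _); rewrite addrA subrK. Qed.

Lemma small_rnorm_eq x y : (forall e : R, 0 < e -> rnorm (x - y) <= e) -> x = y.
Proof.
move=> xy; apply/eqP; rewrite -subr_eq0; apply/eqP/rnorm_eq0/le_anti.
rewrite rnorm_ge0 andbT; apply/ler_addgt0Pr => e e0; rewrite add0r; exact: xy.
Qed.

Lemma rnorm_eq_of_small x y C : 0 <= C ->
  (forall e : R, 0 < e -> rnorm (x - y) <= C * e) -> x = y.
Proof.
move=> C0 xy; apply: small_rnorm_eq => e e0.
have C1 : 0 < C + 1 by rewrite ltr_wpDl.
apply: (le_trans (xy _ (divr_gt0 e0 C1))).
by rewrite mulrCA -[leRHS]mulr1 ler_wpM2l ?(ltW e0)// ler_pdivrMr// mul1r lerDl.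
Qed.

Lemma opnorm_le (A : X -> X) K : 0 <= K ->
  (forall x, rnorm (A x) <= K * rnorm x) -> opnorm A <= K.
Proof.
move=> K0 AK; apply: ge_sup; first by exists (rnorm (A 0)), 0 => //=; rewrite rnorm0.
move=> _ [x /= x1 <-]; apply: (le_trans (AK x)).
by rewrite -[leRHS]mulr1 ler_wpM2l.
Qed.

Lemma rnorm_opnorm (A : X -> X) x : bounded_operator A ->
  rnorm (A x) <= opnorm A * rnorm x.
Proof.
move=> [Alin [K AK]].
have A0 : A 0 = 0.
  have := Alin 1 0 0; rewrite !scale1r addr0 => E.
  by apply: (@addrI _ (A 0)); rewrite -E addr0.
have AZ a y : A (a *: y) = a *: A y by rewrite -[a *: y]addr0 Alin A0 addr0.
have [->|x0] := eqVneq x 0; first by rewrite A0 rnorm0 mulr0.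
have nx0 : 0 < rnorm x.
  by rewrite lt_def rnorm_ge0 andbT; apply: contra x0 => /eqP/rnorm_eq0 ->.
have nV : normc ((rnorm x)^-1)%:C = (rnorm x)^-1.
  by rewrite normc_real ger0_norm// invr_ge0 ltW.
rewrite -ler_pdivrMr//.
apply: ub_le_sup.
  exists `|K| => _ [y /= y1 <-]; apply: (le_trans (AK y)).
  apply: (le_trans (ler_norm _)); rewrite normrM -[leRHS]mulr1 ler_wpM2l//.
  by rewrite ger0_norm ?rnorm_ge0.
exists (((rnorm x)^-1)%:C *: x); rewrite /= ?AZ rnormZ nV; last by rewrite mulrC.
by rewrite mulVf// gt_eqF.
Qed.

(** The gain delta depends on the bound M for the radius only, so that it can be
    applied to radii that are not known in advance. *)
Definition uniformly_convex : Prop := forall M e : R, 0 < e ->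
  exists2 delta : R, 0 < delta & forall (r : R) x y, r <= M ->
    rnorm x <= r -> rnorm y <= r -> e <= rnorm (x - y) ->
    rnorm ((2^-1)%:C *: (x + y)) <= r - delta.

Definition complete_rnorm : Prop := forall u : nat -> X,
  (forall e : R, 0 < e -> exists N, forall n m, (N <= n)%N -> (N <= m)%N ->
     rnorm (u n - u m) <= e) ->
  exists y, forall e : R, 0 < e -> exists N, forall n, (N <= n)%N ->
     rnorm (u n - y) <= e.

End real_norm.

Section calculus.
Context (R : realType) (X : normedModType R[i]) (sigma : set R).
Hypothesis sigma0 : sigma !=set0.
Hypothesis sigma_bounded : exists B : R, forall s : sigma, `|\val s| <= B.
Hypothesis sigma_closed : closed sigma.
Implicit Types (f g h : sigma -> R[i]) (x y : X).
Local Notation AC := (AC_fun sigma).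
Local Notation BV := (BV_fun sigma).
Variable Phi : (sigma -> R[i]) -> X -> X.
Hypothesis Phi_hom : algebra_hom AC Phi.
Variable K : R.
Hypothesis K0 : 0 <= K.
Hypothesis Phi_le : forall h x, AC h -> rnorm (Phi h x) <= K * BVnorm h * rnorm x.
Hypothesis ucX : uniformly_convex X.
Hypothesis complX : complete_rnorm X.

Lemma Phi_lin h a x y : AC h -> Phi h (a *: x + y) = a *: Phi h x + Phi h y.
Proof. by move=> hAC; have [] := algebra_hom_bounded Phi_hom hAC. Qed.

Lemma Phi_subr h x y : AC h -> Phi h (x - y) = Phi h x - Phi h y.
Proof. by move=> hAC; rewrite addrC -scaleN1r Phi_lin// scaleN1r addrC. Qed.

Lemma Phi_sub f g x : AC f -> AC g -> Phi (f - g) x = Phi f x - Phi g x.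
Proof.
move=> fAC gAC; have gN : AC (- g) by exact: AC_funN.
rewrite (algebra_homD Phi_hom)//; congr (_ + _).
by rewrite -scaleN1r (algebra_homZ Phi_hom)// scaleN1r.
Qed.

(** Let C n be the convex set of the p in AC of norm at most M such that g_m p = p
    for m < n and g_m p = g_m for large m; it contains g_n and decreases with n.  If the norm of p(T) x almost attains the limit L of the
    infima over C n, uniform convexity makes p(T) x almost unique.  Given such a p in
    C N and q in C (m + 1), one has g_m(T) (p(T) x - q(T) x) = g_m(T) x - q(T) x
    for large m, so g_m(T) x is close to q(T) x, hence to p(T) x. *)
Lemma nested_cauchy (g : nat -> sigma -> R[i]) M x :
  (forall n, AC (g n)) -> (forall n, BVnorm (g n) <= M) ->
  (forall n m, (n < m)%N -> g n * g m = g m) ->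
  forall e : R, 0 < e -> exists N, forall n m, (N <= n)%N -> (N <= m)%N ->
    rnorm (Phi (g n) x - Phi (g m) x) <= e.
Proof.
move=> gAC gM gg e e0.
have M0 : 0 <= M := le_trans (BVnorm_ge0 sigma0 (AC_BV (gAC 0%N))) (gM 0%N).
pose C n : set (sigma -> R[i]) := [set p | [/\ AC p, BVnorm p <= M,
  forall m, (m < n)%N -> g m * p = p & exists N, forall m, (N <= m)%N -> g m * p = g m]].
have gC n : C n (g n).
  split=> //; first by move=> m; exact: gg.
  by exists n.+1 => m nm; rewrite mulrC; exact: gg.
have CS m n : (m <= n)%N -> C n `<=` C m.
  by move=> mn p [pAC pM pn pN]; split=> // k km; apply: pn; exact: leq_trans mn.
have Cmid n p q : C n p -> C n q -> C n ((2^-1)%:C *: (p + q)).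
  move=> [pAC pM pn [N pN]] [qAC qM qn [N' qN]].
  have mulfZ c (f h : sigma -> R[i]) : f * (c *: h) = c *: (f * h).
    by apply/funext => s; exact: mulrCA.
  have half2 (h : sigma -> R[i]) : (2^-1)%:C *: (h + h) = h.
    apply/funext => s; rewrite -[LHS]/((2^-1)%:C * (h s + h s)).
    have c2 : (2^-1)%:C + (2^-1)%:C = 1 :> R[i].
      by rewrite -rmorphD -(rmorph1 (real_complex R)); congr (_%:C); lra.
    by rewrite mulrDr -mulrDl c2 mul1r.
  split.
  - by apply: AC_funZ => //; exact: AC_funD.
  - apply: (le_trans (BVnormZ sigma0 _ (BV_funD sigma0 (AC_BV pAC) (AC_BV qAC)))).
    have := BVnormD sigma0 (AC_BV pAC) (AC_BV qAC); rewrite normc_half; lra.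
  - by move=> m mn; rewrite mulfZ mulrDr pn// qn.
  exists (maxn N N') => m; rewrite geq_max => /andP[Nm N'm].
  by rewrite mulfZ mulrDr pN// qN// half2.
(* The supremum of S is the limit of the infima of rnorm (Phi p x) over C n. *)
pose S : set R := [set l | exists n, forall p, C n p -> l <= rnorm (Phi p x)].
have S0 : S !=set0 by exists 0, 0%N => p _; exact: rnorm_ge0.
have Sub : has_ubound S.
  exists (K * M * rnorm x) => l [n Sl]; apply: (le_trans (Sl _ (gC n))).
  apply: (le_trans (Phi_le x (gAC n))).
  by rewrite ler_wpM2r ?rnorm_ge0// ler_wpM2l.
pose L := sup S.
have near_min n eta : 0 < eta -> exists2 p, C n p & rnorm (Phi p x) < L + eta.
  move=> eta0; apply: contrapT => H.
  suff : L + eta <= L by lra.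
  apply: ub_le_sup => //; exists n => p Cp; rewrite leNgt; apply/negP => pl.
  by apply: H; exists p.
have close e' : 0 < e' -> exists N eta, 0 < eta /\ forall p q, C N p -> C N q ->
    rnorm (Phi p x) < L + eta -> rnorm (Phi q x) < L + eta ->
    rnorm (Phi p x - Phi q x) < e'.
  move=> e'0; have [delta delta0 uc] := @ucX (L + 1) e' e'0.
  pose eta := Num.min 1 (delta / 4).
  have eta0 : 0 < eta by rewrite /eta lt_min ltr01 divr_gt0.
  have [eta1 etad] : eta <= 1 /\ eta <= delta / 4.
    by split; rewrite /eta ge_min lexx ?orbT.
  have [l [N Nl] lL] : exists2 l, S l & L - eta < l.
    exact: sup_adherent.
  exists N, eta; split=> // p q Cp Cq pL qL; rewrite ltNge; apply/negP => pq.
  have := Nl _ (Cmid _ _ _ Cp Cq); apply/negP; rewrite -ltNge.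
  have [pAC _ _ _] := Cp; have [qAC _ _ _] := Cq.
  rewrite (algebra_homZ Phi_hom) ?(algebra_homD Phi_hom)//; last exact: AC_funD.
  have := uc (L + eta) (Phi p x) (Phi q x) _ (ltW pL) (ltW qL) pq.
  by rewrite lerD2l => /(_ eta1); lra.
pose e' := e / (2 * (K * M + 1)).
have KM0 : 0 <= K * M by rewrite mulr_ge0.
have e'0 : 0 < e' by rewrite divr_gt0// mulr_gt0//; lra.
have [N [eta [eta0 Neta]]] := close _ e'0.
have [p Cp pL] := near_min N _ eta0.
have [pAC _ _ [N0 pN0]] := Cp.
have key m : (maxn N N0 <= m)%N -> rnorm (Phi (g m) x - Phi p x) <= e / 2.
  rewrite geq_max => /andP[Nm N0m].
  have [q Cq qL] := near_min m.+1 _ eta0.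
  have [qAC _ qm _] := Cq.
  have qp : rnorm (Phi q x - Phi p x) < e'.
    by apply: Neta => //; apply: CS Cq; exact: leqW.
  apply: (le_trans (rnorm_triangle (Phi q x) _ _)).
  have -> : Phi (g m) x - Phi q x = Phi (g m) (Phi p x - Phi q x).
    by rewrite Phi_subr// -!(algebra_homM Phi_hom)// pN0// qm.
  have h1 : rnorm (Phi (g m) (Phi p x - Phi q x)) <= K * M * e'.
    apply: (le_trans (Phi_le _ (gAC m))); rewrite rnormBC.
    apply: ler_pM; rewrite ?rnorm_ge0 ?mulr_ge0 ?BVnorm_ge0 ?ler_wpM2l ?(ltW qp)//.
    exact/AC_BV.
  have : K * M * e' + e' = e / 2.
    by rewrite -{2}[e']mul1r -mulrDl /e'; field; apply/eqP; lra.
  lra.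
exists (maxn N N0) => n m /key hn /key hm.
have := rnorm_triangle (Phi p x) (Phi (g n) x) (Phi (g m) x).
rewrite [rnorm (Phi p x - _)]rnormBC; lra.
Qed.

(** * Functions supported near a point *)

(** In the applications r is [smin c] or [smax c], and h \o r = h with h c = 0 says
    that h vanishes on one side of c.  If the polynomial p is close to h, then h is
    close to p \o r - p(c), which is a multiple of r - c. *)
Lemma cutoff_decay (r : sigma -> sigma) (c : sigma) (g : nat -> sigma -> R[i]) M h :
  (forall s t, \val s <= \val t -> \val (r s) <= \val (r t)) ->
  (forall n, AC (g n)) -> (forall n, BVnorm (g n) <= M) ->
  (forall e, 0 < e -> exists N, forall n, (N <= n)%N ->
     BVnorm ((fun s => (\val (r s) - \val c)%:C) * g n) <= e) ->
  AC h -> h \o r = h -> h c = 0 ->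
  forall e, 0 < e -> exists N, forall n, (N <= n)%N -> BVnorm (h * g n) <= e.
Proof.
move=> rm gAC gM rg hAC hr hc e e0.
have M0 : 0 <= M := le_trans (BVnorm_ge0 sigma0 (AC_BV (gAC 0%N))) (gM 0%N).
have d0 : 0 < e / (4 * (M + 1)) by rewrite divr_gt0// mulr_gt0//; lra.
set d := e / _ in d0.
have [p hp] := hAC.2 _ d0.
have [q pq] : exists q, p - (p.[(\val c)%:C])%:P = q * ('X - ((\val c)%:C)%:P).
  by apply/factor_theorem; rewrite rootE !hornerE subrr.
pose w (s : sigma) : R[i] := (\val (r s) - \val c)%:C.
pose k : sigma -> R[i] := (poly_fun sigma q \o r) * w.
have pBV := BV_poly sigma0 sigma_bounded p.
have qBV := BV_fun_comp sigma0 rm (BV_poly sigma0 sigma_bounded q).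
have Q0 := BVnorm_ge0 sigma0 qBV.
have hpBV := BV_funB sigma0 hAC.1 pBV.
have kE : h - k = ((h - poly_fun sigma p) \o r) + (fun=> p.[(\val c)%:C]).
  rewrite -{1}hr; apply/funext => s.
  rewrite -[LHS]/(h (r s) - q.[(\val (r s))%:C] * (\val (r s) - \val c)%:C).
  rewrite -[RHS]/(h (r s) - p.[(\val (r s))%:C] + p.[(\val c)%:C]).
  have /(congr1 (fun u => u.[(\val (r s))%:C])) := pq.
  rewrite !hornerE -rmorphB => <-.
  by rewrite opprB addrA addrAC.
have wBV : BV_fun sigma w.
  have -> : w = ((fun s => (\val s)%:C) \o r) - (fun=> (\val c)%:C).
    by apply/funext => s; rewrite /w rmorphB.
  by apply: BV_funB (BV_fun_cst _ _) => //; apply: BV_fun_comp => //; exact: BV_val.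
have kBV : BV_fun sigma k by exact: BV_funM.
have hk : BVnorm (h - k) <= 2 * d.
  have BV1 := BV_fun_comp sigma0 rm hpBV.
  have BV2 := BV_fun_cst sigma (p.[(\val c)%:C]).
  rewrite kE; apply: (le_trans (BVnormD sigma0 BV1 BV2)).
  have n1 := BVnorm_comp sigma0 rm hpBV.
  have n2 := BVnorm_cst sigma0 (p.[(\val c)%:C]).
  have := BVnorm_sup sigma0 c hpBV.
  have -> : (h - poly_fun sigma p) c = - p.[(\val c)%:C].
    by rewrite -[LHS]/(h c - p.[(\val c)%:C]) hc sub0r.
  rewrite normcN; lra.
pose Q := BVnorm (poly_fun sigma q \o r).
have e'0 : 0 < e / (2 * (Q + 1)) by rewrite divr_gt0// mulr_gt0// ltr_wpDl.
have [N rgN] := rg _ e'0; exists N => n Nn.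
have gBV := AC_BV (gAC n).
have wgBV : BV_fun sigma (w * g n) by exact: BV_funM.
have -> : h * g n = (h - k) * g n + (poly_fun sigma q \o r) * (w * g n).
  by rewrite mulrA -/k mulrBl subrK.
have hkBV : BV_fun sigma (h - k) := BV_funB sigma0 hAC.1 kBV.
have := BVnormD sigma0 (BV_funM sigma0 hkBV gBV) (BV_funM sigma0 qBV wgBV).
have h1 := BVnormM sigma0 hkBV gBV.
have h2 := BVnormM sigma0 qBV wgBV.
have h3 : BVnorm (h - k) * BVnorm (g n) <= 2 * d * M.
  by apply: ler_pM; rewrite ?BVnorm_ge0.
have h4 : Q * BVnorm (w * g n) <= Q * (e / (2 * (Q + 1))).
  by apply: ler_wpM2l => //; exact: rgN.
have h5 : 2 * d * M <= e / 2.
  have -> : e / 2 = 2 * d * (M + 1) by rewrite /d; field; apply/eqP; lra.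
  by apply: ler_wpM2l; lra.
have h6 : Q * (e / (2 * (Q + 1))) <= e / 2.
  have -> : e / 2 = (Q + 1) * (e / (2 * (Q + 1))).
    by field; apply/eqP; have : 0 <= Q by []; lra.
  by apply: ler_wpM2r; lra.
rewrite -/Q in h2; lra.
Qed.

(** Since h = h g_N, the vector h(T) x is h(T) (g_N(T) x - g_n(T) x) up to
    (h g_n)(T) x, which tends to 0 by [cutoff_decay]; the difference is small by
    [nested_cauchy]. *)
Lemma local_smallness (r : sigma -> sigma) (c : sigma) (g : nat -> sigma -> R[i]) M x :
  (forall s t, \val s <= \val t -> \val (r s) <= \val (r t)) ->
  (forall n, AC (g n)) -> (forall n, BVnorm (g n) <= M) ->
  (forall n m, (n < m)%N -> g n * g m = g m) ->
  (forall e, 0 < e -> exists N, forall n, (N <= n)%N ->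
     BVnorm ((fun s => (\val (r s) - \val c)%:C) * g n) <= e) ->
  forall e, 0 < e -> exists N, forall h, AC h -> h \o r = h -> h c = 0 ->
    g N * h = h -> rnorm (Phi h x) <= e * BVnorm h.
Proof.
move=> rm gAC gM gg rg e e0.
have Kp : 0 < K + 1 by rewrite ltr_wpDl.
have e'0 : 0 < e / (K + 1) by rewrite divr_gt0.
have [N Ncauchy] := nested_cauchy x gAC gM gg e'0.
exists N => h hAC hr hc gh.
have h0 := BVnorm_ge0 sigma0 (AC_BV hAC).
apply/ler_addgt0Pr => eta eta0.
have eta'0 : 0 < eta / (K * rnorm x + 1).
  by rewrite divr_gt0// ltr_wpDl// mulr_ge0// rnorm_ge0.
have [N' N'h] := cutoff_decay rm gAC gM rg hAC hr hc eta'0.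
pose n := maxn N N'.
have hgAC : AC (h * g n) by exact: AC_funM.
have -> : Phi h x = Phi h (Phi (g N) x - Phi (g n) x) + Phi (h * g n) x.
  by rewrite Phi_subr// (algebra_homM Phi_hom (g := g n))// subrK
    -(algebra_homM Phi_hom)// mulrC gh.
apply: (le_trans (rnormD _ _)); apply: lerD.
  apply: (le_trans (Phi_le _ hAC)).
  apply: (@le_trans _ _ (K * BVnorm h * (e / (K + 1)))).
    apply: ler_wpM2l; first by rewrite mulr_ge0.
    by apply: Ncauchy; rewrite ?leqnn ?leq_maxl.
  have -> : K * BVnorm h * (e / (K + 1)) = (e * BVnorm h) * (K / (K + 1)).
    by field; apply/eqP; lra.
  rewrite -[leRHS]mulr1 ler_wpM2l ?mulr_ge0 ?(ltW e0)//.
  rewrite ler_pdivrMr; lra.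
apply: (le_trans (Phi_le _ hgAC)).
have := N'h n (leq_maxr _ _); move: (BVnorm _) => b be.
apply: (@le_trans _ _ (K * rnorm x * (eta / (K * rnorm x + 1)))).
  by rewrite mulrAC ler_wpM2l// mulr_ge0// rnorm_ge0.
have Kx0 : 0 <= K * rnorm x by rewrite mulr_ge0// rnorm_ge0.
by rewrite mulrCA -[leRHS]mulr1 ler_wpM2l ?(ltW eta0)// ler_pdivrMr; lra.
Qed.

(** * Functions vanishing on a finite set *)

Let eps n : R := n.+1%:R^-1.

Let eps_gt0 n : 0 < eps n. Proof. by rewrite invr_gt0. Qed.

Let eps_le n m : (n <= m)%N -> eps m <= eps n.
Proof. by move=> nm; rewrite lef_pV2 ?posrE// ler_nat. Qed.

Let eps_lt n m : (n < m)%N -> eps m < eps n.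
Proof. by move=> nm; rewrite ltf_pV2 ?posrE// ltr_nat. Qed.

Lemma right_smallness (c : sigma) x (e : R) : 0 < e -> exists2 delta, 0 < delta &
  forall h, AC h -> (forall s, \val s <= \val c -> h s = 0) ->
    (forall s, \val c + delta <= \val s -> h s = 0) ->
    rnorm (Phi h x) <= e * BVnorm h.
Proof.
move=> e0; pose v : R := \val c.
pose rm n := ramp_fun (sigma := sigma) (v + eps n.+1) (v + eps n).
pose g n : sigma -> R[i] := (fun=> 1) - rm n.
have vlt n : v + eps n.+1 < v + eps n by rewrite ltrD2l eps_lt.
have g1 n s : \val s <= v + eps n.+1 -> g n s = 1.
  by move=> sv; rewrite -[LHS]/(1 - (ramp _ _ _)%:C) ramp0// rmorph0 subr0.
have g0 n s : v + eps n <= \val s -> g n s = 0.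
  by move=> sv; rewrite -[LHS]/(1 - (ramp _ _ _)%:C) ramp1// rmorph1 subrr.
have gb n : bounded_by (g n) 2 1.
  have := bounded_byB (bounded_by_cst sigma 1) (@bounded_by_ramp _ sigma _ _ (vlt n)).
  by rewrite normc1 add0r.
have gAC n : AC (g n) by apply: AC_funB => //; [exact: AC_cst|exact: AC_ramp].
have gM n : BVnorm (g n) <= 3.
  by have := BVnorm_le sigma0 (gb n); lra.
have gg n m : (n < m)%N -> g n * g m = g m.
  move=> nm; apply/funext => s; rewrite -[LHS]/(g n s * g m s).
  have [sv|sv] := leP (\val s) (v + eps n.+1); first by rewrite g1// mul1r.
  by rewrite (g0 m) ?mulr0// (le_trans _ (ltW sv))// lerD2l eps_le.
have rg d : 0 < d -> exists N, forall n, (N <= n)%N ->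
    BVnorm ((fun s => (\val (smax c s) - \val c)%:C) * g n) <= d.
  move=> d0; have [N Nd] := invS_small (divr_gt0 d0 (ltr0Sn R 4)).
  exists N => n /Nd; rewrite -/(eps n) => epsd.
  (* On the support of g n, the function r - c is at most eps n, so it can be
     truncated there: the truncation u has variation at most eps n. *)
  pose u (s : sigma) := Num.min (\val (smax c s) - v) (eps n).
  have -> : (fun s => (\val (smax c s) - \val c)%:C) * g n = (fun s => (u s)%:C) * g n.
    apply/funext => s.
    rewrite -[LHS]/((\val (smax c s) - v)%:C * g n s) -[RHS]/((u s)%:C * g n s).
    have [sv|sv] := leP (v + eps n) (\val s); first by rewrite g0// !mulr0.
    congr (_%:C * _); rewrite /u (min_idPl _)// val_smax -/v lerBlDl.
    by rewrite ge_max (ltW sv) lerDl ltW.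
  have ub : bounded_by (fun s => (u s)%:C) (eps n) (eps n - 0).
    apply: bounded_by_monotone; rewrite ?normr0 ?(ltW (eps_gt0 n))//.
    - by move=> s t st; rewrite /u le_min2// lerB// smax_homo.
    - move=> s; rewrite /u le_min ge_min lexx orbT andbT (ltW (eps_gt0 n)) andbT.
      by rewrite subr_ge0 val_smax le_max lexx orbT.
    - by rewrite ger0_norm ?(ltW (eps_gt0 n)).
  have := BVnorm_le sigma0 (bounded_byM sigma0 ub (gb n)); have := eps_gt0 n; lra.
have [N Nh] := local_smallness x (@smax_homo _ _ c) gAC gM gg rg e0.
exists (eps N.+1) => // h hAC hl hr; apply: Nh => //.
- apply/funext => s /=; rewrite /smax; case: leP => // sc.
  by rewrite !hl.
- exact: hl.
- apply/funext => s; rewrite -[LHS]/(g N s * h s).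
  have [sv|sv] := leP (\val s) (v + eps N.+1); first by rewrite g1// mul1r.
  by rewrite hr ?mulr0// ltW.
Qed.

Lemma left_smallness (c : sigma) x (e : R) : 0 < e -> exists2 delta, 0 < delta &
  forall h, AC h -> (forall s, \val c <= \val s -> h s = 0) ->
    (forall s, \val s <= \val c - delta -> h s = 0) ->
    rnorm (Phi h x) <= e * BVnorm h.
Proof.
move=> e0; pose v : R := \val c.
pose g n := ramp_fun (sigma := sigma) (v - eps n) (v - eps n.+1).
have vlt n : v - eps n < v - eps n.+1 by rewrite ltrD2l ltrN2 eps_lt.
have g1 n s : v - eps n.+1 <= \val s -> g n s = 1.
  by move=> sv; rewrite -[LHS]/((ramp _ _ _)%:C) ramp1// rmorph1.
have g0 n s : \val s <= v - eps n -> g n s = 0.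
  by move=> sv; rewrite -[LHS]/((ramp _ _ _)%:C) ramp0// rmorph0.
have gb n : bounded_by (g n) 1 1 by exact: bounded_by_ramp.
have gAC n : AC (g n) by exact: AC_ramp.
have gM n : BVnorm (g n) <= 2.
  by have := BVnorm_le sigma0 (gb n); lra.
have gg n m : (n < m)%N -> g n * g m = g m.
  move=> nm; apply/funext => s; rewrite -[LHS]/(g n s * g m s).
  have [sv|sv] := leP (v - eps n.+1) (\val s); first by rewrite g1// mul1r.
  by rewrite (g0 m) ?mulr0// (le_trans (ltW sv))// lerD2l lerN2 eps_le.
have rg d : 0 < d -> exists N, forall n, (N <= n)%N ->
    BVnorm ((fun s => (\val (smin c s) - \val c)%:C) * g n) <= d.
  move=> d0; have [N Nd] := invS_small (divr_gt0 d0 (ltr0Sn R 4)).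
  exists N => n /Nd; rewrite -/(eps n) => epsd.
  (* The truncation from below at - eps n is harmless on the support of g n. *)
  pose u (s : sigma) := Num.max (\val (smin c s) - v) (- eps n).
  have -> : (fun s => (\val (smin c s) - \val c)%:C) * g n = (fun s => (u s)%:C) * g n.
    apply/funext => s.
    rewrite -[LHS]/((\val (smin c s) - v)%:C * g n s) -[RHS]/((u s)%:C * g n s).
    have [sv|sv] := leP (\val s) (v - eps n); first by rewrite g0// !mulr0.
    congr (_%:C * _); rewrite /u (max_idPl _)// val_smin -/v lerBrDl.
    by rewrite le_min (ltW sv) gerBl ltW.
  have ub : bounded_by (fun s => (u s)%:C) (eps n) (0 - - eps n).
    apply: bounded_by_monotone; rewrite ?normr0 ?(ltW (eps_gt0 n))//.
    - by move=> s t st; rewrite /u le_max2// lerB// smin_homo.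
    - move=> s; rewrite /u le_max lexx orbT ge_max oppr_le0 (ltW (eps_gt0 n)) andbT.
      by rewrite subr_le0 val_smin ge_min lexx orbT.
    - by rewrite normrN ger0_norm ?(ltW (eps_gt0 n)).
  have := BVnorm_le sigma0 (bounded_byM sigma0 ub (gb n)); have := eps_gt0 n; lra.
have [N Nh] := local_smallness x (@smin_homo _ _ c) gAC gM gg rg e0.
exists (eps N.+1) => // h hAC hl hr; apply: Nh => //.
- apply/funext => s /=; rewrite /smin; case: leP => // sc.
  by rewrite (hl _ (ltW sc)) hl.
- exact: hl.
- apply/funext => s; rewrite -[LHS]/(g N s * h s).
  have [sv|sv] := leP (v - eps N.+1) (\val s); first by rewrite g1// mul1r.
  by rewrite hr ?mulr0// ltW.
Qed.

(** The bound involves the variation b of h and not its norm: variations over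
    disjoint intervals can be added. *)
Definition small_up_to x e (F : seq sigma) (c : sigma) := forall h b, AC h ->
  (forall n t, chain n t -> chain_sum h n t <= b) ->
  (forall s, s \in F -> h s = 0) -> (forall s, \val c <= \val s -> h s = 0) ->
  rnorm (Phi h x) <= e * b.

Lemma vanishing_BVnorm_le h b c : (forall n u, chain n u -> chain_sum h n u <= b) ->
  h c = 0 -> BVnorm h <= b *+ 2.
Proof.
move=> hb hc; rewrite mulr2n; apply: (BVnorm_le sigma0); split=> // s.
by rewrite -[h s]subr0 -hc; exact: chain_osc.
Qed.

(** A function h that vanishes at c is the sum of h \o smin c, covered by the
    hypothesis up to c, and h \o smax c, supported between c and d. *)
Lemma small_up_to_extend x e F (c d : sigma) : 0 < e -> small_up_to x e F c ->
  \val c <= \val d ->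
  (forall h, AC h -> (forall s, \val s <= \val c -> h s = 0) ->
    (forall s, \val d <= \val s -> h s = 0) ->
    rnorm (Phi h x) <= e / 2 * BVnorm h) ->
  small_up_to x e (c :: F) d.
Proof.
move=> e0 Fc cd good h b hAC hb hF hd.
have hc : h c = 0 by apply: hF; rewrite mem_head.
pose h1 := h \o smin c; pose h2 := h \o smax c.
have h1AC : AC h1 by exact: AC_smin.
have h2AC : AC h2 by exact: AC_smax.
have hE : h = h1 + h2.
  apply/funext => s; rewrite -[RHS]/(h (smin c s) + h (smax c s)) /smin /smax.
  by case: leP => _; rewrite hc ?addr0 ?add0r.
pose b1 := fine (var h1).
have h1b : forall n u, chain n u -> chain_sum h1 n u <= b1.
  apply/var_le; rewrite /b1 fineK// ge0_fin_numE ?var_ge0//.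
  by have [] := h1AC.
(* The variation left for h2 is b minus that of h1, by [chain_sum_split]. *)
have h2b : forall n u, chain n u -> chain_sum h2 n u <= b - b1.
  move=> n u un; rewrite lerBrDr addrC -lerBrDr -lee_fin /b1.
  rewrite fineK; last by rewrite ge0_fin_numE ?var_ge0//; have [] := h1AC.
  by apply/var_le => m t tm; rewrite lerBrDr; exact: chain_sum_split tm un.
have -> : e * b = e * b1 + e * (b - b1) by ring.
rewrite hE (algebra_homD Phi_hom)//.
apply: (le_trans (rnormD _ _)); apply: lerD.
  apply: Fc => // s.
    move=> sF; rewrite /h1 /= /smin; case: leP => // _.
    by apply: hF; rewrite inE sF orbT.
  move=> cs; rewrite /h1 /= /smin; case: leP => // sc.
  by rewrite (_ : s = c)//; apply/val_inj/le_anti; rewrite sc.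
have h2c : h2 c = 0 by rewrite /h2 /= /smax lexx.
apply: (@le_trans _ _ (e / 2 * BVnorm h2)).
  apply: good => // s; rewrite /h2 /= /smax; first by move=> ->.
  by move=> ds; case: leP => // _; exact: hd.
have h2le : BVnorm h2 <= (b - b1) * 2.
  by rewrite mulr_natr; exact: vanishing_BVnorm_le h2b h2c.
have e20 : 0 <= e / 2 by rewrite divr_ge0// ltW.
have := ler_wpM2l e20 h2le; lra.
Qed.

Lemma closed_approx (a : R) : (forall e, 0 < e -> exists2 s, sigma s & `|a - s| < e) ->
  sigma a.
Proof.
move=> aS; apply: sigma_closed => B [e /= e0 eB].
have [s ss sa] := aS _ e0; exists s; split=> //; exact: eB.
Qed.

(** Induction along sigma: the supremum m of the points up to which the estimate
    holds is reached by [left_smallness], and no point of sigma lies beyond m by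
    [right_smallness], since the estimate could be extended either to a nearby
    point or across a gap of sigma. *)
Lemma small_off_finite x e : 0 < e -> exists F : seq sigma, forall h, AC h ->
  (forall s, s \in F -> h s = 0) -> rnorm (Phi h x) <= e * BVnorm h.
Proof.
move=> e0; have e20 : 0 < e / 2 by rewrite divr_gt0.
have [B sB] := sigma_bounded.
have zero_ok h b : (forall s, h s = 0) ->
    (forall n u, chain n u -> chain_sum h n u <= b) -> AC h -> rnorm (Phi h x) <= e * b.
  move=> hz hb hAC; have [c sc] := sigma0; pose t0 : sigma := exist _ c (mem_set sc).
  have b0 : 0 <= b := le_trans (normc_ge0 _) (chain_osc t0 t0 hb).
  have -> : h = h - h by apply/funext => s; rewrite -[RHS]/(h s - h s) hz subr0.
  by rewrite Phi_sub// subrr rnorm0 mulr_ge0// ltW.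
have sup_in (A : set R) : A !=set0 -> A `<=` sigma -> sigma (sup A).
  move=> A0 As; have hA : has_sup A.
    split=> //; exists B => s /As ss; have := sB (exist _ s (mem_set ss)).
    exact: le_trans (ler_norm _).
  apply: closed_approx => d d0; have [s As' sd] := sup_adherent d0 hA.
  exists s; first exact: As.
  by have ss := ub_le_sup hA.2 As'; rewrite ger0_norm ?subr_ge0//; lra.
have inf_in (A : set R) : A !=set0 -> A `<=` sigma -> sigma (inf A).
  move=> A0 As; have hA : has_inf A.
    split=> //; exists (- B) => s /As ss; have := sB (exist _ s (mem_set ss)).
    by rewrite ler_norml => /andP[].
  apply: closed_approx => d d0; have [s As' sd] := inf_adherent d0 hA.
  exists s; first exact: As.
  by have ss := ge_inf hA.2 As'; rewrite distrC ger0_norm ?subr_ge0//; lra.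
have valS (s : sigma) : sigma (\val s) by exact: set_mem (valP s).
pose S : set R := [set v | exists c : sigma, exists2 F, \val c = v & small_up_to x e F c].
have Ss : S `<=` sigma by move=> _ [c [F <- _]].
have S0 : S !=set0.
  have infS : sigma (inf sigma) by exact: inf_in.
  pose a : sigma := exist _ (inf sigma) (mem_set infS).
  exists (\val a), a, [::] => // h b hAC hb _ ha; apply: zero_ok => // s.
  apply: ha; apply: ge_inf => //; exists (- B) => s' ss'.
  have := sB (exist _ s' (mem_set ss')).
  by rewrite ler_norml => /andP[].
have hS : has_sup S.
  split=> //; exists B => s /Ss ss; have := sB (exist _ s (mem_set ss)).
  exact: le_trans (ler_norm _).
have supS := sup_in _ S0 Ss.
pose m : sigma := exist _ (sup S) (mem_set supS).
have [Fm mS] : exists F, small_up_to x e F m.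
  have [delta delta0 md] := left_smallness m x e20.
  have [_ [c [F <- cF]] cm] := sup_adherent delta0 hS.
  exists (c :: F); apply: small_up_to_extend => //.
    by apply: (ub_le_sup hS.2); exists c, F.
  move=> h hAC hl hr; apply: md => // s sd; apply: hl.
  by apply: (le_trans sd); exact: ltW.
have mmax (s : sigma) : \val s <= \val m.
  rewrite leNgt; apply/negP => ms.
  have [delta delta0 md] := right_smallness m x e20.
  have [[t mt td]|nt] := 
    pselect (exists2 t : sigma, \val m < \val t & \val t < \val m + delta).
    suff : \val t <= \val m by rewrite leNgt mt.
    apply: (ub_le_sup hS.2); exists t, (m :: Fm) => //.
    apply: small_up_to_extend => //; first exact: ltW.
    by move=> h hAC hl hr; apply: md => // s' sd; apply: hr; apply: le_trans sd; exact: ltW.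
  (* Right of m there is a gap of sigma; its other end t is the next candidate,
     as functions supported inside the gap vanish. *)
  pose A : set R := [set v | sigma v /\ \val m < v].
  have A0 : A !=set0 by exists (\val s).
  have Asub : A `<=` sigma by move=> v [].
  have infA := inf_in _ A0 Asub.
  pose t : sigma := exist _ (inf A) (mem_set infA).
  have At v : A v -> \val t <= v.
    move=> Av; apply: ge_inf => //; exists (\val m) => w [_ /ltW]; exact.
  have mt : \val m + delta <= \val t.
    apply: lb_le_inf => // v [sv mv]; rewrite leNgt; apply/negP => vd.
    by apply: nt; exists (exist _ v (mem_set sv)).
  suff : \val t <= \val m by lra.
  apply: (ub_le_sup hS.2); exists t, (m :: Fm) => //.
  apply: small_up_to_extend => //; first lra.
  move=> h hAC hl hr.
  have hz s' : h s' = 0.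
    have [sm|sm] := leP (\val s') (\val m); first exact: hl.
    by apply: hr; apply: At.
  by apply: md => // s' _; exact: hz.
exists (m :: Fm) => h hAC hF.
have [a [b [hab <-]]] := BV_bounded_by sigma0 (AC_BV hAC).
have [a0 b0] := bounded_by_ge0 sigma0 hab.
apply: (@le_trans _ _ (e * b)); last by rewrite ler_wpM2l ?(ltW e0)// lerDr.
apply: mS => //; first exact: bnd_chain hab.
  by move=> s sF; apply: hF; rewrite inE sF orbT.
move=> s ms; rewrite (_ : s = m); first by apply: hF; rewrite mem_head.
by apply/val_inj/le_anti; rewrite ms mmax.
Qed.

(** * The BV calculus on a uniformly convex space *)

(** The vector y is the limit of h(T) x when h runs over a bounded part of AC and
    converges pointwise to f.  Agreement with f on a finite set suffices to
    describe this convergence, as interpolants agree with f exactly. *)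
Definition pointwise_limit f x y := forall M e : R, 0 < e -> exists F : seq sigma,
  forall h, AC h -> BVnorm h <= M -> {in F, h =1 f} -> rnorm (Phi h x - y) <= e.

Lemma AC_pointwise_limit f x : AC f -> pointwise_limit f x (Phi f x).
Proof.
move=> fAC M e e0.
have n0 : 0 < `|M| + BVnorm f + 1.
  by rewrite ltr_wpDl// addr_ge0// (BVnorm_ge0 sigma0 (AC_BV fAC)).
have [F small] := small_off_finite x (divr_gt0 e0 n0).
exists F => h hAC hM hf; rewrite -Phi_sub//.
apply: (le_trans (small _ _ _)); first exact: AC_funB.
  by move=> s sF; rewrite -[LHS]/(h s - f s) hf// subrr.
rewrite mulrAC ler_pdivrMr// ler_wpM2l ?(ltW e0)//.
have := BVnormB sigma0 (AC_BV hAC) (AC_BV fAC); have := ler_norm M; lra.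
Qed.

(** With finite sets F n given by [small_off_finite] for the precision 1 / (n + 1),
    interpolants of f on the union of F 0, ..., F n give a Cauchy sequence. *)
Lemma pointwise_limit_exists f x : BV f -> exists y, pointwise_limit f x y.
Proof.
move=> fBV.
have smallF n : exists F : seq sigma, forall h, AC h -> (forall s, s \in F -> h s = 0) ->
    rnorm (Phi h x) <= n.+1%:R^-1 * BVnorm h.
  exact: small_off_finite.
have [F small] := choice smallF.
pose G n := flatten [seq F i | i <- iota 0 n.+1].
have FG m n s : (m <= n)%N -> s \in F m -> s \in G n.
  move=> mn sm; apply/flattenP; exists (F m) => //; apply/mapP; exists m => //.
  by rewrite mem_iota.
have [h hP] := choice (fun n => BV_interpolant sigma0 sigma_bounded (G n) fBV).
have hAC n : AC (h n) by have [] := hP n.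
have hM n : BVnorm (h n) <= 2 * BVnorm f by have [] := hP n.
have hf m n s : (m <= n)%N -> s \in F m -> h n s = f s.
  by move=> mn sm; have [_ _] := hP n; apply; exact: FG sm.
have f0 := BVnorm_ge0 sigma0 fBV.
have arch (e C : R) : 0 < e -> 0 <= C -> exists N : nat, N.+1%:R^-1 * C <= e.
  move=> e0 C0; have C1 : 0 < C + 1 by rewrite ltr_wpDl.
  have [N NP] := invS_small (divr_gt0 e0 C1); exists N.
  apply: (@le_trans _ _ (e / (C + 1) * (C + 1))); last by rewrite divfK ?gt_eqF.
  by apply: ler_pM => //; [exact: NP|rewrite lerDl].
have dist N k n : (N <= n)%N -> AC k -> {in F N, k =1 f} ->
    rnorm (Phi k x - Phi (h n) x) <= N.+1%:R^-1 * (BVnorm k + 2 * BVnorm f).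
  move=> Nn kAC kf; rewrite -Phi_sub//.
  apply: (le_trans (small N _ _ _)); first exact: AC_funB.
    by move=> s sN; rewrite -[LHS]/(k s - h n s) kf// (hf _ _ _ Nn sN) subrr.
  rewrite ler_wpM2l// (le_trans (BVnormB _ _ _))//; try exact: AC_BV.
  by rewrite lerD2l.
have [e e0|y hy] := @complX (fun n => Phi (h n) x).
  have [N Ne] := arch e (4 * BVnorm f) e0 (mulr_ge0 (ler0n R 4) f0).
  exists N => n m Nn Nm; apply: le_trans Ne.
  apply: (le_trans (dist N (h n) m Nm (hAC n) _)).
    by move=> s; exact: hf.
  by rewrite ler_wpM2l//; have := hM n; lra.
exists y => M e e0; have e20 : 0 < e / 2 by rewrite divr_gt0.
have [N1 N1y] := hy _ e20.
have C0 : 0 <= `|M| + 2 * BVnorm f by rewrite addr_ge0// mulr_ge0.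
have [N2 N2e] := arch (e / 2) (`|M| + 2 * BVnorm f) e20 C0.
exists (F N2) => k kAC kM kf.
apply: (le_trans (rnorm_triangle (Phi (h (maxn N1 N2)) x) _ _)).
rewrite (splitr e); apply: lerD; last by apply: N1y; rewrite leq_maxl.
apply: (le_trans (dist N2 k (maxn N1 N2) (leq_maxr _ _) kAC kf)).
apply: le_trans N2e; rewrite ler_wpM2l// lerD2r (le_trans kM)// ?ler_norm//.
Qed.

Definition BV_extension f x : X := xget 0 (pointwise_limit f x).
Local Notation Psi := BV_extension.

Lemma BV_extensionP f x : BV f -> pointwise_limit f x (Psi f x).
Proof.
move=> fBV; have [y yP] := pointwise_limit_exists x fBV.
exact: (xgetI 0 yP).
Qed.

Lemma BV_extension_AC f x : AC f -> Psi f x = Phi f x.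
Proof.
move=> fAC; apply: (@rnorm_eq_of_small _ _ _ _ 2) => // e e0.
have [F1 F1P] := BV_extensionP x (AC_BV fAC) (BVnorm f) e0.
have [F2 F2P] := AC_pointwise_limit x fAC (BVnorm f) e0.
have [h1 h2] : rnorm (Phi f x - Psi f x) <= e /\ rnorm (Phi f x - Phi f x) <= e.
  by split; [exact: F1P|exact: F2P].
by rewrite rnormBC; lra.
Qed.

Lemma BV_extension_approx f x e : BV f -> 0 < e -> exists h,
  [/\ AC h, BVnorm h <= 2 * BVnorm f & rnorm (Phi h x - Psi f x) <= e].
Proof.
move=> fBV e0; have [F FP] := BV_extensionP x fBV (2 * BVnorm f) e0.
have [h [hAC hM hf]] := BV_interpolant sigma0 sigma_bounded F fBV.
by exists h; split=> //; exact: FP.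
Qed.

Let inl_cat (F G : seq sigma) f h : {in F ++ G, h =1 f} -> {in F, h =1 f}.
Proof. by move=> H s sF; apply: H; rewrite mem_cat sF. Qed.

Let inr_cat (F G : seq sigma) f h : {in F ++ G, h =1 f} -> {in G, h =1 f}.
Proof. by move=> H s sG; apply: H; rewrite mem_cat sG orbT. Qed.

Lemma BV_extensionD f g x : BV f -> BV g -> Psi (f + g) x = Psi f x + Psi g x.
Proof.
move=> fBV gBV; have fgBV := BV_funD sigma0 fBV gBV.
apply: (@rnorm_eq_of_small _ _ _ _ 3) => // e e0.
have [F1 F1P] := BV_extensionP x fBV (2 * BVnorm f) e0.
have [F2 F2P] := BV_extensionP x gBV (2 * BVnorm g) e0.
have [F3 F3P] := BV_extensionP x fgBV (2 * BVnorm f + 2 * BVnorm g) e0.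
pose F := F1 ++ F2 ++ F3.
have [h [hAC hM hf]] := BV_interpolant sigma0 sigma_bounded F fBV.
have [k [kAC kM kg]] := BV_interpolant sigma0 sigma_bounded F gBV.
have d1 := F1P h hAC hM (inl_cat hf).
have d2 := F2P k kAC kM (inl_cat (inr_cat kg)).
have d3 : rnorm (Phi (h + k) x - Psi (f + g) x) <= e.
  apply: F3P; first exact: AC_funD.
    by apply: (le_trans (BVnormD sigma0 (AC_BV hAC) (AC_BV kAC))); exact: lerD.
  move=> s sF; rewrite -[LHS]/(h s + k s) (inr_cat (inr_cat hf))//.
  by rewrite (inr_cat (inr_cat kg)).
apply: (le_trans (rnorm_triangle (Phi (h + k) x) _ _)).
rewrite rnormBC (algebra_homD Phi_hom)// opprD addrACA.
rewrite (algebra_homD Phi_hom)// in d3.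
have := rnormD (Phi h x - Psi f x) (Phi k x - Psi g x); lra.
Qed.

Lemma BV_extensionZ a f x : BV f -> Psi (a *: f) x = a *: Psi f x.
Proof.
move=> fBV; have afBV := BV_funZ sigma0 a fBV.
have C0 : 0 <= normc a + 1 by rewrite addr_ge0// normc_ge0.
apply: (rnorm_eq_of_small C0) => e e0.
have [F1 F1P] := BV_extensionP x fBV (2 * BVnorm f) e0.
have [F2 F2P] := BV_extensionP x afBV (normc a * (2 * BVnorm f)) e0.
have [h [hAC hM hf]] := BV_interpolant sigma0 sigma_bounded (F1 ++ F2) fBV.
have d1 := F1P h hAC hM (inl_cat hf).
have d2 : rnorm (Phi (a *: h) x - Psi (a *: f) x) <= e.
  apply: F2P; first exact: AC_funZ.
    apply: (le_trans (BVnormZ sigma0 a (AC_BV hAC))).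
    by rewrite ler_wpM2l ?normc_ge0.
  by move=> s sF; rewrite -[LHS]/(a * h s) (inr_cat hf).
apply: (le_trans (rnorm_triangle (Phi (a *: h) x) _ _)).
rewrite rnormBC (algebra_homZ Phi_hom)// -scalerBr rnormZ.
rewrite (algebra_homZ Phi_hom)// in d2.
have := ler_wpM2l (normc_ge0 a) d1; lra.
Qed.

Lemma BV_extension_lin f a x y : BV f ->
  Psi f (a *: x + y) = a *: Psi f x + Psi f y.
Proof.
move=> fBV.
have C0 : 0 <= normc a + 2 by rewrite addr_ge0// normc_ge0.
apply: (rnorm_eq_of_small C0) => e e0.
have [F1 F1P] := BV_extensionP x fBV (2 * BVnorm f) e0.
have [F2 F2P] := BV_extensionP y fBV (2 * BVnorm f) e0.
have [F3 F3P] := BV_extensionP (a *: x + y) fBV (2 * BVnorm f) e0.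
have [h [hAC hM hf]] :=
  BV_interpolant sigma0 sigma_bounded (F1 ++ F2 ++ F3) fBV.
have d1 := F1P h hAC hM (inl_cat hf).
have d2 := F2P h hAC hM (inl_cat (inr_cat hf)).
have d3 := F3P h hAC hM (inr_cat (inr_cat hf)).
apply: (le_trans (rnorm_triangle (Phi h (a *: x + y)) _ _)).
rewrite (rnormBC (Psi _ _)) Phi_lin// opprD addrACA -scalerBr.
rewrite Phi_lin// in d3.
have := rnormD (a *: (Phi h x - Psi f x)) (Phi h y - Psi f y).
have := ler_wpM2l (normc_ge0 a) d1; rewrite rnormZ; lra.
Qed.

(** Norm convergence makes (h k)(T) x = h(T) (k(T) x) pass to the limit: h(T) is
    bounded uniformly, and k(T) x converges. *)
Lemma BV_extensionM f g x : BV f -> BV g -> Psi (f * g) x = Psi f (Psi g x).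
Proof.
move=> fBV gBV; have fgBV := BV_funM sigma0 fBV gBV.
have f0 := BVnorm_ge0 sigma0 fBV; have g0 := BVnorm_ge0 sigma0 gBV.
have Kf0 : 0 <= K * (2 * BVnorm f) by rewrite !mulr_ge0.
have C0 : 0 <= K * (2 * BVnorm f) + 2 by rewrite addr_ge0.
apply: (rnorm_eq_of_small C0) => e e0.
have [F1 F1P] := BV_extensionP (Psi g x) fBV (2 * BVnorm f) e0.
have [F2 F2P] := BV_extensionP x gBV (2 * BVnorm g) e0.
have [F3 F3P] := BV_extensionP x fgBV ((2 * BVnorm f) * (2 * BVnorm g)) e0.
pose F := F1 ++ F2 ++ F3.
have [h [hAC hM hf]] := BV_interpolant sigma0 sigma_bounded F fBV.
have [k [kAC kM kg]] := BV_interpolant sigma0 sigma_bounded F gBV.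
have d1 := F1P h hAC hM (inl_cat hf).
have d2 := F2P k kAC kM (inl_cat (inr_cat kg)).
have d3 : rnorm (Phi (h * k) x - Psi (f * g) x) <= e.
  apply: F3P; first exact: AC_funM.
    apply: (le_trans (BVnormM sigma0 (AC_BV hAC) (AC_BV kAC))).
    by apply: ler_pM; rewrite ?(BVnorm_ge0 sigma0 (AC_BV hAC))
      ?(BVnorm_ge0 sigma0 (AC_BV kAC)).
  move=> s sF; rewrite -[LHS]/(h s * k s) (inr_cat (inr_cat hf))//.
  by rewrite (inr_cat (inr_cat kg)).
have d4 : rnorm (Phi h (Phi k x) - Phi h (Psi g x)) <= K * (2 * BVnorm f) * e.
  rewrite -Phi_subr//; apply: (le_trans (Phi_le _ hAC)).
  apply: ler_pM; rewrite ?rnorm_ge0 ?ler_wpM2l ?mulr_ge0//.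
  exact: BVnorm_ge0 (AC_BV hAC).
rewrite (algebra_homM Phi_hom)// in d3.
have t1 := rnorm_triangle (Phi h (Phi k x)) (Psi (f * g) x) (Psi f (Psi g x)).
have t2 := rnorm_triangle (Phi h (Psi g x)) (Phi h (Phi k x)) (Psi f (Psi g x)).
rewrite (rnormBC (Psi (f * g) x) (Phi h (Phi k x))) in t1; lra.
Qed.

Lemma BV_extension_le f x : BV f -> rnorm (Psi f x) <= K * (2 * BVnorm f) * rnorm x.
Proof.
move=> fBV; apply/ler_addgt0Pr => e e0.
have [h [hAC hM hx]] := BV_extension_approx x fBV e0.
have -> : Psi f x = Phi h x - (Phi h x - Psi f x) by rewrite opprB addrCA subrr addr0.
apply: (le_trans (rnormB _ _)); apply: lerD => //.
by apply: (le_trans (Phi_le _ hAC)); rewrite ler_wpM2r ?rnorm_ge0// ler_wpM2l.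
Qed.

Lemma BV_extension_hom : algebra_hom BV Psi.
Proof.
split.
- move=> f fBV; split=> [a x y|]; first exact: BV_extension_lin.
  by exists (K * (2 * BVnorm f)) => x; exact: BV_extension_le.
- by move=> f g fBV gBV x; exact: BV_extensionD.
- by move=> a f fBV x; exact: BV_extensionZ.
- by move=> f g fBV gBV x; exact: BV_extensionM.
Qed.

End calculus.

(** * Integral norms and almost everywhere convergence *)

Section power.
Context (R : realType).

(** The absolute value makes the power continuous at 0, because x `^ p is 1 for
    negative x. *)
Lemma norm_powR_continuous (p : R) : 0 < p ->
  continuous (fun x : R => `|x| `^ p).
Proof.
move=> p0 x; have [->|x0] := eqVneq x 0.
  rewrite /continuous_at normr0 powR0 ?gt_eqF//.
  apply/cvgrPdist_le => e e0; near=> y.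
  rewrite sub0r normrN ger0_norm ?powR_ge0//.
  have : `|y| <= e `^ p^-1.
    near: y; apply/nbhs_ballP; exists (e `^ p^-1); first exact: powR_gt0.
    by move=> y; rewrite /ball /= sub0r normrN => /ltW.
  move=> /(ge0_ler_powR (ltW p0)) H.
  have := H _ _; rewrite !nnegrE normr_ge0 powR_ge0 => /(_ isT isT) => /le_trans; apply.
  by rewrite -powRrM mulVf ?gt_eqF// powRr1// ltW.
apply: (@continuous_comp _ _ _ (fun x : R => `|x|) (fun x => x `^ p)).
  exact: norm_continuous.
have nx : 0 < `|x| by rewrite normr_gt0.
apply: differentiable_continuous; apply/derivable1_diffP.
by have [] := @is_derive1_powR R p `|x| nx.
Unshelve. all: by end_near. Qed.

Lemma cvg_powR (u : nat -> R) (l p : R) : 0 < p -> (forall n, 0 <= u n) -> 0 <= l ->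
  u @ \oo --> l -> (fun n => u n `^ p) @ \oo --> l `^ p.
Proof.
move=> p0 u0 l0 ul.
have := cvg_comp _ _ ul (@norm_powR_continuous p p0 l).
rewrite ger0_norm//; apply: cvg_trans; apply: near_eq_cvg; apply: nearW => n /=.
by rewrite ger0_norm.
Qed.

End power.

Section Lp_functions.
Context d (Omega : measurableType d) (R : realType).
Variable mu : {measure set Omega -> \bar R}.
Implicit Types (u v : L0 mu) (p q : R).

(** The root in the definition of the norm is removed once and for all. *)
Lemma L0norm_leP p u (c : R) : 0 < p -> 0 <= c ->
  (L0norm p u <= c%:E)%E =
  (\int[mu]_w (normc (repr u w) `^ p)%:E <= (c `^ p)%:E)%E.
Proof.
move=> p0 c0; rewrite /L0norm cLnormE.
have I0 : (0 <= \int[mu]_w (normc (repr u w) `^ p)%:E)%E.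
  by apply: integral_ge0 => w _; rewrite lee_fin powR_ge0.
apply/idP/idP => [h|h].
  have := @gt0_ler_poweR R p (ltW p0) _ _ _ _ h.
  rewrite -poweRrM mulVf ?gt_eqF// poweRe1// poweR_EFin; apply.
    by rewrite in_itv /= poweR_ge0 leey.
  by rewrite in_itv /= lee_fin c0 leey.
have pV : 0 <= p^-1 by rewrite invr_ge0 ltW.
have := @gt0_ler_poweR R p^-1 pV _ _ _ _ h.
rewrite poweR_EFin -powRrM mulfV ?gt_eqF// powRr1//; apply.
  by rewrite in_itv /= I0 leey.
by rewrite in_itv /= lee_fin powR_ge0 leey.
Qed.

Lemma repr_linE (a : R[i]) u v :
  {ae mu, forall w, repr (a *: u + v) w = a * repr u w + repr v w}.
Proof.
have -> : a *: u + v = (\pi_(L0 mu) (a *: repr u + repr v))%qT.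
  by rewrite L0_piD L0_piZ !reprK.
exact: L0_reprP.
Qed.

Lemma repr_subE u v : {ae mu, forall w, repr (u - v) w = repr u w - repr v w}.
Proof.
rewrite addrC -scaleN1r; apply: filterS (repr_linE (-1) v u) => w ->.
by rewrite mulN1r addrC.
Qed.

Lemma L0normN p u : 1 <= p -> L0norm p (- u) = L0norm p u.
Proof. by move=> p1; rewrite -scaleN1r L0normZ// normcN normc1 mul1e. Qed.

Lemma L0normBC p u v : 1 <= p -> L0norm p (u - v) = L0norm p (v - u).
Proof. by move=> p1; rewrite -L0normN// opprB. Qed.

Lemma L0norm_fatou q (un : nat -> L0 mu) u (C : R) : 0 < q -> 0 <= C ->
  {ae mu, forall w, (fun k => normc (repr (un k) w)) @ \oo --> normc (repr u w)} ->
  (forall k, (L0norm q (un k) <= C%:E)%E) -> (L0norm q u <= C%:E)%E.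
Proof.
move=> q0 C0 uu unC; rewrite L0norm_leP//.
pose F k w : \bar R := (normc (repr (un k) w) `^ q)%:E.
have mF k : measurable_fun setT (F k) by exact: measurable_normc_powR.
have F0 k w : setT w -> (0 <= F k w)%E by rewrite lee_fin powR_ge0.
have mlim : measurable_fun setT (fun w => limn_einf (F ^~ w)).
  apply: (emeasurable_fun_cvg (fun n w => einfs (F ^~ w) n)).
    exact: measurable_fun_einfs.
  by move=> w _; rewrite limn_einf_lim; exact: is_cvg_einfs.
apply: (@le_trans _ _ (\int[mu]_w limn_einf (F ^~ w))%E).
  apply: ae_ge0_le_integral => //.
  - by move=> w _; rewrite lee_fin powR_ge0.
  - exact: measurable_normc_powR.
  - move=> w _; rewrite limn_einf_lim; apply: lime_ge; first exact: is_cvg_einfs.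
    by apply: nearW => n; apply: le_ereal_inf_tmp => _ [m _ <-]; exact: F0.
  apply: filterS uu => w uw _.
  have Fc : F ^~ w @ \oo --> (normc (repr u w) `^ q)%:E.
    apply: cvg_EFin; first exact: nearW.
    by apply: cvg_powR => // [n|]; exact: normc_ge0.
  have [<- _] := cvg_limn_einf_sup Fc; exact: lexx.
have FT := fatou mu measurableT mF F0.

apply: (le_trans FT).
rewrite limn_einf_lim; apply: lime_le; first exact: is_cvg_einfs.
apply: nearW => n; apply: (@le_trans _ _ (\int[mu]_w F n w)%E).
  by apply: ereal_inf_lbound; exists n => /=.
by rewrite -L0norm_leP.
Qed.

(** The first factor is the bound obtained almost everywhere in [fast_rate_ae]; the
    second one makes the integrals of the p-th powers summable. *)
Definition fast_rate p k : R := 2^-1 ^+ k * (2^-1 ^+ k.+1) `^ p^-1.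

Lemma fast_rate_gt0 p k : 0 < fast_rate p k.
Proof. by rewrite mulr_gt0 ?powR_gt0 ?exprn_gt0. Qed.

(** The p-th powers of 2^k |v_k| have summable integrals, so their sum is finite
    almost everywhere and its terms are eventually at most 1. *)
Lemma fast_rate_ae p (v : nat -> L0 mu) : 0 < p ->
  (forall k, (L0norm p (v k) <= (fast_rate p k)%:E)%E) ->
  {ae mu, forall w, exists N, forall k, (N <= k)%N ->
     normc (repr (v k) w) <= 2^-1 ^+ k}.
Proof.
move=> p0 vk.
pose F k w : \bar R := ((2 ^+ k * normc (repr (v k) w)) `^ p)%:E.
have F0 k w : (0 <= F k w)%E by rewrite lee_fin powR_ge0.
have FE k w : F k w = (((2 ^+ k) `^ p)%:E * (normc (repr (v k) w) `^ p)%:E)%E.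
  by rewrite /F powRM ?exprn_ge0 ?normc_ge0.
have mF k : measurable_fun setT (F k).
  rewrite (_ : F k = fun w => (((2 ^+ k) `^ p)%:E * (normc (repr (v k) w) `^ p)%:E)%E).
    by apply: measurable_funeM; exact: (measurable_normc_powR p (repr (v k))).
  exact/funext.
have iF k : (\int[mu]_w F k w <= (1 / (2 ^ k.+1)%:R)%:E)%E.
  under eq_integral do rewrite FE.
  have -> : (\int[mu]_w (((2 ^+ k) `^ p)%:E * (normc (repr (v k) w) `^ p)%:E) =
      ((2 ^+ k) `^ p)%:E * \int[mu]_w (normc (repr (v k) w) `^ p)%:E)%E.
    apply: ge0_integralZl => //; first exact: measurable_normc_powR.
    by move=> w _; rewrite lee_fin powR_ge0.
  have := vk k; rewrite L0norm_leP ?(ltW (fast_rate_gt0 _ _))// => vk'.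
  apply: (le_trans (lee_wpmul2l _ vk')); first by rewrite lee_fin powR_ge0.
  rewrite -EFinM lee_fin -powRM ?exprn_ge0 ?(ltW (fast_rate_gt0 _ _))//.
  rewrite /fast_rate mulrA -exprMn divff// expr1n !mul1r -powRrM mulVf ?gt_eqF//.
  by rewrite powRr1 ?exprn_ge0// exprVn natrX.
pose S w : \bar R := (\sum_(k <oo) F k w)%E.
have iS : (\int[mu]_w S w <= 1)%E.
  rewrite integral_nneseries//.
  apply: le_trans (epsilon_trick0 xpredT ler01).
  by apply: lee_nneseries => // k _ _; apply: integral_ge0.
have S0 w : (0 <= S w)%E by apply: nneseries_ge0.
have mS : measurable_fun setT S.
  apply: (emeasurable_fun_cvg (fun n w => \sum_(0 <= k < n) F k w)%E).
    by move=> n; exact: emeasurable_sum.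
  by move=> w _; apply: is_cvg_nneseries.
have /integrable_ae : mu.-integrable setT S.
  apply/integrableP; split=> //; under eq_integral do rewrite gee0_abs//.
  by apply: (le_lt_trans iS); rewrite ltry.
move=> /(_ measurableT); apply: filterS => w /(_ I) Sfin.
have Soo : (S w < +oo)%E by rewrite -ge0_fin_numE.
have := @nneseries_tail_cvg R (F ^~ w) xpredT Soo (fun k _ => F0 k w).
move=> /fine_cvgP[tfin] /cvgrPdist_le/(_ 1 ltr01) [N _ Nt].
have [N' _ N'fin] := tfin.
exists (maxn N N') => k; rewrite geq_max => /andP[Nk N'k].
have := Nt k Nk; rewrite /= sub0r normrN => /(le_trans (ler_norm _)) tk.
have Fk : (F k w <= 1)%E.
  apply: (@le_trans _ _ (\sum_(k <= i <oo) F i w)%E).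
    have := @nneseries_lim_ge R (F ^~ w) xpredT k k.+1 (fun n _ _ => F0 n w).
    by rewrite big_nat1.
  by rewrite -(fineK (N'fin k N'k)) lee_fin.
have pVp : 0 <= p^-1 by rewrite invr_ge0 ltW.
have : (2 ^+ k * normc (repr (v k) w)) `^ p <= 1 `^ p.
  by rewrite powR1 -lee_fin.
move=> h; rewrite -(ler_pM2l (exprn_gt0 k (ltr0Sn R 1))) exprVn mulfV; last first.
  by rewrite gt_eqF// exprn_gt0.
rewrite leNgt; apply/negP => h1.
move: h; rewrite leNgt => /negP; apply.
by apply: gt0_ltr_powR => //; rewrite nnegrE ?mulr_ge0 ?exprn_ge0 ?normc_ge0.
Qed.

End Lp_functions.

(** * Convergence, lower semicontinuity and completeness *)

Section complex_norm.
Context (R : realType).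
Implicit Types a b z : R[i].

Lemma normc_dist a b : `|normc a - normc b| <= normc (a - b).
Proof.
have h c z : normc c - normc z <= normc (c - z).
  by rewrite lerBlDr -{1}(subrK z c); exact: le_normcD.
have h' : normc b - normc a <= normc (a - b) by rewrite -(opprB b) normcN; exact: h.
by rewrite ler_norml h andbT -[leRHS]opprB lerN2.
Qed.

Lemma le_Re_normc z : `|complex.Re z| <= normc z.
Proof. by case: z => x y /=; rewrite -sqrtr_sqr ler_wsqrtr// lerDl sqr_ge0. Qed.

Lemma le_Im_normc z : `|complex.Im z| <= normc z.
Proof. by case: z => x y /=; rewrite -sqrtr_sqr ler_wsqrtr// lerDr sqr_ge0. Qed.

Lemma normc_le_ReIm z : normc z <= `|complex.Re z| + `|complex.Im z|.
Proof.
case: z => x y /=; rewrite -[leRHS]ger0_norm ?addr_ge0// -sqrtr_sqr ler_wsqrtr//.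
by rewrite sqrrD !real_normK ?num_real// lerD2r lerDl mulrn_wge0// mulr_ge0.
Qed.

Lemma normc_cvg (a : nat -> R[i]) b :
  (fun k => normc (a k - b)) @ \oo --> (0 : R) ->
  (fun k => normc (a k)) @ \oo --> normc b.
Proof.
move=> /cvgrPdist_le ab; apply/cvgrPdist_le => e /ab; apply: filterS => k.
rewrite sub0r normrN => h; rewrite distrC; apply: le_trans (normc_dist _ _) _.
by rewrite (le_trans (ler_norm _)).
Qed.

Lemma halving_cvg0 (a : nat -> R) : (forall k, 0 <= a k) ->
  (exists N, forall k, (N <= k)%N -> a k <= 2^-1 ^+ k) -> a @ \oo --> (0 : R).
Proof.
move=> a0 [N aN].
apply: (@squeeze_cvgr _ _ _ _ (fun=> 0) (fun k => 2^-1 ^+ k)).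
- by exists N => // k /= Nk; rewrite a0 aN.
- exact: cvg_cst.
by apply: cvg_expr; rewrite ger0_norm// invf_lt1// ltr1n.
Qed.

Lemma halving_cvg (r : nat -> R) N :
  (forall k, (N <= k)%N -> `|r k.+1 - r k| <= 2^-1 ^+ k) -> cvgn r.
Proof.
move=> rk.
have step k m : (N <= k)%N -> `|r (m + k)%N - r k| <= 2 * 2^-1 ^+ k - 2 * 2^-1 ^+ (m + k).
  move=> Nk; elim: m => [|m IH]; first by rewrite add0n !subrr normr0.
  rewrite addSn (_ : _ - _ =
    (r (m + k).+1 - r (m + k)%N) + (r (m + k)%N - r k)); last first.
    by rewrite addrA subrK.
  apply: (le_trans (ler_normD _ _)).
  have := rk (m + k)%N (leq_trans Nk (leq_addl _ _)).
  rewrite exprS; lra.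
apply/cauchy_cvgP/cauchy_exP => e e0.
have [n ne] : exists n, 2 * 2^-1 ^+ n < e.
  have := @cvg_expr R 2^-1.
  rewrite ger0_norm// => /(_ _)/cvgrPdist_lt.
  have -> : (2^-1 : R) < 1 by rewrite invf_lt1// ltr1n.
  move=> /(_ isT (e / 2)) [|n _ H]; first by rewrite divr_gt0.
  exists n; have := H n (leqnn n); rewrite /= sub0r normrN ger0_norm ?exprn_ge0//; lra.
exists (r (maxn N n)); exists (maxn N n) => // i /= mi.
rewrite /ball /= distrC -(subnK mi).
apply: (le_lt_trans (step _ _ (leq_maxl _ _))).
apply: le_lt_trans ne.
have : (2^-1 : R) ^+ maxn N n <= 2^-1 ^+ n.
  by apply: ler_wiXn2l; rewrite ?leq_maxr ?invf_le1 ?ler1n.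
have : 0 <= (2^-1 : R) ^+ (i - maxn N n + maxn N n) by exact: exprn_ge0.
lra.
Qed.

End complex_norm.

Section Lp_limits.
Context d (Omega : measurableType d) (R : realType).
Variable mu : {measure set Omega -> \bar R}.
Implicit Types (u v : L0 mu) (p q : R).

(** A subsequence converges almost everywhere, and Fatou's lemma applies to it. *)
Lemma L0norm_lsc p q (un : nat -> L0 mu) u (C : R) : 1 <= p -> 0 < q -> 0 <= C ->
  (forall e : R, 0 < e -> exists n, (L0norm p (un n - u)%R <= e%:E)%E) ->
  (forall n, (L0norm q (un n) <= C%:E)%E) -> (L0norm q u <= C%:E)%E.
Proof.
move=> p1 q0 C0 unu unC; have p0 : 0 < p by exact: lt_le_trans p1.
have [nk nkP] := choice (fun k => unu _ (fast_rate_gt0 p k)).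
apply: (@L0norm_fatou _ _ _ _ q (fun k => un (nk k))) => //.
have := fast_rate_ae p0 nkP.
have /ae_foralln := fun k => repr_subE (un (nk k)) u.
apply: filterS2 => w wE wN; apply: normc_cvg.
apply: halving_cvg0 => [k|]; first exact: normc_ge0.
by have [N NP] := wN; exists N => k /NP; rewrite wE.
Qed.

Lemma L0norm_eq0_small p u : 1 <= p ->
  (forall e : R, 0 < e -> (L0norm p u <= e%:E)%E) -> u = 0.
Proof.
move=> p1 ue; apply: (L0norm_eq0 (lt_le_trans ltr01 p1)).
apply/le_anti/andP; split; last exact: L0norm_ge0.
by apply/lee_addgt0Pr => e e0; rewrite add0e; exact: ue.
Qed.

(** Limits in different norms agree: the sequence un - u tends to v - u in the norm
    q and its p-norms tend to 0, so lower semicontinuity gives v - u = 0. *)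
Lemma L0lim_unique p q (un : nat -> L0 mu) u v : 1 <= p -> 1 <= q ->
  (forall e : R, 0 < e -> exists N, forall n, (N <= n)%N ->
     (L0norm p (un n - u)%R <= e%:E)%E) ->
  (forall e : R, 0 < e -> exists N, forall n, (N <= n)%N ->
     (L0norm q (un n - v)%R <= e%:E)%E) -> u = v.
Proof.
move=> p1 q1 unu unv; apply/esym/eqP; rewrite -subr_eq0; apply/eqP.
apply: (L0norm_eq0_small p1) => e e0; have [N Nu] := unu _ e0.
apply: (@L0norm_lsc q p (fun n => un (N + n)%N - u)) => //.
- exact: lt_le_trans p1.
- exact: ltW.
- move=> e' e'0; have [N' N'v] := unv _ e'0; exists N'.
  by rewrite opprB addrA subrK; apply: N'v; exact: leq_addl.
by move=> n; apply: Nu; exact: leq_addr.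
Qed.

(** A subsequence with fast decaying increments converges almost everywhere; its
    limit is the limit of the whole sequence by Fatou's lemma. *)
Lemma L0_complete p (un : nat -> L0 mu) : 1 <= p ->
  (forall e : R, 0 < e -> exists N, forall n m, (N <= n)%N -> (N <= m)%N ->
     (L0norm p (un n - un m)%R <= e%:E)%E) ->
  exists u, forall e : R, 0 < e -> exists N, forall n, (N <= n)%N ->
     (L0norm p (un n - u)%R <= e%:E)%E.
Proof.
move=> p1 unC; have p0 : 0 < p by exact: lt_le_trans p1.
have [N NP] := choice (fun k => unC _ (fast_rate_gt0 p k)).
(* By the maximum NP k applies to nk k and to nk k.+1; the term k sends the indices
   to infinity. *)
pose nk k := (k + \max_(j < k.+1) N j)%N.
have Nnk j k : (j <= k)%N -> (N j <= nk k)%N.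
  move=> jk; apply: leq_trans (leq_addl _ _).
  by rewrite -ltnS in jk; exact: (@leq_bigmax _ (fun i : 'I_k.+1 => N i) (Ordinal jk)).
pose v k := un (nk k.+1) - un (nk k).
have vP k : (L0norm p (v k) <= (fast_rate p k)%:E)%E.
  by apply: NP; exact: Nnk.
have : {ae mu, forall w, cvgn (fun k => complex.Re (repr (un (nk k)) w)) /\
   cvgn (fun k => complex.Im (repr (un (nk k)) w))}.
  have := fast_rate_ae p0 vP.
  have /ae_foralln := fun k => repr_subE (un (nk k.+1)) (un (nk k)).
  apply: filterS2 => w wE [M MP]; split; apply: (@halving_cvg _ _ M) => k /MP.
    rewrite wE; apply: le_trans; rewrite -raddfB; exact: le_Re_normc.
  rewrite wE; apply: le_trans; rewrite -raddfB; exact: le_Im_normc.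
move=> [Z [mZ Z0 ZP]].
(* Cutting off the null set Z makes the sequences converge everywhere, so that
   their limits are measurable. *)
pose re k w : R := complex.Re (repr (un (nk k)) w) * \1_(~` Z) w.
pose im k w : R := complex.Im (repr (un (nk k)) w) * \1_(~` Z) w.
have conv w : cvgn (re ^~ w) /\ cvgn (im ^~ w).
  rewrite /re /im indicE; have [wZ|wZ] := boolP (w \in ~` Z); last first.
    by rewrite mulr0n; split; under eq_fun do rewrite mulr0; exact: is_cvg_cst.
  have : ~ Z w by move: wZ; rewrite inE.
  move=> /(contra_not (ZP w))/contrapT [c1 c2].
  by rewrite mulr1n; split; under eq_fun do rewrite mulr1.
have mre k : measurable_fun setT (re k).
  apply: measurable_funM; first by have /cmeasurableP[] := cmfunP (repr (un (nk k))).
  by apply: measurable_indic; exact: measurableC.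
have mim k : measurable_fun setT (im k).
  apply: measurable_funM; first by have /cmeasurableP[] := cmfunP (repr (un (nk k))).
  by apply: measurable_indic; exact: measurableC.
pose f w : R[i] := (limn (re ^~ w) +i* limn (im ^~ w))%C.
have fm : f \in @cmeasurable _ Omega R.
  apply/cmeasurableP; split => /=.
    by apply: (measurable_fun_cvg mre) => w _; have [] := conv w.
  by apply: (measurable_fun_cvg mim) => w _; have [] := conv w.
pose u : L0 mu := (\pi_(L0 mu) (CMfun fm))%qT.
have uP : {ae mu, forall w,
    (fun k => normc (repr (un (nk k)) w - repr u w)) @ \oo --> (0 : R)}.
  have nZ : {ae mu, forall w, ~ Z w}.
    by exists Z; split=> // w /=; apply: contra_notP.
  apply: filterS2 nZ (L0_reprP mu (CMfun fm)) => w wZ uE.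
  have -> : repr u w = f w by exact: uE.
  have [c1 c2] := conv w.
  have wZ' : w \in ~` Z by rewrite inE.
  have d1 : (fun k => complex.Re (repr (un (nk k)) w) - limn (re ^~ w)) @ \oo --> (0 : R).
    apply/subr_cvg0; move: c1; rewrite /re indicE wZ' mulr1n.
    by under eq_fun do rewrite mulr1.
  have d2 : (fun k => complex.Im (repr (un (nk k)) w) - limn (im ^~ w)) @ \oo --> (0 : R).
    apply/subr_cvg0; move: c2; rewrite /im indicE wZ' mulr1n.
    by under eq_fun do rewrite mulr1.
  have d3 := cvgD (cvg_norm d1) (cvg_norm d2); rewrite normr0 addr0 in d3.
  apply: (@squeeze_cvgr _ _ _ _ (fun=> 0)
    (fun k => `|complex.Re (repr (un (nk k)) w) - limn (re ^~ w)| +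
              `|complex.Im (repr (un (nk k)) w) - limn (im ^~ w)|)).
  - apply: nearW => k; rewrite normc_ge0 /=.
    by apply: (le_trans (normc_le_ReIm _)); rewrite !raddfB.
  - exact: cvg_cst.
  - exact: d3.
exists u => e e0; have [M MP] := unC _ e0; exists M => n Mn.
apply: (@L0norm_fatou _ _ _ _ p (fun k => un n - un (nk (k + M)%N))) => //.
- exact: ltW.
- have /ae_foralln := fun k => repr_subE (un n) (un (nk (k + M)%N)).
  move=> H; apply: filterS3 H uP (repr_subE (un n) u) => w kE wu uE; rewrite uE.
  under eq_fun do rewrite kE.
  apply: normc_cvg; move: wu; rewrite -(cvg_shiftn M); apply: cvg_trans.
  apply: near_eq_cvg; apply: nearW => k /=.
  by rewrite opprB [_ + (_ - _)]addrC addrA subrK -normcN opprB.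
move=> k; apply: MP => //; rewrite (leq_trans (leq_addl k M))// leq_addr//.
Qed.

End Lp_limits.

(** * The normed spaces L^p *)

Section Lp_space.
Context d (Omega : measurableType d) (R : realType).
Variable mu : {measure set Omega -> \bar R}.

Section fixed_exponent.
Variables (p : R) (p1 : 1 <= p).
Implicit Types x y : Lp mu p1.

Lemma rnorm_Lp x : (rnorm x)%:E = L0norm p (x : L0 mu).
Proof. by rewrite -[RHS]fineK ?Lp_fin. Qed.

Lemma Lp_valB x y : Lp_val (x - y) = Lp_val x - Lp_val y.
Proof. exact: (raddfB (\val : Lp mu p1 -> L0 mu)). Qed.

Lemma Lp_valD x y : Lp_val (x + y) = Lp_val x + Lp_val y.
Proof. exact: (raddfD (\val : Lp mu p1 -> L0 mu)). Qed.

Lemma Lp_valZ a x : Lp_val (a *: x) = a *: Lp_val x.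
Proof. exact: (linearZZ (\val : Lp mu p1 -> L0 mu)). Qed.

Lemma rnorm_LpB x y : (rnorm (x - y))%:E = L0norm p (Lp_val x - Lp_val y).
Proof. by rewrite rnorm_Lp Lp_valB. Qed.

Lemma Lp_complete_rnorm : complete_rnorm (Lp mu p1).
Proof.
move=> x xC.
have [u uP] : exists u, forall e : R, 0 < e -> exists N, forall n, (N <= n)%N ->
    (L0norm p (Lp_val (x n) - u)%R <= e%:E)%E.
  apply: L0_complete => // e e0; have [N NP] := xC _ e0; exists N => n m Nn Nm.
  by rewrite -rnorm_LpB lee_fin; exact: NP.
have up : u \in @Lp_pred _ _ _ mu p p1.
  have [N NP] := uP 1 ltr01.
  apply/Lp_predP; rewrite /in_Lp /= -[u](subrK (Lp_val (x N))).
  apply: (le_lt_trans (L0normD _ _ p1)).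
  apply: lte_add_pinfty; last exact: Lp_lty.
  by rewrite L0normBC// (le_lt_trans (NP N (leqnn N)))// ltry.
exists (MkLp up) => e e0; have [N NP] := uP _ e0; exists N => n /NP.
by rewrite -lee_fin rnorm_LpB.
Qed.

End fixed_exponent.

(** Truncate u where |u| > n: the result is in L^s because
    |v|^s <= n^(s-1) |v|, and it tends to u in L^1 by dominated convergence. *)
Lemma L1_truncation (u : L0 mu) (s e : R) : 1 < s -> in_Lp 1 u -> 0 < e ->
  exists v, [/\ in_Lp 1 v, in_Lp s v & (L0norm 1 (u - v)%R <= e%:E)%E].
Proof.
move=> s1 u1 e0; have s0 : 0 < s by exact: lt_trans s1.
pose f := repr u.
have mf : measurable_fun setT (fun w => normc (f w)) by exact: measurable_normc.
pose A n : set Omega := [set w | normc (f w) <= n%:R].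
have mA n : measurable (A n).
  rewrite (_ : A n = setT `&` (fun w => normc (f w)) @^-1` [set` `]-oo, n%:R]]).
    by apply: mf => //; exact: measurable_itv.
  by rewrite setTI; apply/seteqP; split=> w; rewrite /A /= in_itv.
pose t n w : R[i] := f w * (\1_(A n) w)%:C.
have tm n : t n \in @cmeasurable _ Omega R.
  have /cmeasurableP[mr mi] := cmfunP f.
  have ReE w : complex.Re (t n w) = complex.Re (f w) * \1_(A n) w.
    by rewrite /t; case: (f w) => a b /=; rewrite mulr0 subr0.
  have ImE w : complex.Im (t n w) = complex.Im (f w) * \1_(A n) w.
    by rewrite /t; case: (f w) => a b /=; rewrite mulr0 add0r.
  apply/cmeasurableP; split; [under eq_fun do rewrite ReE|under eq_fun do rewrite ImE];
    by apply: measurable_funM => //; exact: (measurable_indic _ (mA n)).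
pose v n : L0 mu := (\pi_(L0 mu) (CMfun (tm n)))%qT.
have normt n w : normc (t n w) = normc (f w) * \1_(A n) w.
  by rewrite normcM normc_real ger0_norm.
have int1 (g : cmfun Omega R) :
    (\int[mu]_w (normc (g w) `^ 1)%:E = \int[mu]_w (normc (g w))%:E)%E.
  by apply: eq_integral => w _; rewrite powRr1 ?normc_ge0.
have ufin : (\int[mu]_w (normc (f w))%:E < +oo)%E.
  have := u1; rewrite /in_Lp /= /L0norm cLnormE int1 invr1 poweRe1//.
  by apply: integral_ge0 => w _; rewrite lee_fin normc_ge0.
have v1 n : in_Lp 1 (v n).
  rewrite /in_Lp /= L0norm_pi cLnormE int1 invr1 poweRe1; last first.
    by apply: integral_ge0 => w _; rewrite lee_fin normc_ge0.
  apply: le_lt_trans ufin; apply: ge0_le_integral => //.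
  - by move=> w _; rewrite lee_fin normc_ge0.
  - exact/measurable_EFinP/measurable_normc.
  - exact/measurable_EFinP.
  move=> w _; rewrite lee_fin /= normt -[leRHS]mulr1 ler_wpM2l ?normc_ge0//.
have vs n : in_Lp s (v n).
  rewrite /in_Lp /= L0norm_pi cLnormE; apply: poweR_lty.
  apply: (@le_lt_trans _ _ (\int[mu]_w (((n%:R `^ (s - 1)) : R)%:E * (normc (f w))%:E))%E).
    apply: ge0_le_integral => //.
    - by move=> w _; rewrite lee_fin powR_ge0.
    - exact: measurable_normc_powR.
    - by apply: measurable_funeM; exact/measurable_EFinP.
    move=> w _; rewrite -EFinM lee_fin normt indicE.
    have [wA|wA] := boolP (w \in A n); last first.
      by rewrite mulr0 powR0 ?gt_eqF// mulr_ge0 ?powR_ge0 ?normc_ge0.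
    rewrite mulr1 -mulr_powRB1 ?normc_ge0// mulrC ler_wpM2r ?normc_ge0//.
    apply: ge0_ler_powR; rewrite ?nnegrE ?normc_ge0 ?subr_ge0 ?(ltW s1)//.
    by move: wA; rewrite inE.
  rewrite ge0_integralZl//.
  - by rewrite lte_mul_pinfty ?lee_fin ?powR_ge0.
  - exact/measurable_EFinP.
  - by move=> w _; rewrite lee_fin normc_ge0.
pose g n w : \bar R := (normc (f w - t n w))%:E.
have gE n w : normc (f w - t n w) = normc (f w) * (1 - \1_(A n) w).
  rewrite /t -{1}[f w]mulr1 -mulrBr normcM; congr (_ * _).
  rewrite -[1 in LHS](rmorph1 (real_complex R)) -rmorphB normc_real.
  by rewrite ger0_norm// subr_ge0 indicE; case: (_ \in _).
have mg n : measurable_fun setT (g n).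
  apply/measurable_EFinP.
  rewrite (_ : (fun w => _) = fun w => normc (f w) * (1 - \1_(A n) w)).
    by apply: measurable_funM => //; exact: measurable_funB.
  by apply/funext => w; exact: gE.
have g_cvg0 : {ae mu, forall w, setT w -> g ^~ w @ \oo --> 0%E}.
  apply: nearW => w _; apply: cvg_near_cst.
  exists (Num.bound (normc (f w))) => // n /= Nn.
  rewrite /g gE indicE mem_set ?subrr ?mulr0//.
  rewrite /A /=; apply: (le_trans (ltW (archi_boundP (normc_ge0 (f w))))).
  by rewrite ler_nat.
have intf : mu.-integrable setT (fun w => (normc (f w))%:E).
  apply/integrableP; split; first exact/measurable_EFinP.
  by under eq_integral do rewrite gee0_abs ?lee_fin ?normc_ge0//.
have g_dom : {ae mu, forall w n, setT w -> (`|g n w| <= (normc (f w))%:E)%E}.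
  apply: nearW => w n _; rewrite /g gE gee0_abs ?lee_fin; last first.
    by rewrite -gE normc_ge0.
  rewrite -[leRHS]mulr1 ler_wpM2l ?normc_ge0// gerBl.
have [_ _ gcvg] := dominated_convergence measurableT mg
  (@measurable_cst _ _ _ _ setT 0%E) g_cvg0 intf g_dom.
have [n gn] : exists n, (\int[mu]_w g n w <= e%:E)%E.
  rewrite integral0 in gcvg; move/fine_cvgP: gcvg => [[N' _ N'fin]].
  move=> /cvgrPdist_le/(_ e e0) [N _ Nt]; exists (maxn N N').
  have := Nt (maxn N N') (leq_maxl _ _).
  rewrite /= sub0r normrN => /(le_trans (ler_norm _)).
  by rewrite -lee_fin fineK//; apply: N'fin; exact: leq_maxr.
exists (v n); split=> //; rewrite L0norm_leP ?(ltW e0)// powRr1 ?(ltW e0)//.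
rewrite int1; apply: le_trans gn; apply: ae_ge0_le_integral => //.
- by move=> w _; rewrite lee_fin normc_ge0.
- exact/measurable_EFinP/measurable_normc.
- by move=> w _; rewrite lee_fin normc_ge0.
apply: filterS2 (repr_subE u (v n)) (L0_reprP mu (CMfun (tm n))) => w uE vE _.
by rewrite lee_fin uE vE.
Qed.

End Lp_space.

(** * A quantitative convexity inequality for powers *)

Section power_convexity.
Context (R : realType) (s : R).
Hypothesis s1 : 1 < s.

Let s0 : 0 < s. Proof. exact: lt_trans s1. Qed.
Let s10 : 0 < s - 1. Proof. by rewrite subr_gt0. Qed.

Lemma powR_MVT (a b : R) : 0 <= a -> a < b -> exists2 c, a < c < b &
  b `^ s - a `^ s = s * c `^ (s - 1) * (b - a).
Proof.
move=> a0 ab.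
have [x xab||c] := @MVT R (fun x : R => x `^ s) (fun x => s * x `^ (s - 1)) a b ab.
- by apply: is_derive1_powR; apply: le_lt_trans a0 _; rewrite (itvP xab).
- have H : {in `[a, b]%classic, (fun x : R => `|x| `^ s) =1 (fun x : R => x `^ s)}.
    by move=> x; rewrite inE /= in_itv /= => /andP[ax _]; rewrite ger0_norm// (le_trans a0).
  apply: (subspace_eq_continuous H); apply: continuous_subspaceT => x.
  exact: norm_powR_continuous.
by rewrite in_itv /= => cab E; exists c.
Qed.

Lemma powR_lipschitz (x y : R) : 0 <= x -> x <= y ->
  y `^ s - x `^ s <= s * y `^ (s - 1) * (y - x).
Proof.
move=> x0; rewrite le_eqVlt => /orP[/eqP ->|xy]; first by rewrite !subrr mulr0.
have [c /andP[xc cy] ->] := powR_MVT x0 xy.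
rewrite ler_wpM2r ?subr_ge0 ?(ltW xy)// ler_wpM2l ?(ltW s0)//.
by apply: ge0_ler_powR; rewrite ?nnegrE ?(ltW s10) ?(ltW cy)//; lra.
Qed.

(** Bound x^(s-1) by y^(s-1) in x^s = x x^(s-1). *)
Lemma powR_sub_ge (x y : R) : 0 <= x -> x <= y ->
  y `^ (s - 1) * (y - x) <= y `^ s - x `^ s.
Proof.
move=> x0 xy; have y0 := le_trans x0 xy.
rewrite mulrBr mulrC mulr_powRB1// lerD2l lerN2 -(mulr_powRB1 x0 s0) mulrC.
by rewrite ler_wpM2r//; apply: ge0_ler_powR; rewrite ?nnegrE ?(ltW s10).
Qed.

(** The convexity defect of the s-th power between 1 and r. *)
Definition midpoint_defect (r : R) : R := (1 + r `^ s) / 2 - ((1 + r) / 2) `^ s.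

(** The mean slope of the power over [r, Q] is smaller than over [Q, 1], where Q is
    the midpoint. *)
Lemma midpoint_defect_gt0 (r : R) : 0 <= r -> r < 1 -> 0 < midpoint_defect r.
Proof.
move=> r0 r1; have rQ : r < (1 + r) / 2 by lra.
have Q1 : (1 + r) / 2 < 1 by lra.
have Q0 : 0 <= (1 + r) / 2 by lra.
have [c /andP[rc cQ] cE] := powR_MVT r0 rQ.
have [z /andP[Qz z1] zE] := powR_MVT Q0 Q1.
rewrite powR1 in zE.
have cz : c `^ (s - 1) < z `^ (s - 1).
  by apply: gt0_ltr_powR => //; rewrite ?nnegrE; lra.
rewrite /midpoint_defect.
have : s * c `^ (s - 1) * ((1 + r) / 2 - r) < s * z `^ (s - 1) * (1 - (1 + r) / 2).
  have -> : 1 - (1 + r) / 2 = (1 + r) / 2 - r by field.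
  by rewrite ltr_pM2r ?subr_gt0// ltr_pM2l.
rewrite -cE -zE; lra.
Qed.

Lemma midpoint_defect_ge0 (r : R) : 0 <= r -> r <= 1 -> 0 <= midpoint_defect r.
Proof.
move=> r0; rewrite le_eqVlt => /orP[/eqP ->|r1]; last exact/ltW/midpoint_defect_gt0.
by rewrite /midpoint_defect !powR1 divff// powR1 subrr.
Qed.

Lemma midpoint_defect_bounded_below (r0 : R) : 0 <= r0 -> r0 < 1 -> exists2 c, 0 < c &
  forall r, 0 <= r -> r <= r0 -> c <= midpoint_defect r.
Proof.
move=> r00 r01.
pose n (x : R) := `|x| `^ s.
have nC : continuous n by exact: norm_powR_continuous.
pose k (x : R) := (1 + n x) / 2 - n ((1 + x) / 2).
have kC : continuous k.
  move=> x; apply: cvgB.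
    by apply: cvgM; [apply: cvgD; [exact: cvg_cst|exact: nC]|exact: cvg_cst].
  apply: (@cvg_comp _ _ _ (fun x : R => (1 + x) / 2) n _ (nbhs ((1 + x) / 2))).
    by apply: cvgM; [apply: cvgD; [exact: cvg_cst|exact: cvg_id]|exact: cvg_cst].
  exact: nC.
have kE x : 0 <= x -> k x = midpoint_defect x.
  by move=> x0; rewrite /k /n !ger0_norm//; lra.
have [c] := EVT_min r00 (continuous_subspaceT kC).
rewrite in_itv /= => /andP[c0 cr] cmin; exists (k c).
  by rewrite kE// midpoint_defect_gt0// (le_lt_trans cr).
move=> r rr0 rr; rewrite -kE//; apply: cmin; by rewrite in_itv /= rr0.
Qed.

(** Here r, q, t stand for |b|, |(a + b) / 2|, |a - b| when |a| = 1, and the last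
    hypothesis is the parallelogram law.  If r is far from 1, the gain comes from
    the strict convexity of the power; otherwise a and b have almost the same
    modulus and are far apart, so that their midpoint is well inside the disc. *)
Lemma unit_defect (eta : R) : 0 < eta -> eta <= 1 -> exists2 c, 0 < c &
  forall r q t, 0 <= r -> r <= 1 -> 0 <= q -> q <= (1 + r) / 2 -> eta <= t ->
    4 * q ^+ 2 + t ^+ 2 = 2 + 2 * r ^+ 2 -> c <= (1 + r `^ s) / 2 - q `^ s.
Proof.
move=> eta0 eta1.
have [||c1 c10 c1P] := @midpoint_defect_bounded_below (1 - eta / 2); [lra|lra|].
pose c2 := 2^-1 `^ (s - 1) * (3 * eta ^+ 2 / 32).
have c20 : 0 < c2 by rewrite mulr_gt0 ?powR_gt0// divr_gt0// mulr_gt0// exprn_gt0.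
exists (Num.min c1 c2); first by rewrite lt_min c10.
move=> r q t r0 r1 q0 qQ et E; pose Q := (1 + r) / 2.
have Q0 : 0 <= Q by rewrite /Q; lra.
have dE : (1 + r `^ s) / 2 - q `^ s = midpoint_defect r + (Q `^ s - q `^ s).
  by rewrite /midpoint_defect -/Q addrA subrK.
have qQs : 0 <= Q `^ s - q `^ s.
  by rewrite subr_ge0; apply: ge0_ler_powR; rewrite ?nnegrE ?(ltW s0).
have [rl|rl] := leP r (1 - eta / 2).
  apply: (@le_trans _ _ c1); first by rewrite ge_min lexx.
  by rewrite dE; have := c1P r r0 rl; lra.
apply: (@le_trans _ _ c2); first by rewrite ge_min lexx orbT.
have h := powR_sub_ge q0 qQ; rewrite -/Q in h.
have d0 := midpoint_defect_ge0 r0 r1.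
have Q2 : 2^-1 `^ (s - 1) <= Q `^ (s - 1).
  by apply: ge0_ler_powR; rewrite ?nnegrE ?invr_ge0 ?(ltW s10)//; rewrite /Q; lra.
have Qq : 3 * eta ^+ 2 / 32 <= Q - q.
  have t2 : eta ^+ 2 <= t ^+ 2 by rewrite ler_pXn2r// nnegrE; lra.
  have q1 : q <= 1 by rewrite (le_trans qQ)//; lra.
  have QE : 2 * Q = 1 + r by rewrite /Q; field.
  nra.
have : c2 <= Q `^ (s - 1) * (Q - q).
  by apply: ler_pM; rewrite ?powR_ge0 ?divr_ge0 ?mulr_ge0 ?(ltW eta0).
rewrite dE; lra.
Qed.

Lemma normc_parallelogram (a b : R[i]) :
  normc (a + b) ^+ 2 + normc (a - b) ^+ 2 = 2 * normc a ^+ 2 + 2 * normc b ^+ 2.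
Proof.
case: a b => a1 a2 [b1 b2]; rewrite /= !sqr_sqrtr ?addr_ge0 ?sqr_ge0//; ring.
Qed.

(** By homogeneity take |a| = 1 >= |b|.  If |a - b| is small, the first term on the
    right is enough; otherwise the defect is bounded below by [unit_defect]. *)
Lemma pointwise_convexity (eta : R) : 0 < eta -> exists2 C, 0 < C & forall a b : R[i],
  normc (a - b) `^ s <= eta * (normc a `^ s + normc b `^ s) +
   C * ((normc a `^ s + normc b `^ s) / 2 - (normc (a + b) / 2) `^ s).
Proof.
move=> eta0; pose e1 := Num.min 1 (eta `^ s^-1).
have e10 : 0 < e1 by rewrite lt_min ltr01 powR_gt0.
have e11 : e1 <= 1 by rewrite ge_min lexx.
have e1s : e1 `^ s <= eta.
  rewrite -[leRHS](powRr1 (ltW eta0)) -(mulVf (lt0r_neq0 s0)) powRrM.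
  apply: ge0_ler_powR; rewrite ?nnegrE ?powR_ge0 ?(ltW s0) ?(ltW e10)//.
  by rewrite ge_min lexx orbT.
have [c c0 cP] := unit_defect e10 e11.
exists (2 `^ s / c); first by rewrite divr_gt0// powR_gt0.
have C0 : 0 <= 2 `^ s / c by rewrite divr_ge0 ?powR_ge0// ltW.
suff H (a b : R[i]) : normc b <= normc a ->
   normc (a - b) `^ s <= eta * (normc a `^ s + normc b `^ s) +
   2 `^ s / c * ((normc a `^ s + normc b `^ s) / 2 - (normc (a + b) / 2) `^ s).
  move=> a b; have [ba|/ltW ab] := leP (normc b) (normc a); first exact: H.
  have := H b a ab; rewrite -(normcN (b - a)) opprB (addrC b) => /le_trans; apply.
  by rewrite (addrC (normc b `^ s)).
move=> ba; have a0 := normc_ge0 a; have b0 := normc_ge0 b.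
have [an0|an0] := eqVneq (normc a) 0.
  have bn0 : normc b = 0 by apply/le_anti; rewrite b0 -an0 ba.
  have az := eq0_normc an0; have bz := eq0_normc bn0.
  rewrite az bz subr0 addr0 normc0 mul0r powR0 ?gt_eqF//.
  by rewrite addr0 !mul0r subr0 !mulr0 addr0.
have A0 : 0 < normc a by rewrite lt_def an0.
set A := normc a in an0 A0 ba a0 *; set B := normc b in ba b0 *.
set D := normc (a - b); set S := normc (a + b).
have D0 : 0 <= D := normc_ge0 _; have S0 : 0 <= S := normc_ge0 _.
have SAB : S <= A + B := le_normcD _ _.
have DAB : D <= A + B by rewrite /D (le_trans (le_normcD _ _))// normcN.
have par : S ^+ 2 + D ^+ 2 = 2 * A ^+ 2 + 2 * B ^+ 2 := normc_parallelogram a b.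
pose r := B / A; pose q := S / 2 / A; pose t := D / A.
have BE : B = A * r by rewrite /r mulrCA mulfV// mulr1.
have SE : S / 2 = A * q by rewrite /q mulrCA mulfV// mulr1.
have DE : D = A * t by rewrite /t mulrCA mulfV// mulr1.
have r0 : 0 <= r by rewrite divr_ge0.
have r1 : r <= 1 by rewrite ler_pdivrMr// mul1r.
have q0 : 0 <= q by rewrite !divr_ge0.
have qQ : q <= (1 + r) / 2.
  by rewrite -(ler_pM2l A0) -SE mulrA mulrDr mulr1 -BE; lra.
have defE : (A `^ s + B `^ s) / 2 - (S / 2) `^ s = A `^ s * ((1 + r `^ s) / 2 - q `^ s).
  by rewrite BE SE (powRM _ a0 r0) (powRM _ a0 q0); ring.
have As0 : 0 <= A `^ s := powR_ge0 _ _.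
have [te|te] := leP e1 t.
  have E : 4 * q ^+ 2 + t ^+ 2 = 2 + 2 * r ^+ 2.
    have A2 : A ^+ 2 != 0 by rewrite expf_eq0.
    apply: (mulfI A2); have SE' : S = 2 * (A * q) by rewrite -SE; field.
    rewrite SE' DE BE in par; lra.
  have cd := cP r q t r0 r1 q0 qQ te E.
  have D2 : D `^ s <= 2 `^ s * A `^ s.
    rewrite -powRM//; apply: ge0_ler_powR; rewrite ?nnegrE ?(ltW s0) ?mulr_ge0//; lra.
  have h1 : 2 `^ s * A `^ s <= 2 `^ s / c * (A `^ s * ((1 + r `^ s) / 2 - q `^ s)).
    have -> : 2 `^ s / c * (A `^ s * ((1 + r `^ s) / 2 - q `^ s)) =
      2 `^ s * A `^ s * (((1 + r `^ s) / 2 - q `^ s) / c) by ring.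
    by rewrite -[leLHS]mulr1 ler_wpM2l ?mulr_ge0 ?powR_ge0// ler_pdivlMr// mul1r.
  rewrite defE; apply: (le_trans D2); apply: (le_trans h1).
  by rewrite lerDr mulr_ge0 ?(ltW eta0)// addr_ge0// powR_ge0.
have Ds : D `^ s <= eta * A `^ s.
  apply: (@le_trans _ _ (e1 `^ s * A `^ s)); last by rewrite ler_wpM2r.
  rewrite -powRM ?(ltW e10)//.
  apply: ge0_ler_powR; rewrite ?nnegrE ?(ltW s0) ?mulr_ge0 ?(ltW e10)//.
  by rewrite DE mulrC ler_wpM2r// ltW.
have h1 : 0 <= 2 `^ s / c * ((A `^ s + B `^ s) / 2 - (S / 2) `^ s).
  rewrite mulr_ge0// defE mulr_ge0//.
  have := midpoint_defect_ge0 r0 r1; rewrite /midpoint_defect.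
  have : q `^ s <= ((1 + r) / 2) `^ s.
    by apply: ge0_ler_powR; rewrite ?nnegrE ?(ltW s0)//; lra.
  lra.
have h2 : 0 <= eta * B `^ s by rewrite mulr_ge0 ?powR_ge0// ltW.
rewrite mulrDr; lra.
Qed.

End power_convexity.

(** * Uniform convexity of L^s *)

Section integral_combination.
Local Open Scope ereal_scope.
Context d (Omega : measurableType d) (R : realType).
Variable mu : {measure set Omega -> \bar R}.

Lemma ae_le_integral_combination (a b f g : Omega -> \bar R) (C k : R) :
  (0 <= C)%R -> (0 <= k)%R ->
  (forall w, 0 <= a w) -> (forall w, 0 <= b w) ->
  (forall w, 0 <= f w) -> (forall w, 0 <= g w) ->
  measurable_fun setT a -> measurable_fun setT b ->
  measurable_fun setT f -> measurable_fun setT g ->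
  {ae mu, forall w, a w + C%:E * b w <= k%:E * (f w + g w)} ->
  \int[mu]_w a w + C%:E * \int[mu]_w b w <=
  k%:E * (\int[mu]_w f w + \int[mu]_w g w).
Proof.
move=> C0 k0 a0 b0 f0 g0 ma mb mf mg abfg.
have Cb0 w : 0 <= C%:E * b w by rewrite mule_ge0.
have fg0 w : 0 <= f w + g w by rewrite adde_ge0.
have mCb : measurable_fun setT (fun w => C%:E * b w) by exact: measurable_funeM.
have mfg : measurable_fun setT (fun w => f w + g w) by exact: emeasurable_funD.
rewrite -ge0_integralZl// -ge0_integralD// -ge0_integralD// -ge0_integralZl//.
apply: ae_ge0_le_integral => //.
- by move=> w _; rewrite adde_ge0.
- exact: emeasurable_funD.
- by move=> w _; rewrite mule_ge0.
- exact: measurable_funeM.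
by apply: filterS abfg.
Qed.

End integral_combination.

Section Lp_convexity.
Context d (Omega : measurableType d) (R : realType).
Variable mu : {measure set Omega -> \bar R}.
Variables (s : R) (s1 : 1 < s).
Implicit Types x y : Lp mu (ltW s1).

Let s0 : 0 < s. Proof. exact: lt_trans s1. Qed.

Lemma rnorm_powR x :
  (rnorm x `^ s)%:E = (\int[mu]_w (normc (repr (Lp_val x) w) `^ s)%:E)%E.
Proof.
rewrite -poweR_EFin rnorm_Lp /L0norm cLnormE -poweRrM mulVf ?gt_eqF// poweRe1//.
by apply: integral_ge0 => w _; rewrite lee_fin powR_ge0.
Qed.

Lemma Lp_midpoint_convexity (eta : R) : 0 < eta -> exists2 C, 0 < C & forall x y,
  rnorm (x - y) `^ s + C * rnorm ((2^-1)%:C *: (x + y)) `^ s <=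
  (eta + C / 2) * (rnorm x `^ s + rnorm y `^ s).
Proof.
move=> eta0; have [C C0 CP] := @pointwise_convexity R s s1 eta eta0.
exists C => // x y; rewrite -lee_fin !(EFinD, EFinM) !rnorm_powR.
rewrite Lp_valB Lp_valZ Lp_valD; move: (Lp_val x) (Lp_val y) => u v.
have sumE := repr_linE 1 u v; rewrite scale1r in sumE.
have halfE := repr_linE (2^-1)%:C (u + v) 0; rewrite addr0 in halfE.
have zeroE : {ae mu, forall w, repr (0 : L0 mu) w = 0} by exact: L0_reprP.
have midE : {ae mu, forall w, normc (repr ((2^-1)%:C *: (u + v)) w) =
    normc (repr u w + repr v w) / 2}.
  apply: filterS3 sumE halfE zeroE => w -> -> ->.
  by rewrite mul1r addr0 normcM normc_half mulrC.
apply: ae_le_integral_combination; rewrite ?addr_ge0 ?divr_ge0 ?(ltW C0) ?(ltW eta0)//;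
  try by [move=> w; rewrite lee_fin powR_ge0|exact: measurable_normc_powR].
apply: filterS2 midE (repr_subE u v) => w mE dE.
rewrite mE dE -!EFinD -?EFinM lee_fin.
have := CP (repr u w) (repr v w); rewrite mulrBr; lra.
Qed.

(** Take eta so small that the first term of the midpoint inequality absorbs at
    most half of e^s.  The s-th power of the norm of the midpoint is then at most
    r^s - tau, and delta is chosen so that this is below (r - delta)^s. *)
Lemma Lp_uniformly_convex : uniformly_convex (Lp mu (ltW s1)).
Proof.
move=> M0 e e0.
pose M := Num.max M0 1.
have M1 : 1 <= M by rewrite le_max lexx orbT.
have M00 : M0 <= M by rewrite le_max lexx.
have Mp : 0 < M by exact: lt_le_trans M1.
have Ms0 : 0 < M `^ s by exact: powR_gt0.
have Ms10 : 0 < M `^ (s - 1) by exact: powR_gt0.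
have es0 : 0 < e `^ s by exact: powR_gt0.
pose eta := e `^ s / (4 * M `^ s).
have eta0 : 0 < eta by rewrite divr_gt0// mulr_gt0.
have [C C0 CP] := Lp_midpoint_convexity eta0.
pose tau := e `^ s / (2 * C).
have tau0 : 0 < tau by rewrite divr_gt0// mulr_gt0.
pose delta := tau / (s * M `^ (s - 1)).
have delta0 : 0 < delta by rewrite divr_gt0// mulr_gt0.
exists delta => // r x y rM0 xr yr exy.
have rM : r <= M := le_trans rM0 M00.
have r0 : 0 <= r := le_trans (rnorm_ge0 x) xr.
have powR_le (a b : R) : 0 <= a -> a <= b -> a `^ s <= b `^ s.
  by move=> a0 ab; apply: ge0_ler_powR; rewrite ?nnegrE ?(ltW s0) ?(le_trans a0 ab).
have xs := powR_le _ _ (rnorm_ge0 x) xr.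
have ys := powR_le _ _ (rnorm_ge0 y) yr.
have es := powR_le _ _ (ltW e0) exy.
have rMs := powR_le _ _ r0 rM.
have := CP x y; move: (rnorm x `^ s) (rnorm y `^ s) (rnorm (x - y) `^ s) xs ys es => a b c.
move: (rnorm _) (rnorm_ge0 ((2^-1)%:C *: (x + y))) => m m0 ar br ec main.
have etaM : 4 * (eta * M `^ s) = e `^ s.
  by rewrite /eta; field; rewrite gt_eqF.
have Ctau : 2 * (C * tau) = e `^ s by rewrite /tau; field; rewrite gt_eqF.
have mtau : m `^ s <= r `^ s - tau.
  rewrite -(ler_pM2l C0) mulrBr.
  have k0 : 0 <= eta + C / 2 by apply: addr_ge0; [exact: ltW|rewrite divr_ge0// ltW].
  have h1 : (eta + C / 2) * (a + b) <= (eta + C / 2) * (2 * r `^ s).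
    by apply: ler_wpM2l => //; lra.
  have h2 := ler_wpM2l (ltW eta0) rMs.
  lra.
have dM : s * M `^ (s - 1) * delta = tau.
  by rewrite /delta; field; rewrite !gt_eqF.
have s10 : 0 <= s - 1 by rewrite subr_ge0 ltW.
have rM1 : r `^ (s - 1) <= M `^ (s - 1).
  by apply: ge0_ler_powR; rewrite ?nnegrE ?(ltW Mp).
have dr : delta <= r.
  rewrite -(ler_pM2l (mulr_gt0 s0 Ms10)) dM.
  have ms0 : 0 <= m `^ s by exact: powR_ge0.
  have h1 : r `^ s <= M `^ (s - 1) * r.
    by rewrite -(mulr_powRB1 r0 s0) mulrC ler_wpM2r.
  have h2 : M `^ (s - 1) * r <= s * (M `^ (s - 1) * r).
    by rewrite ler_peMl ?mulr_ge0 ?(ltW Ms10)// ltW.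
  rewrite -mulrA; lra.
have rd0 : 0 <= r - delta by rewrite subr_ge0.
have h1 : s * r `^ (s - 1) * delta <= tau.
  by rewrite -dM ler_wpM2r ?(ltW delta0)// ler_wpM2l// ltW.
have h2 : r - delta <= r by rewrite gerBl ltW.
have := powR_lipschitz s1 rd0 h2; rewrite opprB addrCA subrr addr0 => h3.
rewrite leNgt; apply/negP => rm.
have : (r - delta) `^ s < m `^ s by apply: gt0_ltr_powR; rewrite ?nnegrE.
lra.
Qed.

End Lp_convexity.

(** * Extension of a calculus from a dense subspace *)

Section dense_extension.
Context (R : realType) (X : normedModType R[i]) (sigma : set R).
Hypothesis sigma0 : sigma !=set0.
Hypothesis complX : complete_rnorm X.
Implicit Types (f g h : sigma -> R[i]) (x y u v : X).
Local Notation BV := (BV_fun sigma).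
Variable D : set X.
Hypothesis D_lin : forall (a : R[i]) u v, D u -> D v -> D (a *: u + v).
Hypothesis D_dense : forall x (e : R), 0 < e -> exists2 u, D u & rnorm (u - x) <= e.
Variable A : (sigma -> R[i]) -> X -> X.
Variable K : R.
Hypothesis K0 : 0 <= K.
Hypothesis A_le : forall f u, BV f -> D u -> rnorm (A f u) <= K * BVnorm f * rnorm u.
Hypothesis A_lin : forall f (a : R[i]) u v, BV f -> D u -> D v ->
  A f (a *: u + v) = a *: A f u + A f v.
Hypothesis A_D : forall f u, BV f -> D u -> D (A f u).
Hypothesis A_add : forall f g u, BV f -> BV g -> D u -> A (f + g) u = A f u + A g u.
Hypothesis A_scale : forall (a : R[i]) f u, BV f -> D u -> A (a *: f) u = a *: A f u.
Hypothesis A_mul : forall f g u, BV f -> BV g -> D u -> A (f * g) u = A f (A g u).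

Let C f := K * BVnorm f.

Let C_ge0 f : BV f -> 0 <= C f.
Proof. by move=> fBV; rewrite mulr_ge0// BVnorm_ge0. Qed.

Let D_sub u v : D u -> D v -> D (u - v).
Proof. by move=> Du Dv; rewrite addrC -scaleN1r; exact: D_lin. Qed.

Let A_sub f u v : BV f -> D u -> D v -> A f (u - v) = A f u - A f v.
Proof. by move=> fBV Du Dv; rewrite addrC -scaleN1r A_lin// scaleN1r addrC. Qed.

Let D0 : D 0.
Proof. by have [u Du _] := D_dense 0 ltr01; rewrite -(subrr u); exact: D_sub. Qed.

Let A0 f : BV f -> A f 0 = 0.
Proof. by move=> fBV; rewrite -[X in A f X](subrr (0 : X)) A_sub// subrr. Qed.

(** A characterization of the value at x of the continuous extension of A f that
    does not refer to a sequence tending to x. *)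
Definition continuous_value f x y :=
  forall u, D u -> rnorm (A f u - y) <= K * BVnorm f * rnorm (u - x).

Lemma continuous_value_exists f x : BV f -> exists y, continuous_value f x y.
Proof.
move=> fBV; have Cf := C_ge0 fBV; have C1 : 0 < C f + 1 by rewrite ltr_wpDl.
have n0 n : 0 < n.+1%:R^-1 :> R by rewrite invr_gt0.
have dense n : exists u, D u /\ rnorm (u - x) <= n.+1%:R^-1.
  by have [u Du ux] := D_dense x (n0 n); exists u.
have [u uP] := choice dense.
have uD n : D (u n) by have [] := uP n.
have small e : 0 < e -> exists N, forall n, (N <= n)%N -> rnorm (u n - x) <= e.
  move=> /invS_small[N NP]; exists N => n /NP; apply: le_trans.
  by have [] := uP n.
have [e e0|y yP] := @complX (fun n => A f (u n)).
  have e'0 : 0 < e / (2 * (C f + 1)) by rewrite divr_gt0// mulr_gt0.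
  have [N NP] := small _ e'0; exists N => n m Nn Nm.
  rewrite -A_sub//; apply: (le_trans (A_le fBV (D_sub (uD n) (uD m)))).
  have h : rnorm (u n - u m) <= 2 * (e / (2 * (C f + 1))).
    apply: (le_trans (rnorm_triangle x _ _)); rewrite [X in _ + X]rnormBC.
    by have := NP n Nn; have := NP m Nm; lra.
  apply: (@le_trans _ _ ((C f + 1) * (2 * (e / (2 * (C f + 1)))))).
    by apply: ler_pM; rewrite ?rnorm_ge0// lerDl.
  rewrite le_eqVlt; apply/orP; left; apply/eqP; field; rewrite gt_eqF//.
exists y => v Dv; apply/ler_addgt0Pr => e e0.
have e'0 : 0 < e / (C f + 1) by rewrite divr_gt0.
have [N1 N1P] := small _ e'0.
have [N2 N2P] := yP _ e'0.
pose n := maxn N1 N2.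
have h1 := N1P n (leq_maxl _ _); have h2 := N2P n (leq_maxr _ _).
apply: (le_trans (rnorm_triangle (A f (u n)) _ _)).
have h3 : rnorm (A f v - A f (u n)) <= C f * rnorm (v - x) + C f * (e / (C f + 1)).
  rewrite -A_sub// -mulrDr; apply: (le_trans (A_le fBV (D_sub Dv (uD n)))).
  apply: ler_wpM2l => //; apply: (le_trans (rnorm_triangle x _ _)).
  by rewrite lerD2l rnormBC.
have -> : e = C f * (e / (C f + 1)) + e / (C f + 1).
  by field; rewrite gt_eqF.
rewrite -/(C f); lra.
Qed.

Definition dense_ext f x : X := xget 0 (continuous_value f x).

Lemma dense_extP f x u : BV f -> D u ->
  rnorm (A f u - dense_ext f x) <= K * BVnorm f * rnorm (u - x).
Proof.
move=> fBV Du; have [y yP] := continuous_value_exists x fBV.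
exact: (xgetI 0 yP).
Qed.

Lemma dense_ext_le f x : BV f -> rnorm (dense_ext f x) <= K * BVnorm f * rnorm x.
Proof.
move=> fBV; have := dense_extP x fBV D0.
by rewrite A0// !sub0r !rnormN.
Qed.

Lemma dense_ext_lin f (a : R[i]) x y : BV f ->
  dense_ext f (a *: x + y) = a *: dense_ext f x + dense_ext f y.
Proof.
move=> fBV; have Cf := C_ge0 fBV; have a0 := normc_ge0 a.
have c0 : 0 <= 2 * C f * (normc a + 1).
  by apply: mulr_ge0; [exact: mulr_ge0|exact: addr_ge0].
apply: (rnorm_eq_of_small c0) => e e0.
have [u Du ux] := D_dense x e0; have [v Dv vy] := D_dense y e0.
have h1 := dense_extP (a *: x + y) fBV (D_lin a Du Dv).
have h2 := dense_extP x fBV Du; have h3 := dense_extP y fBV Dv.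
have n1 : rnorm (a *: u + v - (a *: x + y)) <= normc a * e + e.
  rewrite opprD addrACA -scalerBr (le_trans (rnormD _ _))// lerD//.
  by rewrite rnormZ ler_wpM2l.
apply: (le_trans (rnorm_triangle (A f (a *: u + v)) _ _)); rewrite rnormBC.
have n2 : rnorm (A f (a *: u + v) - (a *: dense_ext f x + dense_ext f y)) <=
    normc a * (C f * e) + C f * e.
  rewrite A_lin// opprD addrACA -scalerBr (le_trans (rnormD _ _))// rnormZ.
  apply: lerD; last by apply: (le_trans h3); exact: ler_wpM2l.
  by apply: ler_wpM2l => //; apply: (le_trans h2); exact: ler_wpM2l.
have := ler_wpM2l Cf n1; rewrite /C in n2 *; lra.
Qed.

Lemma dense_extD f g x : BV f -> BV g ->
  dense_ext (f + g) x = dense_ext f x + dense_ext g x.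
Proof.
move=> fBV gBV; have fgBV := BV_funD sigma0 fBV gBV.
have c0 : 0 <= C (f + g) + (C f + C g).
  by apply: addr_ge0; [|apply: addr_ge0]; exact: C_ge0.
apply: (rnorm_eq_of_small c0) => e e0; have [u Du ux] := D_dense x e0.
apply: (le_trans (rnorm_triangle (A (f + g) u) _ _)); rewrite rnormBC mulrDl.
apply: lerD.
  by apply: (le_trans (dense_extP x fgBV Du)); apply: ler_wpM2l => //; exact: C_ge0.
rewrite A_add// opprD addrACA (le_trans (rnormD _ _))// mulrDl lerD//.
  by apply: (le_trans (dense_extP x fBV Du)); apply: ler_wpM2l => //; exact: C_ge0.
by apply: (le_trans (dense_extP x gBV Du)); apply: ler_wpM2l => //; exact: C_ge0.
Qed.

Lemma dense_extZ (a : R[i]) f x : BV f -> dense_ext (a *: f) x = a *: dense_ext f x.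
Proof.
move=> fBV; have afBV := BV_funZ sigma0 a fBV; have a0 := normc_ge0 a.
have c0 : 0 <= C (a *: f) + normc a * C f.
  by apply: addr_ge0; [exact: C_ge0|apply: mulr_ge0 => //; exact: C_ge0].
apply: (rnorm_eq_of_small c0) => e e0; have [u Du ux] := D_dense x e0.
apply: (le_trans (rnorm_triangle (A (a *: f) u) _ _)); rewrite rnormBC mulrDl.
apply: lerD.
  by apply: (le_trans (dense_extP x afBV Du)); apply: ler_wpM2l => //; exact: C_ge0.
rewrite A_scale// -scalerBr rnormZ -mulrA ler_wpM2l//.
by apply: (le_trans (dense_extP x fBV Du)); apply: ler_wpM2l => //; exact: C_ge0.
Qed.

Lemma dense_extM f g x : BV f -> BV g ->
  dense_ext (f * g) x = dense_ext f (dense_ext g x).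
Proof.
move=> fBV gBV; have fgBV := BV_funM sigma0 fBV gBV.
have c0 : 0 <= C (f * g) + C f * C g.
  by apply: addr_ge0; [exact: C_ge0|apply: mulr_ge0 => //; exact: C_ge0].
apply: (rnorm_eq_of_small c0) => e e0; have [u Du ux] := D_dense x e0.
apply: (le_trans (rnorm_triangle (A (f * g) u) _ _)); rewrite rnormBC mulrDl.
apply: lerD.
  by apply: (le_trans (dense_extP x fgBV Du)); apply: ler_wpM2l => //; exact: C_ge0.
rewrite A_mul//; apply: (le_trans (dense_extP _ fBV (A_D gBV Du))).
rewrite -(mulrA (C f)); apply: ler_wpM2l; first exact: C_ge0.
by apply: (le_trans (dense_extP x gBV Du)); apply: ler_wpM2l => //; exact: C_ge0.
Qed.

Lemma dense_ext_hom : algebra_hom BV dense_ext.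
Proof.
split.
- move=> f fBV; split; first by move=> a x y; exact: dense_ext_lin.
  by exists (C f) => x; exact: dense_ext_le.
- by move=> f g fBV gBV x; exact: dense_extD.
- by move=> a f fBV x; exact: dense_extZ.
- by move=> f g fBV gBV x; exact: dense_extM.
Qed.

Lemma dense_ext_norm_continuous : Defs.norm_continuous BV dense_ext.
Proof.
move=> f fBV e e0; have K1 : 0 < K + 1 by rewrite ltr_wpDl.
exists (e / (K + 1)); first exact: divr_gt0.
move=> g gBV gf.
have gfBV := BV_funB sigma0 gBV fBV.
apply: (@le_lt_trans _ _ (K * BVnorm (g - f))).
  apply: opnorm_le => [|x]; first exact: C_ge0.
  have -> : (dense_ext g \- dense_ext f) x = dense_ext (g - f) x.
    rewrite -[LHS]/(dense_ext g x - dense_ext f x) dense_extD//; last exact: BV_funN.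
    by rewrite -(scaleN1r f) dense_extZ// scaleN1r.
  exact: dense_ext_le.
apply: (@le_lt_trans _ _ ((K + 1) * BVnorm (g - f))).
  by rewrite ler_wpM2r ?BVnorm_ge0// lerDl.
by rewrite mulrC -ltr_pdivlMr.
Qed.

End dense_extension.

(** * Transfer from L^s to L^1 *)

Lemma calculus_bound (R : realType) (X : normedModType R[i]) (sigma : set R)
  (T : X -> X) (Phi : (sigma -> R[i]) -> X -> X) :
  sigma !=set0 -> AC_functional_calculus T Phi ->
  exists2 K : R, 0 <= K &
    forall h x, AC_fun sigma h -> rnorm (Phi h x) <= K * BVnorm h * rnorm x.
Proof.
move=> sigma0 [hom [K KP] _ _]; exists `|K| => // h x hAC.
have h0 := BVnorm_ge0 sigma0 (AC_BV hAC).
apply: (le_trans (rnorm_opnorm x (algebra_hom_bounded hom hAC))).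
apply: ler_wpM2r; first exact: rnorm_ge0.
by apply: (le_trans (KP _ hAC)); rewrite ler_wpM2r// ler_norm.
Qed.

Lemma compact_bounded_closed (R : realType) (sigma : set R) : compact sigma ->
  closed sigma /\ exists B : R, forall s : sigma, `|\val s| <= B.
Proof.
move=> sc; split; first exact: compact_closed.
have [M [_ MP]] := compact_bounded sc.
exists (M + 1) => s; apply: (MP (M + 1)); first by rewrite ltrDl.
exact: set_mem (valP s).
Qed.

Section transfer.
Context (R : realType) (d : measure_display) (Omega : measurableType d).
Variable mu : {measure set Omega -> \bar R}.
Variable sigma : set R.
Hypothesis sigma0 : sigma !=set0.
Hypothesis sigma_bounded : exists B : R, forall s : sigma, `|\val s| <= B.
Variable T : linear_transformation mu.
Implicit Types f g h : sigma -> R[i].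

(** Both calculi send a polynomial r to r(T). *)
Lemma poly_calculus_consistent (p q : R) (p1 : 1 <= p) (q1 : 1 <= q)
  (Tp : defines_bounded_operator p T) (Tq : defines_bounded_operator q T)
  (Phi : (sigma -> R[i]) -> _ -> _) (Psi : (sigma -> R[i]) -> _ -> _) :
  AC_functional_calculus (Lp_restriction p1 Tp) Phi ->
  AC_functional_calculus (Lp_restriction q1 Tq) Psi ->
  forall r (x : Lp mu p1) (y : Lp mu q1), Lp_val x = Lp_val y ->
    Lp_val (Phi (poly_fun sigma r) x) = Lp_val (Psi (poly_fun sigma r) y).
Proof.
move=> [homP _ P1 PX] [homQ _ Q1 QX].
elim/poly_ind => [|r c IH] x y xy.
  have -> : poly_fun sigma 0 = 0 *: poly_fun sigma 1 by rewrite -poly_funZ scale0r.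
  have AC1 := AC_poly sigma0 sigma_bounded 1.
  by rewrite (algebra_homZ homP)// (algebra_homZ homQ)// !scale0r.
have ACr := AC_poly sigma0 sigma_bounded r.
have ACX := AC_poly sigma0 sigma_bounded 'X.
have AC1 := AC_poly sigma0 sigma_bounded 1.
have ACc : AC_fun sigma (c *: poly_fun sigma 1) by exact: AC_funZ.
have ACrX : AC_fun sigma (poly_fun sigma r * poly_fun sigma 'X) by exact: AC_funM.
have -> : poly_fun sigma (r * 'X + c%:P) =
    poly_fun sigma r * poly_fun sigma 'X + c *: poly_fun sigma 1.
  by rewrite poly_funD poly_funM -poly_funZ -alg_polyC.
rewrite (algebra_homD homP)// (algebra_homD homQ)// (algebra_homM homP)//.
rewrite (algebra_homM homQ)// (algebra_homZ homP)// (algebra_homZ homQ)//.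
rewrite !Lp_valD !Lp_valZ P1 Q1 xy; congr (_ + _); apply: IH.
by rewrite PX QX /= xy.
Qed.

(** Polynomials approximating h give the same vectors in both spaces, converging in
    one norm to the first value and in the other to the second. *)
Lemma AC_calculus_consistent (p q : R) (p1 : 1 <= p) (q1 : 1 <= q)
  (Tp : defines_bounded_operator p T) (Tq : defines_bounded_operator q T)
  (Phi : (sigma -> R[i]) -> _ -> _) (Psi : (sigma -> R[i]) -> _ -> _) :
  AC_functional_calculus (Lp_restriction p1 Tp) Phi ->
  AC_functional_calculus (Lp_restriction q1 Tq) Psi ->
  forall h (x : Lp mu p1) (y : Lp mu q1), AC_fun sigma h -> Lp_val x = Lp_val y ->
    Lp_val (Phi h x) = Lp_val (Psi h y).
Proof.
move=> cP cQ h x y hAC xy.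
have n0 n : 0 < n.+1%:R^-1 :> R by rewrite invr_gt0.
have [r rP] := choice (fun n => hAC.2 _ (n0 n)).
have small (e C : R) : 0 < e -> 0 <= C -> exists N : nat, forall n, (N <= n)%N ->
    C * BVnorm (h - poly_fun sigma (r n)) <= e.
  move=> e0 C0; have C1 : 0 < C + 1 by rewrite ltr_wpDl.
  have [N NP] := invS_small (divr_gt0 e0 C1); exists N => n /NP n1.
  apply: (@le_trans _ _ ((C + 1) * (e / (C + 1)))); last first.
    by rewrite mulrCA divff ?mulr1 ?gt_eqF.
  apply: ler_pM; rewrite ?lerDl// ?(le_trans (ltW (rP n)))//.
  exact: BVnorm_ge0 (BV_funB sigma0 (AC_BV hAC) (BV_poly sigma0 sigma_bounded _)).
have [K K0 KP] := calculus_bound sigma0 cP.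
have [L L0 LP] := calculus_bound sigma0 cQ.
have ACr n := AC_poly sigma0 sigma_bounded (r n).
apply: (@L0lim_unique _ _ _ mu p q (fun n => Lp_val (Phi (poly_fun sigma (r n)) x))) => //.
  move=> e e0; have [N NP] := small e (K * rnorm x) e0 (mulr_ge0 K0 (rnorm_ge0 x)).
  exists N => n /NP h1; rewrite L0normBC// -rnorm_LpB lee_fin.
  rewrite -(Phi_sub sigma0 sigma_bounded (AC_calculus_hom cP))//.
  apply: le_trans h1; rewrite mulrAC; apply: KP; exact: AC_funB.
move=> e e0; have [N NP] := small e (L * rnorm y) e0 (mulr_ge0 L0 (rnorm_ge0 y)).
exists N => n /NP h1; rewrite (poly_calculus_consistent cP cQ _ xy).
rewrite L0normBC// -rnorm_LpB lee_fin.
rewrite -(Phi_sub sigma0 sigma_bounded (AC_calculus_hom cQ))//.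
apply: le_trans h1; rewrite mulrAC; apply: LP; exact: AC_funB.
Qed.

End transfer.

Theorem corollary3p4 (R : realType) (d : measure_display)
  (Omega : measurableType d) (mu : {measure set Omega -> \bar R})
  (sigma : set R) (sigma_neq0 : sigma !=set0) (sigma_compact : compact sigma)
  (T : linear_transformation mu) (s : R) (s_gt1 : 1 < s)
  (T1 : defines_bounded_operator 1 T) (Ts : defines_bounded_operator s T) :
  real_AC_operator sigma (Lp_restriction (lexx 1) T1) ->
  real_AC_operator sigma (Lp_restriction (ltW s_gt1) Ts) ->
  has_BV_functional_calculus sigma (Lp_restriction (lexx 1) T1).
Proof.
move=> [_ [Phi cP]] [_ [Phis cS]].
have [sigma_closed sigma_bounded] := compact_bounded_closed sigma_compact.
have [K K0 KP] := calculus_bound sigma_neq0 cP.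
have [L L0 LP] := calculus_bound sigma_neq0 cS.
have homP := AC_calculus_hom cP; have homS := AC_calculus_hom cS.
have ucX := Lp_uniformly_convex mu s_gt1.
have complX := @Lp_complete_rnorm _ Omega R mu s (ltW s_gt1).
pose Psis := BV_extension Phis.
have homPsis : algebra_hom (BV_fun sigma) Psis.
  exact: (BV_extension_hom sigma_neq0 sigma_bounded sigma_closed homS L0 LP ucX complX).
have Psis_lin f a x y : BV_fun sigma f -> Psis f (a *: x + y) = a *: Psis f x + Psis f y.
  by move=> fBV; have [] := algebra_hom_bounded homPsis fBV.
pose s1 := ltW s_gt1.
have lift u : in_Lp s u -> u \in @Lp_pred _ _ _ mu s s1 by move=> /Lp_predP.
have lift1 u : in_Lp 1 u -> u \in @Lp_pred _ _ _ mu 1 (lexx 1) by move=> /Lp_predP.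
pose D : set (Lp mu (lexx (1 : R))) := [set x | in_Lp s (Lp_val x)].
(* On vectors common to L^1 and L^s, the operator f(T_s) is bounded for the norm of
   L^1, by lower semicontinuity of this norm along limits in L^s. *)
have bound f (u : Lp mu (lexx (1 : R))) (v : Lp mu s1) : BV_fun sigma f ->
    Lp_val u = Lp_val v ->
    (L0norm 1 (Lp_val (Psis f v)) <= (2 * K * BVnorm f * rnorm u)%:E)%E.
  move=> fBV uv.
  have n0 n : 0 < n.+1%:R^-1 :> R by rewrite invr_gt0.
  have [h hP] := choice (fun n => BV_extension_approx sigma_neq0 sigma_bounded
    sigma_closed homS L0 LP ucX complX v fBV (n0 n)).
  have C0 : 0 <= 2 * K * BVnorm f * rnorm u.
    by rewrite !mulr_ge0 ?rnorm_ge0 ?BVnorm_ge0.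
  apply: (@L0norm_lsc _ _ _ mu s 1 (fun n => Lp_val (Phis (h n) v))) => // [e e0|n].
    have [N NP] := invS_small e0; exists N; have [_ _] := hP N.
    rewrite -lee_fin rnorm_LpB => /le_trans; apply; rewrite lee_fin.
    exact: NP.
  have [hAC hM _] := hP n.
  rewrite -(AC_calculus_consistent sigma_neq0 sigma_bounded cP cS hAC uv).
  rewrite -rnorm_Lp lee_fin; apply: (le_trans (KP _ _ hAC)).
  rewrite ler_wpM2r ?rnorm_ge0// (mulrC 2) -mulrA ler_wpM2l//.
(* The operator f(T_s), seen as acting on the vectors of L^1 that are in L^s. *)
pose P f (u w : Lp mu (lexx (1 : R))) := exists2 v : Lp mu s1,
  Lp_val v = Lp_val u & Lp_val w = Lp_val (Psis f v).
pose A f (u : Lp mu (lexx (1 : R))) := xget 0 (P f u).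
have AP f u : BV_fun sigma f -> D u -> P f u (A f u).
  move=> fBV Du; pose v : Lp mu s1 := MkLp (lift _ Du).
  have w1 : in_Lp 1 (Lp_val (Psis f v)).
    by apply: (le_lt_trans (bound f u v fBV erefl)); exact: ltry.
  have Pw : P f u (MkLp (lift1 _ w1)) by exists v.
  exact: (xgetI 0 Pw).
have Aval f (u : Lp mu (lexx (1 : R))) (v : Lp mu s1) : BV_fun sigma f ->
    Lp_val v = Lp_val u -> Lp_val (A f u) = Lp_val (Psis f v).
  move=> fBV vu; have Du : D u by rewrite /D /= -vu; exact: Lp_lty.
  have [v' v'u ->] := AP f u fBV Du.
  by congr (Lp_val (Psis f _)); apply: val_inj; rewrite /= v'u vu.
have D_lin (a : R[i]) u v : D u -> D v -> D (a *: u + v).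
  move=> Du Dv; suff : in_Lp s (Lp_val (a *: u + v)) by [].
  rewrite Lp_valD Lp_valZ.
  exact: (Lp_lty (a *: (MkLp (lift _ Du) : Lp mu s1) + MkLp (lift _ Dv))).
have D_dense x e : 0 < e -> exists2 u, D u & rnorm (u - x) <= e.
  move=> e0; have [v [v1 vs ve]] := L1_truncation s_gt1 (Lp_lty x) e0.
  exists (MkLp (lift1 _ v1)) => //.
  by rewrite rnormBC -lee_fin rnorm_LpB.
have pick u : D u -> exists v : Lp mu s1, Lp_val v = Lp_val u.
  by move=> Du; exists (MkLp (lift _ Du)).
have A_le f u : BV_fun sigma f -> D u -> rnorm (A f u) <= 2 * K * BVnorm f * rnorm u.
  move=> fBV /pick[v vu]; rewrite -lee_fin rnorm_Lp (Aval f u v fBV vu).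
  exact: bound.
have A_lin f a u v : BV_fun sigma f -> D u -> D v ->
    A f (a *: u + v) = a *: A f u + A f v.
  move=> fBV Du Dv; have [u' u'u] := pick u Du; have [v' v'v] := pick v Dv.
  have uv : Lp_val (a *: u' + v') = Lp_val (a *: u + v).
    by rewrite !Lp_valD !Lp_valZ u'u v'v.
  apply: val_inj; rewrite /= (Aval f _ _ fBV uv) Psis_lin// !Lp_valD !Lp_valZ.
  by rewrite (Aval f u u')// (Aval f v v').
have A_D f u : BV_fun sigma f -> D u -> D (A f u).
  by move=> fBV Du; have [v vu] := pick u Du; rewrite /D /= (Aval f u v)//; exact: Lp_lty.
have A_add f g u : BV_fun sigma f -> BV_fun sigma g -> D u ->
    A (f + g) u = A f u + A g u.
  move=> fBV gBV Du; have [v vu] := pick u Du; apply: val_inj.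
  rewrite /= (Aval _ _ _ (BV_funD sigma_neq0 fBV gBV) vu) (algebra_homD homPsis)//.
  by rewrite !Lp_valD (Aval f u v)// (Aval g u v).
have A_scale a f u : BV_fun sigma f -> D u -> A (a *: f) u = a *: A f u.
  move=> fBV Du; have [v vu] := pick u Du; apply: val_inj.
  rewrite /= (Aval _ _ _ (BV_funZ sigma_neq0 a fBV) vu) (algebra_homZ homPsis)//.
  by rewrite !Lp_valZ (Aval f u v).
have A_mul f g u : BV_fun sigma f -> BV_fun sigma g -> D u ->
    A (f * g) u = A f (A g u).
  move=> fBV gBV Du; have [v vu] := pick u Du; apply: val_inj.
  rewrite /= (Aval _ _ _ (BV_funM sigma_neq0 fBV gBV) vu) (algebra_homM homPsis)//.
  by rewrite (Aval f (A g u) (Psis g v))// (Aval g u v).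
have complX1 := @Lp_complete_rnorm _ Omega R mu 1 (lexx 1).
have K20 : 0 <= 2 * K by rewrite mulr_ge0.
exists Phi => //; exists (dense_ext D A (2 * K)); split.
- exact: dense_ext_hom.
- exact: dense_ext_norm_continuous.
move=> h hAC x; have hBV := AC_BV hAC.
have c0 : 0 <= 2 * K * BVnorm h + K * BVnorm h.
  by rewrite addr_ge0 ?mulr_ge0 ?BVnorm_ge0.
apply: (rnorm_eq_of_small c0) => e e0; have [u Du ux] := D_dense x e e0.
have [v vu] := pick u Du.
have Ah : A h u = Phi h u.
  apply: val_inj; rewrite /= (Aval h u v)//.
  rewrite /Psis (BV_extension_AC sigma_neq0 sigma_bounded sigma_closed homS L0
    LP ucX complX)//.
  exact/esym/(AC_calculus_consistent sigma_neq0 sigma_bounded cP cS hAC (esym vu)).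
apply: (le_trans (rnorm_triangle (A h u) _ _)); rewrite rnormBC [leRHS]mulrDl.
apply: lerD.
  apply: (le_trans (dense_extP sigma_neq0 complX1 D_lin D_dense K20 A_le A_lin x hBV Du)).
  by apply: ler_wpM2l => //; rewrite mulr_ge0// BVnorm_ge0.
rewrite Ah -(Phi_subr homP)//; apply: (le_trans (KP _ _ hAC)).
by apply: ler_wpM2l => //; rewrite mulr_ge0// BVnorm_ge0.
Qed.
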